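(* Let $n\ge1$ and let $B_n=\mathbb{Z}_2\wr\mathfrak{S}_n$ be the hyperoctahedral group. There is an isomorphism of ungraded $B_n$-modules $$SR_{n,2}\cong\mathbb{C}[\mathcal{OP}^B_n]\otimes\det .$$
   Context: $B_n=\mathbb{Z}_2\wr\mathfrak{S}_n\subseteq GL_n(\mathbb{C})$ is the group of $n\times n$ signed permutation matrices (monomial matrices with nonzero entries $\pm1$); $\det$ is its one-dimensional determinant module. $\Omega=\mathbb{C}[x_1,\dots,x_n]\otimes\wedge\{\theta_1,\dots,\theta_n\}$ is the unital associative $\mathbb{C}$-algebra generated by $x_i,\theta_i$ with relations $x_ix_j=x_jx_i$, $x_i\theta_j=\theta_jx_i$, $\theta_i\theta_j=-\theta_j\theta_i$. $B_n$ acts on $\Omega$ by algebra automorphisms: $\mathrm{diag}(\epsilon_1,\dots,\epsilon_n)$ with $\epsilon_i=\pm1$ sends $x_i\mapsto\epsilon_ix_i$, $\theta_i\mapsto\epsilon_i\theta_i$, and a permutation matrix $w$ sends $x_i\mapsto x_{w(i)}$, $\theta_i\mapsto\theta_{w(i)}$. $SR_{n,2}:=\Omega/SI_{n,2}$, where $SI_{n,2}$ is the two-sided ideal generated by all $B_n$-invariants with vanishing constant term. The $B_n$-reflection arrangement in $\mathbb{R}^n$ consists of the hyperplanes $x_i\pm x_j=0$ ($1\le i<j\le n$) and $x_i=0$ ($1\le i\le n$). These hyperplanes partition $\mathbb{R}^n$ into (relatively open) faces of various dimensions; $\mathcal{OP}^B_n$ is the set of all these faces (the type B Coxeter complex). $B_n$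 acts on $\mathbb{R}^n$ by matrix multiplication and hence permutes $\mathcal{OP}^B_n$; $\mathbb{C}[\mathcal{OP}^B_n]$ is the resulting permutation module. *)

(* Defs.v *)
From HB Require Import structures.
From mathcomp Require Import boolp classical_sets reals.
From mathcomp Require Import all_boot all_order all_algebra all_fingroup.
From mathcomp Require Import generic_quotient.
From mathcomp.real_closed Require Import complex.
From mathcomp Require Import mpoly.

Set Implicit Arguments.
Unset Strict Implicit.
Unset Printing Implicit Defensive.

Import Order.TTheory GRing.Theory Num.Theory.

Local Open Scope ring_scope.
Local Open Scope quotient_scope.

Section SignedPermutationMatrices.
Variable n : nat.
Implicit Types A : 'M[int]_n.

Definition signed_perm_mx A : bool :=
  [&& [forall i, forall j, A i j \in [:: 0; 1; -1]],
      [forall i, #|[set j | A i j != 0]| == 1%N]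
    & [forall j, #|[set i | A i j != 0]| == 1%N]].

Lemma signed_perm_mxP A :
  reflect (exists (s : 'S_n) (e : 'I_n -> bool),
             A = \matrix_(i, j) ((-1) ^+ e i *+ (s i == j)))
          (signed_perm_mx A).
Proof.
apply: (iffP and3P) => [[/forallP h01 /forallP hr /forallP hc]|].
  have ex_s i : exists j, [set k | A i k != 0] = [set j] by apply/cards1P/hr.
  have [s hs] := fin_all_exists ex_s.
  have Anz i j : (A i j != 0) = (s i == j).
    by have /setP/(_ j) := hs i; rewrite !inE [s i == j]eq_sym.
  have s_inj : injective s.
    move=> i k eq_s; have /cards1P [l /setP hl] := hc (s i).
    have := hl i; have := hl k.
    by rewrite !inE !Anz eq_s eqxx => /esym/eqP-> /esym/eqP->.
  exists (perm s_inj), (fun i => A i (s i) == -1).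
  apply/matrixP=> i j; rewrite mxE permE -Anz.
  have [->//|nz] := eqVneq (A i j) 0.
  have -> : s i = j by apply/eqP; rewrite -Anz.
  have /forallP/(_ j) := h01 i; rewrite !inE (negPf nz) /=.
  by case/orP=> /eqP ->.
case=> s [e ->]; have nzE i j :
  ((\matrix_(k, l) ((-1) ^+ e k *+ (s k == l)) : 'M[int]_n) i j != 0)
    = (s i == j).
  by rewrite mxE; case: (s i == j); rewrite ?eqxx // mulr1n signr_eq0.
split; apply/forallP=> i.
- apply/forallP=> j; rewrite mxE !inE.
  by case: (s i == j) => //; case: (e i).
- apply/cards1P; exists (s i); apply/setP=> j.
  by rewrite !inE nzE [s i == j]eq_sym.
- apply/cards1P; exists (s^-1%g i); apply/setP=> j.
  by rewrite !inE nzE (canF_eq (permK s)).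
Qed.

Lemma signed_perm_mx1 : signed_perm_mx 1%:M.
Proof.
apply/signed_perm_mxP; exists 1%g, (fun=> false).
by apply/matrixP=> i j; rewrite !mxE perm1.
Qed.

Lemma signed_perm_mxM A B :
  signed_perm_mx A -> signed_perm_mx B -> signed_perm_mx (A *m B).
Proof.
move=> /signed_perm_mxP [s [e ->]] /signed_perm_mxP [t [f ->]].
apply/signed_perm_mxP; exists (s * t)%g, (fun i => e i (+) f (s i)).
apply/matrixP=> i j; rewrite !mxE (bigD1 (s i)) //= big1 ?addr0.
  by rewrite !mxE eqxx permM mulr1n mulrnAr signr_addb.
by move=> k nk; rewrite !mxE eq_sym (negPf nk) mul0r.
Qed.

Lemma signed_perm_mx_tr A : signed_perm_mx A -> signed_perm_mx A^T.
Proof.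
move=> /signed_perm_mxP [s [e ->]]; apply/signed_perm_mxP.
exists (s^-1)%g, (fun j => e (s^-1 j)%g).
apply/matrixP=> i j; rewrite !mxE (canF_eq (permK s)) eq_sym.
by case: eqP => // <-.
Qed.

Lemma mulmxtr_signed A : signed_perm_mx A -> A *m A^T = 1%:M.
Proof.
move=> /signed_perm_mxP [s [e ->]]; apply/matrixP=> i j.
rewrite !mxE (bigD1 (s i)) //= big1 ?addr0.
  rewrite !mxE eqxx mulr1n (inj_eq perm_inj) [j == i]eq_sym.
  by case: eqP => [->|]; rewrite ?mulr0 // mulr1n -expr2 sqrr_sign.
by move=> k nk; rewrite !mxE eq_sym (negPf nk) mul0r.
Qed.

End SignedPermutationMatrices.

(* The matrices have integer entries, so that they map both to complex matrices
   (acting on superspace) and to real ones (acting on points). *)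
Record hyperoctahedral (n : nat) := HyperOct {
  hyp_mx :> 'M[int]_n;
  hyp_mxP : signed_perm_mx hyp_mx }.

HB.instance Definition _ n := [isSub for @hyp_mx n].
HB.instance Definition _ n := [Countable of hyperoctahedral n by <:].

Section HyperoctahedralGroup.
Variable n : nat.
Local Notation B := (hyperoctahedral n).
Implicit Types g h : B.

Definition hyp_one : B := HyperOct (signed_perm_mx1 n).
Definition hyp_mul g h : B := HyperOct (signed_perm_mxM (hyp_mxP g) (hyp_mxP h)).
Definition hyp_inv g : B := HyperOct (signed_perm_mx_tr (hyp_mxP g)).

Lemma hyp_mulA : associative hyp_mul.
Proof. by move=> g h k; apply/val_inj/mulmxA. Qed.
Lemma hyp_mul1 : left_id hyp_one hyp_mul.
Proof. by move=> g; apply/val_inj/mul1mx. Qed.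
Lemma hyp_mulr1 : right_id hyp_one hyp_mul.
Proof. by move=> g; apply/val_inj/mulmx1. Qed.
Lemma hyp_mulrV : right_inverse hyp_one hyp_inv hyp_mul.
Proof. by move=> g; apply/val_inj/mulmxtr_signed/hyp_mxP. Qed.
Lemma hyp_mulV : left_inverse hyp_one hyp_inv hyp_mul.
Proof.
move=> g; have -> : hyp_mul (hyp_inv g) g = hyp_mul (hyp_inv g) (hyp_inv (hyp_inv g)).
  by congr hyp_mul; apply/val_inj; rewrite /= trmxK.
exact: hyp_mulrV.
Qed.

Definition hyp_signs g : {ffun 'I_n * 'I_n -> option bool} :=
  [ffun ij => if hyp_mx g ij.1 ij.2 == 0 then None
              else Some (hyp_mx g ij.1 ij.2 == 1)].

Definition hyp_of_signs (f : {ffun 'I_n * 'I_n -> option bool}) : option B :=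
  insub (\matrix_(i, j) if f (i, j) is Some b then (-1) ^+ ~~ b else 0).

Lemma hyp_signsK : pcancel hyp_signs hyp_of_signs.
Proof.
move=> g; rewrite /hyp_of_signs; set A := (X in insub X).
suff -> : A = hyp_mx g by rewrite -[hyp_mx g]/(val g) valK.
apply/matrixP=> i j; rewrite !mxE !ffunE /=.
have /and3P [/forallP/(_ i)/forallP/(_ j) + _ _] := hyp_mxP g.
by rewrite !inE => /or3P [] /eqP->.
Qed.

HB.instance Definition _ : isFinite B := PCanIsFinite hyp_signsK.
HB.instance Definition _ := isGroup.Build B
  hyp_mulA hyp_mul1 hyp_mulr1 hyp_mulV hyp_mulrV.

End HyperoctahedralGroup.

Record gmodule (F : fieldType) (gT : finGroupType) := GModule {
  gmod_sort :> lmodType F;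
  gact : gT -> gmod_sort -> gmod_sort;
  gact_linear : forall g, linear (gact g);
  gact1 : forall v, gact 1%g v = v;
  gactM : forall g h v, gact (g * h)%g v = gact g (gact h v) }.

Definition gmod_iso (F : fieldType) (gT : finGroupType) (V W : gmodule F gT) :=
  exists f : {linear V -> W},
    bijective f /\ forall g v, f (gact g v) = gact g (f v).

Section Twist.
Variables (F : fieldType) (gT : finGroupType) (V : gmodule F gT).
Variables (chi : gT -> F) (chi1 : chi 1%g = 1).
Hypothesis chiM : forall g h, chi (g * h)%g = chi g * chi h.

Definition twist_act (g : gT) (v : V) : V := chi g *: gact g v.

Lemma twist_act_linear g : linear (twist_act g).
Proof.
by move=> a u v; rewrite /twist_act gact_linear scalerDr !scalerA mulrC.
Qed.
Lemma twist_act1 v : twist_act 1%g v = v.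
Proof. by rewrite /twist_act chi1 gact1 scale1r. Qed.
Lemma gactZ g a (v : V) : gact g (a *: v) = a *: gact g v.
Proof.
have g0 : gact g (0 : V) = 0.
  have := gact_linear g 1 (0 : V) 0; rewrite !scale1r addr0 => /eqP.
  by rewrite -subr_eq subrr => /eqP.
by rewrite -[X in gact g X]addr0 gact_linear g0 addr0.
Qed.
Lemma twist_actM g h v : twist_act (g * h)%g v = twist_act g (twist_act h v).
Proof. by rewrite /twist_act gactZ scalerA chiM gactM. Qed.

(* The tensor product of V with the one-dimensional module on which g acts by
   chi g, carried over to V along v (x) c |-> c *: v (see gmod_twistE). *)
Definition gmod_twist : gmodule F gT :=
  GModule twist_act_linear twist_act1 twist_actM.

Lemma gmod_twistE g c (v : V) :
  gact g (c *: v : gmod_twist) = (chi g * c) *: gact g v.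
Proof. by rewrite /= /twist_act gactZ scalerA. Qed.
End Twist.

Section PermutationModule.
Variables (F : fieldType) (gT : finGroupType) (X : finType).
Variables (to : gT -> X -> X) (to1 : forall x, to 1%g x = x).
Hypothesis toM : forall g h x, to (g * h)%g x = to g (to h x).

(* f : {ffun X -> F^o} stands for the formal sum of the f x times x, so that g
   sends the basis vector of x to that of to g x. *)
Definition perm_act (g : gT) (f : {ffun X -> F^o}) : {ffun X -> F^o} :=
  [ffun x => f (to g^-1%g x)].

Lemma perm_act_linear g : linear (perm_act g).
Proof. by move=> a u v; apply/ffunP=> x; rewrite !ffunE. Qed.
Lemma perm_act1 f : perm_act 1%g f = f.
Proof. by apply/ffunP=> x; rewrite !ffunE invg1 to1. Qed.
Lemma perm_actM g h f : perm_act (g * h)%g f = perm_act g (perm_act h f).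
Proof. by apply/ffunP=> x; rewrite !ffunE invMg toM. Qed.

Lemma perm_act_basis g x :
  perm_act g [ffun y => (y == x)%:R] = [ffun y => (y == to g x)%:R].
Proof.
apply/ffunP=> y; rewrite !ffunE; congr (_ %:R); congr nat_of_bool.
by apply/eqP/eqP => [<-|->]; rewrite -toM ?mulgV ?mulVg to1.
Qed.

Definition perm_gmodule : gmodule F gT :=
  GModule perm_act_linear perm_act1 perm_actM.
End PermutationModule.

Section Superspace.
Variables (F : numFieldType) (n : nat).
Implicit Types S T U X : {set 'I_n}.

(* f stands for the sum over S of f S * theta_S, where theta_S is the product
   of the theta_i, i \in S, in increasing order of i. *)
Definition superspace := {ffun {set 'I_n} -> {mpoly F[n]}}.
HB.instance Definition _ := GRing.Lmodule.on superspace.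
Implicit Types f g h : superspace.

Definition inversions S T : nat := \sum_(i in S) \sum_(j in T) (j < i)%N.

(* theta_S * theta_T = theta_sign S T *: theta_(S :|: T) *)
Definition theta_sign S T : F :=
  if [disjoint S & T] then (-1) ^+ inversions S T else 0.

(* p * theta_S *)
Definition smon S (p : {mpoly F[n]}) : superspace :=
  [ffun U => if U == S then p else 0].

Definition smul f g : superspace :=
  [ffun U => \sum_S \sum_(T | S :|: T == U) theta_sign S T *: (f S * g T)].

Lemma smul_sum (V : nmodType) (phi : {set 'I_n} -> {mpoly F[n]} -> V) f g :
  (forall U, phi U 0 = 0) -> (forall U, {morph phi U : p q / p + q}) ->
  \sum_U phi U (smul f g U)
    = \sum_S \sum_T phi (S :|: T) (theta_sign S T *: (f S * g T)).
Proof.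
move=> phi0 phiD.
transitivity (\sum_U \sum_S \sum_(T | S :|: T == U)
                phi U (theta_sign S T *: (f S * g T))).
  apply: eq_bigr => U _; rewrite ffunE (big_morph _ (phiD U) (phi0 U)).
  by apply: eq_bigr => S _; rewrite (big_morph _ (phiD U) (phi0 U)).
rewrite exchange_big; apply: eq_bigr => S _.
rewrite (exchange_big_dep xpredT) //=; apply: eq_bigr => T _.
by rewrite (big_pred1 (S :|: T)) // => U; rewrite eq_sym.
Qed.

Lemma smulE f g W : smul f g W =
  \sum_S \sum_T if S :|: T == W then theta_sign S T *: (f S * g T) else 0.
Proof. by rewrite ffunE; apply: eq_bigr => S _; rewrite big_mkcond. Qed.

Lemma sum_setU_disjoint S T (G : 'I_n -> nat) : [disjoint S & T] ->
  (\sum_(i in S :|: T) G i = \sum_(i in S) G i + \sum_(i in T) G i)%N.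
Proof.
by move=> dST; rewrite -bigU //; apply: eq_bigl => i; rewrite !inE.
Qed.

Lemma theta_sign_cocycle S T X :
  theta_sign S T * theta_sign (S :|: T) X
    = theta_sign S (T :|: X) * theta_sign T X.
Proof.
rewrite /theta_sign -!setI_eq0 setIUl setIUr !setU_eq0 !setI_eq0.
case dST: [disjoint S & T]; last by rewrite mul0r mul0r.
case dSX: [disjoint S & X]; last by rewrite mulr0 mul0r.
case dTX: [disjoint T & X]; last by rewrite mulr0 mulr0.
rewrite -!exprD; congr (_ ^+ _); rewrite /inversions sum_setU_disjoint //.
rewrite addnA; congr addn; rewrite -big_split /=.
by apply: eq_bigr => i _; rewrite sum_setU_disjoint.
Qed.

Lemma theta_sign0l T : theta_sign set0 T = 1.
Proof. by rewrite /theta_sign -setI_eq0 set0I eqxx /inversions big_set0. Qed.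
Lemma theta_sign0r S : theta_sign S set0 = 1.
Proof.
rewrite /theta_sign -setI_eq0 setI0 eqxx /inversions big1 // => i _.
by rewrite big_set0.
Qed.

Lemma smulA : associative smul.
Proof.
move=> f g h; apply/ffunP=> W; rewrite !smulE.
pose c S T X := theta_sign S T * theta_sign (S :|: T) X.
pose t S T X := if S :|: T :|: X == W then c S T X *: (f S * g T * h X) else 0.
transitivity (\sum_S \sum_T \sum_X t S T X).
  apply: eq_bigr => S _.
  rewrite (@smul_sum _ (fun V p => if S :|: V == W then
                              theta_sign S V *: (f S * p) else 0)).
  - apply: eq_bigr => T _; apply: eq_bigr => X _; rewrite /t setUA.
    case: eqP => // _; rewrite -scalerAr scalerA /c theta_sign_cocycle.
    by rewrite mulrA.
  - by move=> U; rewrite mulr0 scaler0 if_same.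
  - by move=> U p q; case: ifP; rewrite ?addr0 // mulrDr scalerDr.
transitivity (\sum_X \sum_S \sum_T t S T X); last first.
  symmetry; rewrite exchange_big; apply: eq_bigr => X _.
  rewrite (@smul_sum _ (fun V p => if V :|: X == W then
                              theta_sign V X *: (p * h X) else 0)).
  - apply: eq_bigr => S _; apply: eq_bigr => T _; rewrite /t.
    by case: eqP => // _; rewrite -scalerAl scalerA mulrC.
  - by move=> U; rewrite mul0r scaler0 if_same.
  - by move=> U p q; case: ifP; rewrite ?addr0 // mulrDl scalerDr.
symmetry; rewrite exchange_big; apply: eq_bigr => S _.
by rewrite exchange_big.
Qed.

Definition sone : superspace := smon set0 1.

Lemma smul_mon S T p q :
  smul (smon S p) (smon T q) = smon (S :|: T) (theta_sign S T *: (p * q)).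
Proof.
apply/ffunP=> W; rewrite smulE (bigD1 S) //= [X in _ + X]big1 => [|S' nS].
  rewrite (bigD1 T) //= [X in _ + X + _]big1 => [|T' nT].
    by rewrite !ffunE !eqxx !addr0 [W == _]eq_sym.
  by rewrite !ffunE (negPf nT) mulr0 scaler0 if_same.
by rewrite big1 // => T' _; rewrite !ffunE (negPf nS) mul0r scaler0 if_same.
Qed.

Lemma smulDl : left_distributive smul +%R.
Proof.
move=> f g h; apply/ffunP=> W; rewrite ffunE [RHS]ffunE !ffunE -big_split /=.
apply: eq_bigr => S _; rewrite -big_split /=; apply: eq_bigr => T _.
by rewrite ffunE mulrDl scalerDr.
Qed.
Lemma smulDr : right_distributive smul +%R.
Proof.
move=> f g h; apply/ffunP=> W; rewrite ffunE [RHS]ffunE !ffunE -big_split /=.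
apply: eq_bigr => S _; rewrite -big_split /=; apply: eq_bigr => T _.
by rewrite ffunE mulrDr scalerDr.
Qed.

Lemma smul1 : left_id sone smul.
Proof.
move=> f; apply/ffunP=> W; rewrite smulE (bigD1 set0) //= [X in _ + X]big1.
  rewrite (bigD1 W) //= [X in _ + X + _]big1 => [|T nT].
    by rewrite !addr0 ffunE eqxx set0U eqxx theta_sign0l scale1r mul1r.
  by rewrite set0U (negPf nT).
move=> S nS; rewrite big1 // => T _.
by rewrite !ffunE (negPf nS) mul0r scaler0 if_same.
Qed.
Lemma smulr1 : right_id sone smul.
Proof.
move=> f; apply/ffunP=> W; rewrite smulE (bigD1 W) //= [X in _ + X]big1.
  rewrite (bigD1 set0) //= [X in _ + X + _]big1 => [|T nT].
    by rewrite !addr0 [sone _]ffunE eqxx setU0 eqxx theta_sign0r scale1r mulr1.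
  by rewrite [sone _]ffunE (negPf nT) mulr0 scaler0 if_same.
move=> S nS; rewrite big1 // => T _; rewrite [sone _]ffunE.
have [->|nT] := eqVneq T set0; first by rewrite setU0 (negPf nS).
by rewrite mulr0 scaler0 if_same.
Qed.

Lemma sone_neq0 : sone != 0.
Proof.
by apply/eqP=> /ffunP/(_ set0)/eqP; rewrite !ffunE eqxx oner_eq0.
Qed.

HB.instance Definition _ := GRing.Zmodule_isNzRing.Build superspace
  smulA smul1 smulr1 smulDl smulDr sone_neq0.

Lemma smulZl (a : F) f g : a *: (f * g) = (a *: f) * g.
Proof.
apply/ffunP=> W; rewrite ffunE !smulE scaler_sumr; apply: eq_bigr => S _.
rewrite scaler_sumr; apply: eq_bigr => T _; rewrite [(a *: f) S]ffunE.
by case: ifP; rewrite ?scaler0 // !scalerA mulrC -scalerA scalerAl.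
Qed.
HB.instance Definition _ :=
  GRing.Lmodule_isLalgebra.Build F superspace smulZl.

Lemma smulZr (a : F) f g : a *: (f * g) = f * (a *: g).
Proof.
apply/ffunP=> W; rewrite ffunE !smulE scaler_sumr; apply: eq_bigr => S _.
rewrite scaler_sumr; apply: eq_bigr => T _; rewrite [(a *: g) T]ffunE.
by case: ifP; rewrite ?scaler0 // !scalerA mulrC -scalerA scalerAr.
Qed.
HB.instance Definition _ :=
  GRing.Lalgebra_isAlgebra.Build F superspace smulZr.

End Superspace.

Lemma sorted_index_ord n :
  sorted (fun i j : 'I_n => (i < j)%N) (index_enum 'I_n).
Proof.
have := iota_ltn_sorted 0 n; rewrite -val_enum_ord sorted_map.
by rewrite enumT.
Qed.

Section OrderedProducts.
Variables (F : numFieldType) (n : nat) (A : algType F) (v : 'I_n -> A).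
Hypothesis v_sq : forall i, v i * v i = 0.
Hypothesis v_anti : forall i j, v i * v j = - (v j * v i).
Implicit Types (S T : {set 'I_n}) (r : seq 'I_n).

Lemma prod_anticomm r S m :
  (\prod_(i <- r | i \in S) v i) * v m
    = (-1) ^+ (\sum_(i <- r | i \in S) 1)
        *: (v m * \prod_(i <- r | i \in S) v i).
Proof.
elim: r => [|i r IHr]; first by rewrite !big_nil mul1r mulr1 scale1r.
rewrite !big_cons; case: ifP => // iS.
rewrite -mulrA IHr -scalerAr !mulrA v_anti mulNr scalerN.
by rewrite add1n exprS mulN1r scaleNr -!mulrA opprK.
Qed.

Lemma prod_mul r S T : sorted (fun i j : 'I_n => (i < j)%N) r ->
  (\prod_(i <- r | i \in S) v i) * (\prod_(i <- r | i \in T) v i)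
   = (if has (fun i => i \in S :&: T) r then 0 else
        (-1) ^+ (\sum_(i <- r | i \in S) \sum_(j <- r | j \in T) (j < i)%N))
       *: \prod_(i <- r | i \in S :|: T) v i.
Proof.
elim: r => [|m r IHr] /=; first by rewrite !big_nil mulr1 scale1r.
rewrite path_sortedE; last by move=> j i k; apply: ltn_trans.
case/andP=> m_lt /IHr {}IHr; rewrite !big_cons !inE.
have m_inv : (\sum_(j <- r | j \in T) (j < m) = 0)%N.
  rewrite big_seq_cond big1 // => j /andP [jr _].
  by rewrite ltnNge ltnW //; apply: (allP m_lt).
have sum1 : (\sum_(i <- r | i \in S) \sum_(j <- m :: r | j \in T) (j < i) =
   (if m \in T then \sum_(i <- r | i \in S) 1 else 0) +
     \sum_(i <- r | i \in S) \sum_(j <- r | j \in T) (j < i))%N.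
  case mT: (m \in T); last first.
    by rewrite add0n; apply: eq_bigr => i _; rewrite big_cons mT.
  rewrite -big_split /= [LHS]big_seq_cond [RHS]big_seq_cond.
  apply: eq_bigr => i /andP [ir _] /=; rewrite big_cons mT.
  by rewrite (allP m_lt _ ir : (m < i)%N).
case mS: (m \in S); case mT: (m \in T) => /=.
- rewrite scale0r -mulrA [X in v m * X]mulrA prod_anticomm -scalerAl -scalerAr.
  by rewrite !mulrA v_sq !mul0r scaler0.
- rewrite -mulrA IHr -scalerAr m_inv sum1 mT !add0n.
  by [].
- rewrite mulrA prod_anticomm -scalerAl -mulrA IHr -scalerAr scalerA sum1 mT.
  by case: ifP => _; rewrite ?mulr0 // exprD.
- by rewrite IHr sum1 mT add0n.
Qed.

Lemma prod_theta_sign S T :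
  (\prod_(i in S) v i) * (\prod_(i in T) v i)
    = theta_sign F S T *: \prod_(i in S :|: T) v i.
Proof.
rewrite (prod_mul _ _ (sorted_index_ord n)) /theta_sign /inversions.
suff -> : has (fun i => i \in S :&: T) (index_enum 'I_n) = ~~ [disjoint S & T].
  by case: [disjoint _ & _].
rewrite -setI_eq0; apply/hasP/set0Pn => [[i _ iST]|[i iST]]; exists i => //.
Qed.
End OrderedProducts.

Section SuperspaceAction.
Variables (F : numFieldType) (n : nat).
Local Notation Omega := (superspace F n).
Local Notation B := (hyperoctahedral n).
Implicit Types (S T : {set 'I_n}) (f : Omega) (g h : B) (p q : {mpoly F[n]}).

Definition spoly p : Omega := smon set0 p.
Definition xvar i : Omega := spoly 'X_i.
Definition theta i : Omega := smon [set i] 1.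

Lemma smonD S : {morph @smon F n S : p q / p + q}.
Proof.
by move=> p q; apply/ffunP=> U; rewrite !ffunE; case: ifP; rewrite ?addr0.
Qed.
Lemma smon0 S : @smon F n S 0 = 0.
Proof. by apply/ffunP=> U; rewrite !ffunE if_same. Qed.
Lemma smonZ S a p : smon S (a *: p) = a *: (smon S p : Omega).
Proof. by apply/ffunP=> U; rewrite !ffunE; case: ifP; rewrite ?scaler0. Qed.

Lemma smonM S T p q :
  smon S p * smon T q = smon (S :|: T) (theta_sign F S T *: (p * q)) :> Omega.
Proof. exact: smul_mon. Qed.

Lemma spolyM p q : spoly (p * q) = spoly p * spoly q.
Proof. by rewrite smonM theta_sign0l scale1r setU0. Qed.

Lemma smon_sum f : f = \sum_S smon S (f S).
Proof.
apply/ffunP=> U; rewrite sum_ffunE (bigD1 U) //= ffunE eqxx big1 ?addr0 //.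
by move=> S nS; rewrite ffunE eq_sym (negPf nS).
Qed.

Lemma spoly_central p f : spoly p * f = f * spoly p.
Proof.
rewrite /spoly [f]smon_sum mulr_sumr mulr_suml; apply: eq_bigr => S _.
by rewrite !smonM theta_sign0l theta_sign0r set0U setU0 mulrC.
Qed.

Lemma xvarC i j : xvar i * xvar j = xvar j * xvar i.
Proof. exact: spoly_central. Qed.
Lemma xvar_theta i j : xvar i * theta j = theta j * xvar i.
Proof. exact: spoly_central. Qed.

Lemma inversions1 (i j : 'I_n) : inversions [set i] [set j] = (j < i)%N.
Proof. by rewrite /inversions !big_set1. Qed.

Lemma theta_anti i j : theta i * theta j = - (theta j * theta i).
Proof.
rewrite !smonM setUC mulr1 -[RHS]scaleN1r -smonZ scalerA; congr (smon _ _).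
congr (_ *: _); rewrite /theta_sign !inversions1 !disjoints1 !inE.
have [->|nij] := eqVneq i j; first by rewrite /= mulr0.
have := nij; rewrite -val_eqE /=.
by case: ltngtP => //; rewrite ?mulr1 ?mulN1r ?opprK.
Qed.

Lemma theta_prod S : \prod_(i in S) theta i = smon S 1.
Proof.
suff prodE r : sorted (fun i j : 'I_n => (i < j)%N) r ->
    \prod_(i <- r | i \in S) theta i = smon [set i in r | i \in S] 1.
  rewrite prodE ?sorted_index_ord //; congr (smon _ _).
  by apply/setP=> i; rewrite !inE mem_index_enum.
elim: r => [_|m r IHr] /=.
  by rewrite big_nil; congr (smon _ _); apply/setP=> i; rewrite !inE.
rewrite path_sortedE; last by move=> j i k; apply: ltn_trans.
case/andP=> m_lt /IHr {}IHr; rewrite big_cons IHr; case: ifP => mS.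
  rewrite smonM mulr1 /theta_sign disjoints1 !inE mS andbT.
  have -> : m \notin r by apply/negP=> /(allP m_lt); rewrite ltnn.
  rewrite /inversions big_set1 big1 => [|i]; last first.
    by rewrite inE => /andP [/(allP m_lt) lt_mi _]; rewrite ltnNge ltnW.
  rewrite expr0 scale1r; congr (smon _ _); apply/setP=> i; rewrite !inE.
  by case: eqVneq => // ->; rewrite mS.
congr (smon _ _); apply/setP=> i; rewrite !inE.
by case: eqVneq => // ->; rewrite mS andbF.
Qed.

Lemma superspaceE f : f = \sum_S spoly (f S) * \prod_(i in S) theta i.
Proof.
rewrite {1}[f]smon_sum; apply: eq_bigr => S _.
by rewrite theta_prod smonM theta_sign0l set0U scale1r mulr1.
Qed.

(* A matrix g of B acts by the linear substitutions x_i |-> sum_j g_ji x_j and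
   theta_i |-> sum_j g_ji theta_j.  The permutation matrix of w is the one with
   w e_i = e_(w i), hence it sends x_i to x_(w i). *)
Definition act_xvar g : n.-tuple {mpoly F[n]} :=
  [tuple \sum_j (hyp_mx g j i)%:~R *: 'X_j | i < n].
Definition act_theta g i : Omega := \sum_j (hyp_mx g j i)%:~R *: theta j.
Definition sact g f : Omega :=
  \sum_S spoly (f S \mPo act_xvar g) * \prod_(i in S) act_theta g i.

Lemma act_theta_anti g i j :
  act_theta g i * act_theta g j = - (act_theta g j * act_theta g i).
Proof.
rewrite /act_theta !mulr_suml -sumrN.
under eq_bigr do rewrite mulr_sumr; rewrite exchange_big /=.
apply: eq_bigr => k _; rewrite mulr_sumr -sumrN; apply: eq_bigr => l _.
rewrite -!scalerAl -!scalerAr !scalerA theta_anti scalerN.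
by rewrite [in LHS]mulrC.
Qed.

Lemma act_theta_sq g i : act_theta g i * act_theta g i = 0.
Proof.
have /eqP := act_theta_anti g i i; rewrite -addr_eq0 -mulr2n -scaler_nat.
by rewrite scaler_eq0 pnatr_eq0 => /eqP.
Qed.

Lemma sact_linear g : linear (sact g).
Proof.
move=> a u v; rewrite /sact scaler_sumr -big_split; apply: eq_bigr => S _ /=.
rewrite !ffunE comp_mpolyD comp_mpolyZ /spoly smonD smonZ mulrDl.
by rewrite scalerAl.
Qed.
HB.instance Definition _ g :=
  GRing.isLinear.Build F Omega Omega _ (sact g) (sact_linear g).

Lemma sact_mon g S p :
  sact g (smon S p)
    = spoly (p \mPo act_xvar g) * \prod_(i in S) act_theta g i.
Proof.
rewrite /sact (bigD1 S) //= ffunE eqxx [X in _ + X]big1 ?addr0 // => T nT.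
by rewrite ffunE (negPf nT) comp_mpoly0 /spoly smon0 mul0r.
Qed.

Lemma sact_poly g p : sact g (spoly p) = spoly (p \mPo act_xvar g).
Proof. by rewrite sact_mon big_set0 mulr1. Qed.

Lemma sact_xvar g i : sact g (xvar i) = \sum_j (hyp_mx g j i)%:~R *: xvar j.
Proof.
rewrite sact_poly comp_mpolyXU -tnth_nth tnth_mktuple.
rewrite /spoly (big_morph _ (@smonD set0) (@smon0 set0)).
by apply: eq_bigr => j _; rewrite smonZ.
Qed.

Lemma sact_theta g i : sact g (theta i) = act_theta g i.
Proof. by rewrite sact_mon comp_mpoly1 mul1r big_set1. Qed.

Lemma sact1 g : sact g 1 = 1.
Proof. by rewrite [LHS](sact_poly g 1) comp_mpoly1. Qed.

Lemma sactM g f f' : sact g (f * f') = sact g f * sact g f'.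
Proof.
rewrite {1}/sact (@smul_sum _ _ _ (fun U p =>
    spoly (p \mPo act_xvar g) * \prod_(i in U) act_theta g i)); last 2 first.
- by move=> U; rewrite comp_mpoly0 /spoly smon0 mul0r.
- by move=> U p q; rewrite comp_mpolyD /spoly smonD mulrDl.
rewrite mulr_suml; apply: eq_bigr => S _; rewrite mulr_sumr.
apply: eq_bigr => T _; rewrite comp_mpolyZ rmorphM /= {1}/spoly smonZ.
rewrite -[RHS]mulrA [X in _ = _ * X]mulrA -(spoly_central (f' T \mPo _)).
rewrite -[X in _ = _ * X]mulrA [RHS]mulrA -spolyM.
rewrite (prod_theta_sign (act_theta_sq g) (act_theta_anti g)).
by rewrite -scalerAl -scalerAr.
Qed.

HB.instance Definition _ g :=
  GRing.isMonoidMorphism.Build Omega Omega (sact g) (sact1 g, sactM g).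

Lemma comp_act_xvar g h p :
  (p \mPo act_xvar h) \mPo act_xvar g = p \mPo act_xvar (g * h)%g.
Proof.
rewrite (comp_mpolyE p) [RHS]comp_mpolyE raddf_sum; apply: eq_bigr => m _ /=.
rewrite comp_mpolyZ rmorph_prod; congr (_ *: _); apply: eq_bigr => i _.
rewrite rmorphXn /=; congr (_ ^+ _); rewrite !tnth_mktuple raddf_sum /=.
under eq_bigr do rewrite comp_mpolyZ comp_mpolyXU -tnth_nth tnth_mktuple.
under eq_bigr do rewrite scaler_sumr; rewrite exchange_big.
apply: eq_bigr => k _; rewrite mxE rmorph_sum scaler_suml.
by apply: eq_bigr => j _; rewrite scalerA rmorphM mulrC.
Qed.

Lemma sact_act_theta g h i : sact g (act_theta h i) = act_theta (g * h)%g i.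
Proof.
rewrite raddf_sum /=; under eq_bigr do rewrite linearZ /= sact_theta scaler_sumr.
rewrite exchange_big; apply: eq_bigr => k _; rewrite mxE rmorph_sum scaler_suml.
by apply: eq_bigr => j _; rewrite scalerA rmorphM mulrC.
Qed.

Lemma sact_mulg g h f : sact (g * h)%g f = sact g (sact h f).
Proof.
rewrite [sact h f]/sact raddf_sum; apply: eq_bigr => S _.
rewrite /= sactM sact_poly comp_act_xvar rmorph_prod /=; congr (_ * _).
by apply: eq_bigr => i _; rewrite sact_act_theta.
Qed.

Lemma sact_idg f : sact 1%g f = f.
Proof.
rewrite {2}[f]superspaceE; apply: eq_bigr => S _; congr (spoly _ * _).
  rewrite -[RHS]comp_mpoly_id; congr (_ \mPo _); apply: eq_mktuple => i.
  rewrite (bigD1 i) //= mxE eqxx scale1r big1 ?addr0 // => j /negPf nij.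
  by rewrite mxE nij scale0r.
apply: eq_bigr => i _; rewrite /act_theta (bigD1 i) //= mxE eqxx scale1r.
by rewrite big1 ?addr0 // => j /negPf nij; rewrite mxE nij scale0r.
Qed.

Definition constant_term f : F := (f set0)@_0%MM.

Definition invariant_without_constant_term f :=
  (forall g, sact g f = f) /\ constant_term f = 0.

End SuperspaceAction.

Definition two_sided_ideal (A : nzRingType) (G : A -> Prop) : {pred A} :=
  fun a => `[< exists (k : nat) (l p r : 'I_k -> A),
                 (forall i, G (p i)) /\ a = \sum_i l i * p i * r i >].

Section TwoSidedIdeal.
Variables (A : nzRingType) (G : A -> Prop).

Lemma two_sided_idealP a :
  reflect (exists (k : nat) (l p r : 'I_k -> A),
             (forall i, G (p i)) /\ a = \sum_i l i * p i * r i)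
          (a \in two_sided_ideal G).
Proof. exact: asboolP. Qed.

Lemma two_sided_ideal_gen a : G a -> a \in two_sided_ideal G.
Proof.
move=> Ga; apply/two_sided_idealP.
exists 1%N, (fun=> 1), (fun=> a), (fun=> 1); split=> //.
by rewrite big_ord1 mul1r mulr1.
Qed.

Lemma two_sided_idealD : {in two_sided_ideal G &, forall a b,
  a + b \in two_sided_ideal G}.
Proof.
move=> a b /two_sided_idealP [k [l [p [r [Gp ->]]]]].
move=> /two_sided_idealP [k' [l' [p' [r' [Gp' ->]]]]].
pose cat (u : 'I_k -> A) (u' : 'I_k' -> A) i :=
  match split i with inl j => u j | inr j => u' j end.
apply/two_sided_idealP; exists (k + k')%N, (cat l l'), (cat p p'), (cat r r').
split; first by move=> i; rewrite /cat; case: split.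
rewrite big_split_ord /cat; congr (_ + _); apply: eq_bigr => i _.
  by rewrite (unsplitK (inl i)).
by rewrite (unsplitK (inr i)).
Qed.

Lemma two_sided_idealM a b c :
  b \in two_sided_ideal G -> a * b * c \in two_sided_ideal G.
Proof.
move=> /two_sided_idealP [k [l [p [r [Gp ->]]]]]; apply/two_sided_idealP.
exists k, (fun i => a * l i), p, (fun i => r i * c); split=> //.
by rewrite mulr_sumr mulr_suml; apply: eq_bigr => i _; rewrite !mulrA.
Qed.

Lemma two_sided_ideal_closed : zmod_closed (two_sided_ideal G).
Proof.
split=> [|a b Ia Ib].
  apply/two_sided_idealP; exists 0%N, (fun=> 0), (fun=> 0), (fun=> 0).
  by split=> [[]|] //; rewrite big_ord0.
by rewrite two_sided_idealD // -[b]mulr1 -mulNr -mulN1r two_sided_idealM.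
Qed.
HB.instance Definition _ :=
  GRing.isZmodClosed.Build A (two_sided_ideal G) two_sided_ideal_closed.
End TwoSidedIdeal.

Section Coinvariants.
Variables (F : numFieldType) (n : nat).
Local Notation Omega := (superspace F n).
Local Notation B := (hyperoctahedral n).
Implicit Types (f : Omega) (g h : B) (a : F).

Definition SI : {pred Omega} :=
  two_sided_ideal (@invariant_without_constant_term F n).
HB.instance Definition _ := GRing.ZmodClosed.on SI.

Definition SR := {ideal_quot SI}.
HB.instance Definition _ := GRing.Zmodule.on SR.
Local Notation pi := (\pi_SR).

Lemma SI_Z a f : f \in SI -> a *: f \in SI.
Proof.
by move=> If; rewrite -[f]mul1r -[X in X \in _]mulr1 scalerAl two_sided_idealM.
Qed.

Lemma SI_act g f : f \in SI -> sact g f \in SI.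
Proof.
move=> /two_sided_idealP [k [l [p [r [Gp ->]]]]]; rewrite raddf_sum.
apply: rpred_sum => i _; rewrite /= !sactM (Gp i).1.
exact/two_sided_idealM/two_sided_ideal_gen.
Qed.

Definition SR_scale a (v : SR) : SR := pi (a *: repr v).
Definition SR_act g (v : SR) : SR := pi (sact g (repr v)).

Lemma pi_eq f f' : (pi f = pi f') <-> (f - f' \in SI).
Proof. by rewrite Quotient.idealrBE; split=> /eqP. Qed.

Lemma SR_scaleE a f : SR_scale a (pi f) = pi (a *: f).
Proof. by apply/pi_eq; rewrite -scalerBr SI_Z //; apply/pi_eq; rewrite reprK. Qed.

Lemma SR_actE g f : SR_act g (pi f) = pi (sact g f).
Proof. by apply/pi_eq; rewrite -raddfB SI_act //; apply/pi_eq; rewrite reprK. Qed.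

End Coinvariants.

Section CoinvariantModule.
Variables (F : numFieldType) (n : nat).
Local Notation Omega := (superspace F n).
Local Notation B := (hyperoctahedral n).
Local Notation SR := (SR F n).
Local Notation pi := (\pi_SR).
Implicit Types (f : Omega) (g h : B) (a b : F) (u v : SR).

Lemma SR_scaleA a b v : SR_scale a (SR_scale b v) = SR_scale (a * b) v.
Proof. by rewrite -[v]reprK (SR_scaleE b) !SR_scaleE scalerA. Qed.
Lemma SR_scale1 : left_id 1 (@SR_scale F n).
Proof. by move=> v; rewrite -[v]reprK SR_scaleE scale1r. Qed.
Lemma SR_scaleDr : right_distributive (@SR_scale F n) +%R.
Proof.
move=> a u v; rewrite -[u]reprK -[v]reprK -raddfD !SR_scaleE.
by rewrite scalerDr raddfD.
Qed.
Lemma SR_scaleDl v : {morph (@SR_scale F n)^~ v : a b / a + b}.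
Proof. by move=> a b /=; rewrite -[v]reprK !SR_scaleE scalerDl raddfD. Qed.
HB.instance Definition _ := GRing.Zmodule_isLmodule.Build F SR
  SR_scaleA SR_scale1 SR_scaleDr SR_scaleDl.

Lemma SR_piZ a f : pi (a *: f) = a *: (pi f : SR).
Proof. exact: esym (SR_scaleE a f). Qed.

Lemma SR_piD f f' : pi (f + f') = (pi f + pi f' : SR).
Proof. exact: raddfD. Qed.

Lemma SR_act_linear g : linear (@SR_act F n g).
Proof.
move=> a u v; rewrite -[u]reprK -[v]reprK -SR_piZ -SR_piD !SR_actE.
by rewrite linearP SR_piD SR_piZ.
Qed.
Lemma SR_act1 v : SR_act 1%g v = v.
Proof. by rewrite -[v]reprK SR_actE sact_idg. Qed.
Lemma SR_actM g h v : SR_act (g * h)%g v = SR_act g (SR_act h v).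
Proof. by rewrite -[v]reprK (SR_actE h) !SR_actE sact_mulg. Qed.

Definition SR_gmodule : gmodule F B := GModule SR_act_linear SR_act1 SR_actM.
End CoinvariantModule.

Section CoxeterComplex.
Variables (R : realType) (n : nat).
Local Notation B := (hyperoctahedral n).
Local Notation point := 'cV[R]_n.
Implicit Types (u v : point) (g h : B).

(* u and v lie in the same open half-space of, or both on, each of the
   hyperplanes x_i = 0, x_i - x_j = 0 and x_i + x_j = 0, i < j *)
Definition same_face u v : Prop :=
  (forall i, Num.sg (u i 0) = Num.sg (v i 0)) /\
  (forall i j : 'I_n, (i < j)%N ->
     Num.sg (u i 0 - u j 0) = Num.sg (v i 0 - v j 0) /\
     Num.sg (u i 0 + u j 0) = Num.sg (v i 0 + v j 0)).

Definition face_of u : set point := [set v | same_face u v]%classic.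

Record face := Face {
  face_set :> set point;
  face_setP : `[< exists u, face_set = face_of u >] }.
HB.instance Definition _ := [isSub for face_set].
HB.instance Definition _ := [Choice of face by <:].

Definition the_face u : face := Face (asboolT (ex_intro _ u (erefl (face_of u)))).

Lemma faceP (A : face) : exists u, A = the_face u.
Proof. by have /asboolP [u eA] := face_setP A; exists u; apply/val_inj. Qed.

Lemma same_face_sym u v : same_face u v -> same_face v u.
Proof. by case=> h1 h2; split=> [i|i j /h2 []]; rewrite ?h1. Qed.
Lemma same_face_trans u v w : same_face u v -> same_face v w -> same_face u w.
Proof.
move=> [h1 h2] [k1 k2]; split=> [i|i j lt_ij]; first by rewrite h1.
by have [-> ->] := h2 i j lt_ij; apply: k2.
Qed.

Lemma the_faceP u v : the_face u = the_face v <-> same_face u v.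
Proof.
split=> [/(congr1 face_set) /= eq_uv | uv].
  by have : face_of v v by []; rewrite -eq_uv.
apply/val_inj/funext=> w /=; apply/propext; split.
  exact/same_face_trans/same_face_sym.
exact: same_face_trans.
Qed.

(* finitely many faces: a face is determined by its vector of signs *)
Definition sgn_of (x : R) : option bool := if x == 0 then None else Some (0 < x).
Lemma sgn_ofP x y : sgn_of x = sgn_of y -> Num.sg x = Num.sg y.
Proof. by rewrite /sgn_of; case: (sgrP x); case: (sgrP y). Qed.

Definition face_signs (A : face) : {ffun 'I_n * 'I_n * 'I_3 -> option bool} :=
  let u : point := xget (0 : point) (face_set A) in
  [ffun t : 'I_n * 'I_n * 'I_3 => sgn_of (nth 0 [:: u t.1.1 0; u t.1.1 0 - u t.1.2 0;
                               u t.1.1 0 + u t.1.2 0] t.2)].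

Lemma face_xget (A : face) : A = the_face (xget (0 : point) (face_set A)).
Proof.
have [u eA] := faceP A; rewrite {1}eA; apply/the_faceP.
by case: xgetP => [v -> | /(_ u)]; rewrite eA // => /(_ _)[].
Qed.

Lemma face_signs_inj : injective face_signs.
Proof.
move=> A A' /ffunP eqA; rewrite (face_xget A) (face_xget A'); apply/the_faceP.
split=> [i|i j _]; last split; apply: sgn_ofP.
- by have := eqA (i, i, inord 0); rewrite !ffunE /= inordK.
- by have := eqA (i, j, inord 1); rewrite !ffunE /= inordK.
- by have := eqA (i, j, inord 2); rewrite !ffunE /= inordK.
Qed.

Definition face_of_signs s : option face :=
  match pselect (exists A, face_signs A = s) with
  | left exA => Some (projT1 (cid exA))
  | right _ => None
  end.
Lemma face_signsK : pcancel face_signs face_of_signs.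
Proof.
move=> A; rewrite /face_of_signs; case: pselect => [exA|[]]; last by exists A.
by congr Some; apply: face_signs_inj; case: cid.
Qed.
HB.instance Definition _ := PCanIsCountable face_signsK.
HB.instance Definition _ : isFinite face := PCanIsFinite face_signsK.

Definition act_point g u : point := map_mx intr (hyp_mx g) *m u.

Lemma act_point1 u : act_point 1%g u = u.
Proof. by rewrite /act_point map_mx1 mul1mx. Qed.
Lemma act_pointM g h u : act_point (g * h)%g u = act_point g (act_point h u).
Proof. by rewrite /act_point map_mxM mulmxA. Qed.

Lemma same_face_act g u v :
  same_face u v -> same_face (act_point g u) (act_point g v).
Proof.
have /signed_perm_mxP [s [e eg]] := hyp_mxP g.
have actE w i : act_point g w i 0 = (-1) ^+ e i * w (s i) 0.
  rewrite mxE (bigD1 (s i)) //= big1 => [|k nk]; rewrite ?addr0 !mxE eg !mxE.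
    by rewrite eqxx mulr1n rmorph_sign.
  by rewrite eq_sym (negPf nk) mul0r.
case=> h1 h2; have h3 i j : i != j ->
    Num.sg (u i 0 - u j 0) = Num.sg (v i 0 - v j 0) /\
    Num.sg (u i 0 + u j 0) = Num.sg (v i 0 + v j 0).
  rewrite -val_eqE; case: ltngtP => // [/h2 //|/h2 [hB hD] _].
  by rewrite ![_ i 0 + _ j 0]addrC -(opprB (u j 0)) -(opprB (v j 0)) !sgrN hB.
split=> [i|i j lt_ij]; rewrite !actE; first by rewrite !sgrM h1.
have /h3 [hB hD] : s i != s j.
  by rewrite (inj_eq perm_inj) -val_eqE ltn_eqF.
have -> : (-1) ^+ e j = (-1) ^+ e i * (-1) ^+ (e i (+) e j) :> R.
  by rewrite -signr_addb addKb.
rewrite -!mulrA -!mulrBr -!mulrDr !sgrM.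
by case: (_ (+) _); rewrite ?mulN1r ?mul1r ?opprK hB hD.
Qed.

Lemma face_act_subproof g (A : face) :
  `[< exists u, (act_point g @` A)%classic = face_of u >].
Proof.
have [u ->] := faceP A; apply/asboolP; exists (act_point g u).
apply/funext=> w; apply/propext; split=> [[v uv <-]|gu_w].
  exact: same_face_act.
exists (act_point g^-1%g w); last by rewrite -act_pointM mulgV act_point1.
rewrite /= -[u]act_point1 -(mulVg g) act_pointM; exact: same_face_act.
Qed.
Definition face_act g (A : face) : face := Face (face_act_subproof g A).

Lemma face_act1 A : face_act 1%g A = A.
Proof.
apply/val_inj/funext=> w; apply/propext; split=> [[v Av <-]|Aw] /=.
  by rewrite act_point1.
by exists w; rewrite ?act_point1.
Qed.
Lemma face_actM g h A : face_act (g * h)%g A = face_act g (face_act h A).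
Proof.
apply/val_inj/funext=> w; apply/propext; split=> [[v Av <-]|[_ [v Av <-] <-]] /=.
  by exists (act_point h v); [exists v | rewrite act_pointM].
by exists v; rewrite ?act_pointM.
Qed.

Definition OP_gmodule (F : numFieldType) : gmodule F B :=
  perm_gmodule F face_act1 face_actM.
End CoxeterComplex.

Section Determinant.
Variables (F : numFieldType) (n : nat).
Implicit Types g h : hyperoctahedral n.

Definition hyp_det g : F := \det (map_mx intr (hyp_mx g)).
Lemma hyp_det1 : hyp_det 1%g = 1.
Proof. by rewrite /hyp_det map_mx1 det1. Qed.
Lemma hyp_detM g h : hyp_det (g * h)%g = hyp_det g * hyp_det h.
Proof. by rewrite /hyp_det map_mxM det_mulmx. Qed.

Definition tensor_det (V : gmodule F (hyperoctahedral n)) :=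
  gmod_twist V hyp_det1 hyp_detM.
End Determinant.

(* Main.v *)
(* Let P_a = sum_i x_i^(2a+2) and D_a = sum_i x_i^(2a+1) theta_i, which lie in
   SI.

   Upper bound.  For j in S and U the set of the u < j outside S, the form
   sum_i x_i prod_(u in U) (x_i^2 - x_u^2) theta_i is a combination of the D_a;
   multiplied by theta_(S \ j) it expresses x_j prod_U (x_j^2 - x_u^2) theta_S
   modulo SI by forms theta_T with larger sum of indices.  Together with the P_a
   this gives, for each S and each j, a product of r_j linear forms in x_j and
   the x_u, u in U, that can be reduced, so that dim SR is at most
   sum_S prod_j r_j; this number does not exceed the number of faces.

   Lower bound.  Faces embed equivariantly into the set of the points y in C^n
   with P_a(y) = [a+1 = m] for all a < m, where m is the number of distinct
   nonzero y_i^2: at most 2^m m! faces share a given stabiliser, and there are at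
   least as many such points with that stabiliser, since the equations
   sum_i l_i z_i^(2a+2) = [a+1 = m] (a < m, l_i > 0) in m unknowns define a
   radical ideal with quotient of dimension 2^m m!.
   For such a y let e_d(f)(y) be the coefficient of t^d in the
   theta_1 ... theta_n component of f D_0 ... D_(m-1) at the point t y.  The maps
   e_d : Omega -> C[OP] (x) det are equivariant, their images span, and e_d maps
   SI into the sum of the images of the e_k, k < d.  Composing each e_d with an
   equivariant projection that kills that sum, and adding up, yields an
   equivariant surjection that vanishes on SI. *)
From HB Require Import structures.
Require Import Defs.
From mathcomp Require Import boolp reals.
From mathcomp Require Import all_boot all_order all_fingroup all_algebra.
From mathcomp Require Import generic_quotient.
From mathcomp.real_closed Require Import complex.
From mathcomp Require Import mpoly ring.

Set Implicit Arguments.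
Unset Strict Implicit.
Unset Printing Implicit Defensive.

Import Order.TTheory GRing.Theory Num.Theory.

Local Open Scope ring_scope.
Local Open Scope quotient_scope.

(** * Ideals containing products of linear forms *)

(** The lower bound is an orbit harmonics argument: P_a is the leading form of the equation P_a(y) =
    [a+1 = m], so for a < m multiplication by P_a either kills an evaluation or moves it to a
    smaller d. The points have different m, so no single system of equations holds on all of them;
    the product D_0 ... D_(m-1) sorts them, since a multiple of theta_S reaches the top degree only
    if n - |S| = m. The same product kills invariants of positive degree in the theta_i along y: a
    coefficient of an invariant at more than m of the theta_i changes sign under a reflection that
    fixes y. The twist by det is the action on theta_1 ... theta_n. The value 1 at a+1 = m forces
    the squares of a solution in m unknowns to be nonzero and distinct, so that the stabiliser is
    the prescribed one. The number of faces is never computed: the codes of the spanning set inject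
    into the faces, and a surjection onto a space of that dimension then leaves no kernel beyond
    [SI]. *)

Section Ideals.
Variables (F : numFieldType) (n : nat).
Local Notation P := {mpoly F[n]}.
Implicit Types (p q l : P) (I J : P -> Prop) (m : 'X_{1..n}).

Definition is_ideal I :=
  [/\ I 0, forall p q, I p -> I q -> I (p + q) & forall p q, I q -> I (p * q)].

Section Closure.
Variable I : P -> Prop.
Hypothesis idI : is_ideal I.
Lemma is_ideal0 : I 0. Proof. by case: idI. Qed.
Lemma is_idealD p q : I p -> I q -> I (p + q). Proof. by case: idI => _ + _; apply. Qed.
Lemma is_idealMl p q : I q -> I (p * q). Proof. by case: idI => _ _; apply. Qed.
Lemma is_idealMr p q : I p -> I (p * q). Proof. by rewrite mulrC; apply: is_idealMl. Qed.
Lemma is_idealN p : I p -> I (- p). Proof. by rewrite -mulN1r; apply: is_idealMl. Qed.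
Lemma is_idealB p q : I p -> I q -> I (p - q).
Proof. by move=> Ip Iq; apply/is_idealD/is_idealN. Qed.
Lemma is_idealZ (a : F) p : I p -> I (a *: p).
Proof. by rewrite -mul_mpolyC; apply: is_idealMl. Qed.
Lemma is_ideal_sum (T : Type) (r : seq T) (Q : pred T) (f : T -> P) :
  (forall i, Q i -> I (f i)) -> I (\sum_(i <- r | Q i) f i).
Proof. by move=> If; apply: big_ind => //; [exact: is_ideal0 | exact: is_idealD]. Qed.
Lemma is_ideal_transl p q : I (p - q) -> I q -> I p.
Proof. by move=> Ipq Iq; rewrite -[p](subrK q); apply: is_idealD. Qed.

Lemma ideal_horner (Q : {poly P}) p q : I (p - q) -> I (Q.[p] - Q.[q]).
Proof.
move=> Ipq; elim/poly_ind: Q => [|Q c IHQ]; first by rewrite !horner0 subrr; exact: is_ideal0.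
rewrite !hornerMXaddC.
have -> : Q.[p] * p + c - (Q.[q] * q + c) = p * (Q.[p] - Q.[q]) + Q.[q] * (p - q)
  by ring.
by apply: is_idealD; apply: is_idealMl.
Qed.
End Closure.

(** The ideal (I, l), followed by the colon ideal (I : l); multiplication by l gives the exact
    sequence P/(I : l) -> P/I -> P/(I, l) -> 0. *)
Definition ideal_add I l q := exists r, I (q - r * l).
Definition ideal_colon I l q := I (l * q).

Lemma ideal_add_ideal I l : is_ideal I -> is_ideal (ideal_add I l).
Proof.
move=> idI; split.
- by exists 0; rewrite mul0r subrr; apply: is_ideal0.
- move=> p q [r Ip] [s Iq]; exists (r + s).
  by have -> : p + q - (r + s) * l = (p - r * l) + (q - s * l);
    [ring | apply: is_idealD].
- move=> p q [r Iq]; exists (p * r).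
  by have -> : p * q - p * r * l = p * (q - r * l); [ring | apply: is_idealMl].
Qed.

Lemma ideal_colon_ideal I l : is_ideal I -> is_ideal (ideal_colon I l).
Proof.
move=> idI; split; rewrite /ideal_colon.
- by rewrite mulr0; apply: is_ideal0.
- by move=> p q Ip Iq; rewrite mulrDr; apply: is_idealD.
- by move=> p q Iq; rewrite mulrCA; apply: is_idealMl.
Qed.

(* The quotient by I is spanned by one homogeneous polynomial of degree mdeg m
   for each entry m of ms. *)
Definition graded_span I (ms : seq 'X_{1..n}) :=
  exists2 b : 'X_{1..n} -> P, forall m, b m \is (mdeg m).-homog &
  forall q, exists c : 'X_{1..n} -> F, I (q - \sum_(m <- ms) c m *: b m).

(** The exponent of j records how many of the linear forms have been split off. *)
Definition shift_codes (j : 'I_n) (ms : seq 'X_{1..n}) k :=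
  flatten [seq [seq (U_(j) *+ i + m)%MM | m <- ms] | i <- iota 0 k].

Lemma shift_codesS j ms k :
  shift_codes j ms k.+1 = ms ++ [seq (U_(j) + m)%MM | m <- shift_codes j ms k].
Proof.
rewrite /shift_codes /=; congr (_ ++ _).
  by rewrite -[RHS]map_id; apply: eq_map => m; apply/mnmP=> i; rewrite mnmDE mulmnE muln0.
rewrite map_flatten -map_comp -[1%N]/(1 + 0)%N iotaDl -map_comp.
congr flatten; apply: eq_map => i /=; rewrite -map_comp; apply: eq_map => m /=.
by apply/mnmP=> k'; rewrite !(mnmDE, mulmnE) mulnDr muln1 addnA.
Qed.

(* If a product of linear forms l_1 ... l_k lies in I, then P/I is filtered by
   the multiples of the partial products, with subquotients that are quotients
   of P/(I, l_i). *)
Lemma graded_span_prod I (ls : seq P) (j : 'I_n) ms :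
    is_ideal I -> (forall l, l \in ls -> l \is 1.-homog) ->
    I (\prod_(l <- ls) l) -> (forall m, m \in ms -> m j = 0%N) ->
    (forall J l, l \in ls -> is_ideal J -> (forall p, I p -> J p) -> J l ->
       graded_span J ms) ->
  graded_span I (shift_codes j ms (size ls)).
Proof.
move=> + + + msj; elim: ls I => [|l ls IHls] I idI hls Ils spanI /=.
  exists (fun m => 'X_[m]) => [m|q]; first by rewrite dhomogX.
  exists (fun=> 0); rewrite big_nil subr0 -[q]mulr1.
  by apply: is_idealMl => //; move: Ils; rewrite big_nil.
have [b1 hb1 sp1] : graded_span (ideal_add I l) ms.
  apply: (spanI _ l); rewrite ?mem_head //.
  - exact: ideal_add_ideal.
  - by move=> p Ip; exists 0; rewrite mul0r subr0.
  - by exists 1; rewrite mul1r subrr; apply: is_ideal0.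
have [|||b2 hb2 sp2] := IHls (ideal_colon I l) (ideal_colon_ideal l idI).
- by move=> l' l'ls; apply: hls; rewrite in_cons l'ls orbT.
- by move: Ils; rewrite big_cons.
(* The recursion passes from I to the larger ideal (I : l); this is why the spanning hypothesis
   covers all J containing I. *)
- move=> J l' l'ls idJ IJ Jl'; apply: (spanI _ l'); rewrite ?in_cons ?l'ls ?orbT //.
  by move=> p Ip; apply: IJ; apply: is_idealMl.
(* Codes without j represent P/(I, l); a code with j stands for l times the element of P/(I : l)
   with one j less. *)
exists (fun m => if m j == 0%N then b1 m else l * b2 (m - U_(j))%MM) => [m|q].
  case: ifPn => [_|mj]; first exact: hb1.
  have -> : mdeg m = (1 + mdeg (m - U_(j))%MM)%N.
    rewrite -(mdeg1 j) -mdegD; congr mdeg; apply/mnmP=> i; rewrite !mnmE.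
    by case: eqVneq => [<-|_]; rewrite ?subn0 // addnC subnK // lt0n.
  by apply: dhomogM; [apply: hls; rewrite mem_head | exact: hb2].
have [c1 [r Ic1]] := sp1 q; have [c2 Ic2] := sp2 r.
exists (fun m => if m j == 0%N then c1 m else c2 (m - U_(j))%MM).
rewrite shift_codesS big_cat big_map /=.
rewrite [X in q - (X + _)](_ : _ = \sum_(m <- ms) c1 m *: b1 m); last first.
  by rewrite !big_seq; apply: eq_bigr => m /msj ->.
rewrite [X in q - (_ + X)](_ : _ = l * \sum_(m <- shift_codes j ms (size ls)) c2 m *: b2 m).
  have /(is_idealD idI Ic1) := Ic2; congr I; ring.
rewrite mulr_sumr; apply: eq_bigr => m _.
have -> : (U_(j) + m - U_(j) = m)%MM by apply/mnmP=> i; rewrite !mnmE addKn.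
by rewrite !mnmE eqxx /= scalerAr.
Qed.

Lemma ideal_const I q :
  is_ideal I -> (forall i, I 'X_i) -> I (q - q@_0%MM *: 1).
Proof.
move=> idI IX; rewrite {1}(mpolyE q).
have IXm m : m != 0%MM -> I 'X_[m].
  rewrite -mdeg_eq0 mdegE sum_nat_eq0 negb_forall => /existsP [i mi].
  have -> : m = (U_(i) + (m - U_(i)))%MM.
    apply/mnmP=> k; rewrite !mnmE; case: eqVneq => [<-|_]; rewrite ?subn0 //.
    by rewrite addnC subnK // lt0n.
  by rewrite mpolyXD; apply: is_idealMr.
have [m0|m0] := boolP (0%MM \in msupp q).
  rewrite (bigD1_seq 0%MM) ?msupp_uniq //= mpolyX0 addrAC subrr add0r.
  by apply: is_ideal_sum => // m nm; apply: (is_idealZ idI); apply: IXm.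
rewrite (memN_msupp_eq0 m0) scale0r subr0 big_seq; apply: is_ideal_sum => // m ms.
by apply: (is_idealZ idI); apply: IXm; apply: contraNneq m0 => <-.
Qed.

Section Tree.
Variables (wt : 'I_n -> nat) (S : {set 'I_n}).
Hypothesis wt_gt0 : forall i, (0 < wt i)%N.

(** The weights have two uses: all equal to 1 they give the P_a, and as multiplicities of
    coordinates they give the equations that produce points. *)
Definition wpower a : P := \sum_i (wt i)%:R *: 'X_i ^+ (2 * a + 2).
Definition free_below (j : 'I_n) : seq 'I_n :=
  [seq u : 'I_n <- enum 'I_n | (u < j)%N && (u \notin S)].
Definition sqdiff (us : seq 'I_n) i : P := \prod_(u <- us) ('X_i ^+ 2 - 'X_u ^+ 2).
Definition linforms (j : 'I_n) : seq P :=
  nseq (j \notin S).+1 'X_j ++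
  ([seq 'X_j - 'X_u | u <- free_below j] ++ [seq 'X_j + 'X_u | u <- free_below j]).
Definition nforms (j : 'I_n) : nat :=
  ((j \notin S).+1 + (size (free_below j) + size (free_below j)))%N.

(** The exponent vectors in the variables below t that are bounded by [nforms] ([box_lt],
    [mem_boxP]), in the form that [graded_span_prod] delivers. *)
Fixpoint box t : seq 'X_{1..n} :=
  if t is t'.+1 then
    if insub t' is Some j then shift_codes j (box t') (nforms j) else box t'
  else [:: 0%MM].

Lemma sqdiff_horner us i :
  sqdiff us i = (\prod_(u <- us) ('X - ('X_u ^+ 2)%:P)).[('X_i ^+ 2 : P)].
Proof. by rewrite horner_prod; apply: eq_bigr => u _; rewrite !hornerE. Qed.

(** The coefficients of Q are polynomials, so that Q may have the x_u^2 as roots and chosen terms of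
    the sum vanish. *)
Lemma wpower_horner (Q : {poly P}) k :
  \sum_i (wt i)%:R *: ('X_i ^+ (2 * k + 2) * Q.[('X_i ^+ 2 : P)])
    = \sum_(a < size Q) Q`_a * wpower (k + a).
Proof.
under eq_bigr do rewrite horner_coef mulr_sumr scaler_sumr.
rewrite exchange_big; apply: eq_bigr => a _; rewrite mulr_sumr.
apply: eq_bigr => i _; rewrite -scalerAr; congr (_ *: _).
by rewrite mulrCA -!exprM -exprD; congr (_ * _ ^+ _); rewrite mulnDr addnAC.
Qed.

Lemma ideal_wpower I (Q : {poly P}) k : is_ideal I -> (forall a, I (wpower a)) ->
  I (\sum_i (wt i)%:R *: ('X_i ^+ (2 * k + 2) * Q.[('X_i ^+ 2 : P)])).
Proof.
move=> idI Iw; rewrite wpower_horner; apply: is_ideal_sum => // a _.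
exact: is_idealMl.
Qed.

Lemma prod_linforms j :
  \prod_(l <- linforms j) l = 'X_j ^+ (j \notin S).+1 * sqdiff (free_below j) j.
Proof.
rewrite /linforms !big_cat !big_map big_nseq iter_mulr_1 /=.
rewrite -big_split /=; congr (_ * _).
by apply: eq_bigr => u _; rewrite -subr_sqr.
Qed.

Lemma size_linforms j : size (linforms j) = nforms j.
Proof. by rewrite !size_cat size_nseq !size_map. Qed.

Lemma linform_homog j l : l \in linforms j -> l \is 1.-homog.
Proof.
have hX i : ('X_i : P) \is 1.-homog by rewrite dhomogX /= mdeg1.
rewrite !mem_cat => /orP [/nseqP [-> _] //|/orP [] /mapP [u _ ->]].
  by rewrite dhomogD // dhomogN.
by rewrite dhomogD.
Qed.

Lemma mem_box t m : m \in box t -> forall i : 'I_n, (t <= i)%N -> m i = 0%N.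
Proof.
elim: t m => [|t IHt] m /=; first by rewrite inE => /eqP -> i _; rewrite mnm0E.
case: insubP => [j _ jt|_ /IHt mt i ti]; last exact: mt (ltnW ti).
case/flattenP=> s /mapP [k _ ->] /mapP [m' m't ->] i ti.
rewrite mnmDE mulmnE mnm1E (IHt _ m't) ?(ltnW ti) // -val_eqE /= jt.
by rewrite ltn_eqF.
Qed.

Lemma box_lt t m : m \in box t -> forall i, (m i < nforms i)%N.
Proof.
elim: t m => [|t IHt] m /=; first by rewrite inE => /eqP -> i; rewrite mnm0E.
case: insubP => [j _ jt|_ /IHt //].
case/flattenP=> s /mapP [k]; rewrite mem_iota => kj -> /mapP [m' m't ->] i.
rewrite mnmDE mulmnE mnm1E; case: eqVneq => [<-|_]; last by rewrite mul0n IHt.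
by rewrite (mem_box m't) -?jt // mul1n addn0.
Qed.

Lemma mem_boxP t m : (forall i : 'I_n, (i < t)%N -> (m i < nforms i)%N) ->
  (forall i : 'I_n, (t <= i)%N -> m i = 0%N) -> m \in box t.
Proof.
elim: t m => [|t IHt] m mlt m0 /=.
  by rewrite inE; apply/eqP/mnmP=> i; rewrite m0 ?mnm0E.
case: insubP => [j _ jt|nt]; last first.
  apply: IHt => i it; first by rewrite mlt // ltnW.
  by apply: m0; rewrite ltn_neqAle it andbT; apply: contraNneq nt => ->.
have mE i : (m - U_(j) *+ m j)%MM i = if i == j then 0%N else m i.
  rewrite mnmBE mulmnE mnm1E eq_sym; case: eqVneq => [->|_].
    by rewrite mul1n subnn.
  by rewrite mul0n subn0.
apply/flattenP; exists [seq (U_(j) *+ m j + m')%MM | m' <- box t].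
  by apply/mapP; exists (m j) => //; rewrite mem_iota /= mlt // jt.
apply/mapP; exists (m - U_(j) *+ m j)%MM.
  apply: IHt => i it; rewrite mE; case: eqVneq => // nij.
  - by rewrite mlt // ltnW.
  - by apply: m0; rewrite ltn_neqAle it andbT -jt eq_sym.
apply/mnmP=> i; rewrite mnmDE mE mulmnE mnm1E eq_sym; case: eqVneq => [->|_].
  by rewrite mul1n addn0.
by rewrite mul0n.
Qed.

Lemma size_shift_codes (j : 'I_n) ms k : size (shift_codes j ms k) = (k * size ms)%N.
Proof.
elim: k => [|k IHk] //; rewrite shift_codesS size_cat size_map IHk.
by rewrite mulSn.
Qed.

Lemma uniq_shift_codes (j : 'I_n) ms k : uniq ms -> (forall m, m \in ms -> m j = 0%N) ->
  uniq (shift_codes j ms k).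
Proof.
move=> ums msj; elim: k => [|k IHk] //; rewrite shift_codesS cat_uniq ums /=.
rewrite map_inj_uniq ?IHk ?andbT; last first.
  by move=> m m' /mnmP e; apply/mnmP=> i; have := e i; rewrite !mnmDE => /addnI.
apply/hasPn=> _ /mapP [m _ ->]; apply/negP => /msj.
by rewrite mnmDE mnm1E eqxx.
Qed.

Lemma uniq_box t : uniq (box t).
Proof.
elim: t => [|t IHt] //=; case: insubP => [j _ jt|_ //].
by apply: uniq_shift_codes => // m mt; apply: (mem_box mt); rewrite jt.
Qed.

Lemma size_box : size (box n) = \prod_(j < n) nforms j.
Proof.
suff sz t : (t <= n)%N -> size (box t) = \prod_(j < n | (j < t)%N) nforms j.
  by rewrite sz //; apply: eq_bigl => j; rewrite ltn_ord.
elim: t => [|t IHt] tn /=; first by rewrite big_pred0.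
case: insubP => [j _ jt|]; last by rewrite tn.
rewrite size_shift_codes IHt ?(ltnW tn) // [RHS](bigD1 j) /=; last by rewrite jt.
by congr (_ * _)%N; apply: eq_bigl => i; rewrite -val_eqE /= jt ltnS andbC -ltn_neqAle.
Qed.

Definition resolved J (i : 'I_n) :=
  J 'X_i \/ exists2 u : 'I_n, (u < i)%N && (u \notin S) &
                         J ('X_i - 'X_u) \/ J ('X_i + 'X_u).

(** Variables are eliminated from the last to the first: adding one of the linear forms of j to J
    makes x_j equal to 0 or, up to sign, to an earlier variable. At t = 0 all variables lie in J and
    only constants remain. *)
Lemma graded_span_box t J : (t <= n)%N -> is_ideal J -> (forall a, J (wpower a)) ->
    (forall j, j \in S -> J ('X_j * sqdiff (free_below j) j)) ->
    (forall i : 'I_n, (t <= i)%N -> resolved J i) ->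
  graded_span J (box t).
Proof.
elim: t J => [|t IHt] J tn idJ Jw JS res /=.
  exists (fun m => 'X_[m]) => [m|q]; first by rewrite dhomogX.
  exists (fun=> q@_0%MM); rewrite big_seq1 mpolyX0; apply: ideal_const => // i.
  elim/ltn_ind: {i}(val i) {-2}i (erefl (val i)) => k IHk i ik.
  have [//|[u /andP [ui _] Ju]] := res i isT.
  have Jxu : J 'X_u by apply: (IHk u) => //; rewrite -ik.
  case: Ju => [/(is_idealD idJ)/(_ Jxu)|/(is_idealB idJ)/(_ Jxu)].
    by rewrite subrK.
  by rewrite addrK.
case: insubP => [j _ jt|]; last by rewrite tn.
subst t; rewrite -size_linforms.
apply: graded_span_prod => //.
- exact: linform_homog.
- rewrite prod_linforms; case: (boolP (j \in S)) => jS /=.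
    by apply: JS.
  (* Modulo J each T i is a natural multiple of T j, and the weighted sum of the T i is in J by the
     power sums. Nothing cancels, as weights and multiples are nonnegative, so T j itself is in
     J. *)
  pose T (i : 'I_n) : P := 'X_i ^+ 2 * sqdiff (free_below j) i.
  have TE (i : 'I_n) : T i = ('X * \prod_(u <- free_below j) ('X - ('X_u ^+ 2)%:P)).[('X_i ^+ 2 : P)].
    by rewrite /T sqdiff_horner hornerM hornerX.
  have memf (u : 'I_n) : (u \in free_below j) = (u < j)%N && (u \notin S).
    by rewrite mem_filter mem_enum andbT.
  have Tfree (u : 'I_n) : (u < j)%N -> u \notin S -> T u = 0.
    move=> uj uS; have uf : u \in free_below j by rewrite memf uj.
    by rewrite /T /sqdiff (big_rem u) //= subrr mul0r mulr0.
  have Tmult (i : 'I_n) : exists k, J (T i - k%:R *: T j).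
    elim/ltn_ind: {i}(val i) {-2}i (erefl (val i)) => k IHk i ik.
    case: (ltngtP i j) => [ij|ji|/val_inj->]; last first.
    - by exists 1%N; rewrite scale1r subrr; apply: is_ideal0.
    - have [Jx|[u /andP [ui uS] Ju]] := res i ji.
        by exists 0%N; rewrite scale0r subr0 /T expr2 -mulrA; apply: is_idealMr.
      have [k' Jk'] : exists k, J (T u - k%:R *: T j) by apply: (IHk u) => //; rewrite -ik.
      (* T i depends on x_i only through x_i^2, so replacing x_i by plus or minus x_u turns it into
         T u. *)
      exists k'; rewrite -[T i](subrK (T u)) -addrA; apply: is_idealD => //.
      rewrite !TE; apply: ideal_horner => //; rewrite subr_sqr.
      by case: Ju => Ju; [apply: is_idealMr | apply: is_idealMl].
    - exists 0%N; rewrite scale0r subr0.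
      have [iS|iS] := boolP (i \in S); last by rewrite Tfree //; apply: is_ideal0.
      (* For i < j the free variables below i are among those below j, so T i is a multiple of the
         element of J that [JS] supplies for i. *)
      have ss : sqdiff (free_below j) i = sqdiff (free_below i) i *
          \prod_(u <- free_below j | (i <= u)%N) ('X_i ^+ 2 - 'X_u ^+ 2).
        rewrite /sqdiff (bigID (fun u : 'I_n => (u < i)%N)) /=; congr (_ * _).
          rewrite -[LHS]big_filter -filter_predI; apply: congr_big => //.
          apply: eq_filter => u /=; case: (ltnP u i) => //= ui.
          by rewrite (ltn_trans ui ij).
        by apply: eq_bigl => u; rewrite -leqNgt.
      rewrite /T ss; set r := \prod_(_ <- _ | _) _.
      have -> : 'X_i ^+ 2 * (sqdiff (free_below i) i * r)
          = 'X_i * r * ('X_i * sqdiff (free_below i) i) by ring.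
      by apply: is_idealMl => //; apply: JS.
  have [k Jk] := fin_all_exists Tmult.
  (* The chosen multiple of T j need not be 1, but any other value puts T j into J at once. *)
  have kj : k j = 1%N \/ J (T j).
    have := Jk j; case: (eqVneq (k j) 1%N) => [|kj1 Jkj]; first by left.
    right; have : J ((1 - (k j)%:R) *: T j) by rewrite scalerBl scale1r.
    move/(is_idealZ idJ (1 - (k j)%:R)^-1); rewrite scalerA mulVf ?scale1r //.
    by rewrite subr_eq0 -[1]/(1%:R) eqr_nat eq_sym.
  have JT : J (T j).
    case: kj => // kj.
    have Js : J (\sum_i (wt i)%:R *: T i).
      have := ideal_wpower (\prod_(u <- free_below j) ('X - ('X_u ^+ 2)%:P)) 0 idJ Jw.
      by congr J; apply: eq_bigr => i _; rewrite -sqdiff_horner.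
    have : J ((\sum_i (wt i)%:R * (k i)%:R) *: T j).
      rewrite scaler_suml -[X in J X](subKr (\sum_i (wt i)%:R *: T i)).
      apply: is_idealB => //; rewrite -sumrB; apply: is_ideal_sum => // i _.
      by rewrite -scalerA -scalerBr; apply: is_idealZ.
    set s := \sum_i _ => Jsj.
    have s0 : s != 0.
      rewrite /s (eq_bigr (fun i => (wt i * k i)%:R)) => [|i _]; last by rewrite natrM.
      rewrite -natr_sum pnatr_eq0 (bigD1 j) //= kj muln1.
      by rewrite -lt0n addn_gt0 wt_gt0.
    by have := is_idealZ idJ s^-1 Jsj; rewrite scalerA mulVf // scale1r.
  by [].
- by move=> m /mem_box; apply.
- move=> K l lj idK JK Kl; apply: IHt => //; first exact: ltnW.
  + by move=> a; apply: JK.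
  + by move=> i iS; apply/JK/JS.
  move=> i; rewrite leq_eqVlt => /orP [/eqP ti|ti]; last first.
    have [Jx|[u ui [Ju|Ju]]] := res i ti; [left|right|right]; first exact: JK.
      by exists u => //; left; apply: JK.
    by exists u => //; right; apply: JK.
  have {ti} -> : i = j by apply/val_inj/esym.
  move: lj; rewrite !mem_cat => /orP [/nseqP [lE _]|/orP [] /mapP [u]].
  - by left; rewrite -lE.
  - rewrite mem_filter => /andP [uj _] lE; right; exists u => //; left.
    by rewrite -lE.
  - rewrite mem_filter => /andP [uj _] lE; right; exists u => //; right.
    by rewrite -lE.
Qed.

End Tree.
End Ideals.

(** * Reduction of forms modulo [SI] *)

Section Invariants.
Variables (F : numFieldType) (n : nat).
Local Notation P := {mpoly F[n]}.
Local Notation Omega := (superspace F n).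
Implicit Types (p q : P) (f : Omega) (S T : {set 'I_n}) (g : hyperoctahedral n).

Lemma smonE S p T : (smon S p : Omega) T = if T == S then p else 0.
Proof. by rewrite ffunE. Qed.

Lemma signed_perm_act g : exists (t : 'S_n) (e : 'I_n -> bool),
  [/\ hyp_mx g = \matrix_(i, j) ((-1) ^+ e j *+ (t j == i)),
      forall i, tnth (act_xvar F g) i = (-1) ^+ e i *: 'X_(t i) &
      forall i, act_theta F g i = (-1) ^+ e i *: theta F (t i)].
Proof.
have /signed_perm_mxP [s [e eg]] := hyp_mxP g.
exists s^-1%g, (fun j => e (s^-1 j)%g).
have eg' : hyp_mx g = \matrix_(i, j) ((-1) ^+ e (s^-1 j)%g *+ ((s^-1)%g j == i)).
  rewrite eg; apply/matrixP=> i j; rewrite !mxE (canF_eq (permK s)) eq_sym.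
  by case: eqVneq => // ->.
split=> // i.
  rewrite tnth_mktuple (bigD1 (s^-1 i)%g) //= big1 ?addr0 => [|k nk].
    by rewrite eg' !mxE eqxx mulr1n rmorph_sign.
  by rewrite eg' !mxE eq_sym (negPf nk) scale0r.
rewrite /act_theta (bigD1 (s^-1 i)%g) //= big1 ?addr0 => [|k nk].
  by rewrite eg' !mxE eqxx mulr1n rmorph_sign.
by rewrite eg' !mxE eq_sym (negPf nk) scale0r.
Qed.

(** [power_sum] and [power_form] are the P_a and D_a. *)
Definition power_sum a : P := wpower F (fun=> 1%N) a.
Definition power_form a : Omega := \sum_i smon [set i] ('X_i ^+ (2 * a + 1)).

Lemma power_sumE a : power_sum a = \sum_i 'X_i ^+ (2 * a + 2).
Proof. by apply: eq_bigr => i _; rewrite scale1r. Qed.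

Lemma spoly_smon p S q : spoly p * smon S q = smon S (p * q) :> Omega.
Proof. by rewrite smonM theta_sign0l scale1r set0U. Qed.

Lemma act_xvarXn g i k :
  ('X_i ^+ k : P) \mPo act_xvar F g = tnth (act_xvar F g) i ^+ k.
Proof. by rewrite rmorphXn /= comp_mpolyXU -tnth_nth. Qed.

Lemma power_sum_act g a : power_sum a \mPo act_xvar F g = power_sum a.
Proof.
have [t [e [_ ex _]]] := signed_perm_act g.
rewrite power_sumE raddf_sum /= [RHS](reindex_inj (@perm_inj _ t)).
apply: eq_bigr => i _; rewrite act_xvarXn ex exprZn -exprM mulnDr.
by rewrite -signr_odd oddD !oddM !andbF scale1r.
Qed.

Lemma power_form_act g a : sact g (power_form a) = power_form a.
Proof.
have [t [e [_ ex et]]] := signed_perm_act g.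
rewrite raddf_sum [RHS](reindex_inj (@perm_inj _ t)); apply: eq_bigr => i _ /=.
rewrite sact_mon act_xvarXn ex big_set1 et exprZn -scalerAr spoly_smon.
rewrite mulr1 -!smonZ scalerA; congr smon; rewrite -exprM -exprD.
by rewrite -signr_odd !(oddD, oddM) /= andbT addbb scale1r.
Qed.

Lemma power_sum_SI a f f' : f * spoly (power_sum a) * f' \in @SI F n.
Proof.
apply/two_sided_idealM/two_sided_ideal_gen; split=> [g|].
  by rewrite sact_poly power_sum_act.
rewrite /constant_term smonE eqxx power_sumE raddf_sum big1 // => i _ /=.
by rewrite mcoeffXn -mdeg_eq0 mdegMn mdeg1 mul1n addn2.
Qed.

Lemma power_form_SI a f f' : f * power_form a * f' \in @SI F n.
Proof.
apply/two_sided_idealM/two_sided_ideal_gen; split=> [g|].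
  exact: power_form_act.
rewrite /constant_term sum_ffunE big1 ?mcoeff0 // => i _.
by rewrite smonE eq_sym -cards_eq0 cards1.
Qed.

Lemma power_form_horner (Q : {poly P}) b :
  \sum_i smon [set i] ('X_i ^+ (2 * b + 1) * Q.['X_i ^+ 2])
    = \sum_(a < size Q) spoly Q`_a * power_form (b + a).
Proof.
rewrite [RHS](eq_bigr (fun a : 'I_(size Q) => \sum_i spoly Q`_a *
    smon [set i] ('X_i ^+ (2 * (b + a) + 1)))) => [|a _]; last by rewrite mulr_sumr.
rewrite exchange_big; apply: eq_bigr => i _.
rewrite horner_coef mulr_sumr (big_morph _ (@smonD _ _ _) (@smon0 _ _ _)).
apply: eq_bigr => a _; rewrite spoly_smon; congr smon.
by rewrite mulrCA -!exprM -exprD; congr (_ * _ ^+ _); rewrite mulnDr addnAC.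
Qed.

Lemma sqdiff_form_SI us T :
  (\sum_i smon [set i] ('X_i * sqdiff F us i)) * smon T 1 \in @SI F n.
Proof.
have -> : \sum_i smon [set i] ('X_i * sqdiff F us i) = \sum_i smon [set i]
    ('X_i ^+ (2 * 0 + 1) * (\prod_(u <- us) ('X - ('X_u ^+ 2)%:P)).['X_i ^+ 2]) :> Omega.
  by apply: eq_bigr => i _; rewrite -sqdiff_horner.
by rewrite power_form_horner mulr_suml rpred_sum // => a _; apply: power_form_SI.
Qed.

Definition index_sum S : nat := \sum_(i in S) i.

(** The index sum strictly increases, so repeated reduction ends; for fixed S the reducible q form
    an ideal, to which [graded_span_box] applies. *)
Definition reducible S q := exists2 f : Omega,
  forall T, f T != 0 -> (index_sum S < index_sum T)%N & smon S q - f \in @SI F n.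

Lemma reducible_ideal S : is_ideal (reducible S).
Proof.
split.
- exists 0 => [T|]; first by rewrite ffunE eqxx.
  by rewrite smon0 subrr rpred0.
- move=> p q [f hf If] [f' hf' If']; exists (f + f') => [T|].
    rewrite ffunE; case: (eqVneq (f T) 0) => [->|/hf //].
    by rewrite add0r; apply: hf'.
  by rewrite smonD opprD addrACA rpredD.
- move=> p q [f hf If]; exists (spoly p * f) => [T|].
    rewrite [f]smon_sum mulr_sumr sum_ffunE (bigD1 T) //= big1 => [|U nU].
      rewrite spoly_smon smonE eqxx addr0.
      by case: (eqVneq (f T) 0) => [->|/hf //]; rewrite mulr0 eqxx.
    by rewrite spoly_smon smonE eq_sym (negPf nU).
  rewrite -spoly_smon -mulrBr -[_ * _]mulr1.
  exact: two_sided_idealM.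
Qed.

Lemma reducible_power_sum S a : reducible S (power_sum a).
Proof.
exists 0 => [T|]; first by rewrite ffunE eqxx.
by have := power_sum_SI a 1 (smon S 1); rewrite mul1r spoly_smon mulr1 subr0.
Qed.

Lemma reducible_sqdiff S j : j \in S ->
  reducible S ('X_j * sqdiff F (free_below S j) j).
Proof.
move=> jS; set us := free_below S j; pose T := S :\ j.
pose f : Omega := \sum_(i | i \notin S) smon (i |: T)
  (theta_sign F [set i] T *: ('X_i * sqdiff F us i)).
have SE : S = j |: T by rewrite setD1K.
have memus (u : 'I_n) : (u \in us) = (u < j)%N && (u \notin S).
  by rewrite mem_filter mem_enum andbT.
have sq0 u : u \in us -> sqdiff F us u = 0.
  by move=> uu; rewrite /sqdiff (big_rem u) //= subrr mul0r.
(* Terms with i in S other than j vanish because theta_i divides theta_T; i = j gives theta_S, and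
   the i outside S make up f. *)
have hf : smon S (theta_sign F [set j] T *: ('X_j * sqdiff F us j)) + f \in @SI F n.
  have := sqdiff_form_SI us T; rewrite mulr_suml (bigID (fun i => i \in S)) /=.
  rewrite (bigD1 j jS) /= [X in _ + X + _]big1 => [|i /andP [iS ij]].
    rewrite addr0 smonM mulr1 -SE; under eq_bigr do rewrite smonM mulr1.
    by [].
  have {}iS : i \in S by [].
  rewrite smonM /theta_sign disjoints1 in_setD1 iS ij /=.
  by rewrite scale0r smon0.
have signj : theta_sign F [set j] T * theta_sign F [set j] T = 1.
  rewrite /theta_sign disjoints1 !inE eqxx /= -expr2 -exprM.
  by rewrite mulnC exprM sqrrN !expr1n.
exists (- (theta_sign F [set j] T *: f)) => [U|]; last first.
  rewrite opprK -[smon _ _]scale1r -signj -scalerA -scalerDr -smonZ.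
  exact: SI_Z.
rewrite 2!ffunE oppr_eq0 => nz.
have {nz} : f U != 0 by apply: contraNneq nz => ->; rewrite scaler0.
rewrite sum_ffunE.
(* A surviving term of f has i > j, since the product vanishes at the free i < j; trading j for i
   raises the index sum. *)
case: (boolP [exists i, [&& i \notin S, (j < i)%N & U == i |: T]]).
  move=> /existsP [i /and3P [iS ji /eqP -> _]].
  rewrite /index_sum SE !big_setU1 ?setD11 ?ltn_add2r //.
  by rewrite !inE negb_and iS orbT.
rewrite negb_exists => /forallP hU; rewrite big1 ?eqxx // => i iS.
rewrite smonE; case: eqP => // UE; have := hU i; rewrite iS UE eqxx andbT /=.
rewrite -leqNgt leq_eqVlt => /orP [/eqP/val_inj ij|ij]; first by rewrite ij jS in iS.
by rewrite sq0 ?mulr0 ?scaler0 // memus ij.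
Qed.

Lemma reducible_span S : graded_span (reducible S) (box S n).
Proof.
apply: (graded_span_box (wt := fun=> 1%N)) => //.
- exact: reducible_ideal.
- exact: reducible_power_sum.
- by move=> j; apply: reducible_sqdiff.
- by move=> i; rewrite leqNgt ltn_ord.
Qed.

Lemma SI_span : exists b : {set 'I_n} -> 'X_{1..n} -> P, forall f : Omega,
  exists c : {set 'I_n} -> 'X_{1..n} -> F,
    f - \sum_S \sum_(m <- box S n) c S m *: smon S (b S m) \in @SI F n.
Proof.
have exb S : exists b : 'X_{1..n} -> P, forall q, exists c : 'X_{1..n} -> F,
    reducible S (q - \sum_(m <- box S n) c m *: b m).
  by have [b _ sp] := reducible_span S; exists b.
have [b sp] := fin_all_exists exb; exists b => f.
(* k bounds, over the support of f, the distance from the largest possible index sum; each reduction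
   lowers it, and k = 0 forces f = 0. *)
have [k] : exists k, forall T, f T != 0 -> (index_sum [set: 'I_n] < index_sum T + k)%N.
  by exists (index_sum [set: 'I_n]).+1 => T _; rewrite addnS ltnS leq_addl.
elim: k f => [|k IHk] f hf.
  suff -> : f = 0.
    exists (fun _ _ => 0); rewrite big1 ?subrr ?rpred0 // => S _.
    by rewrite big1 // => m _; rewrite scale0r.
  apply/ffunP=> T; rewrite ffunE; apply/eqP; apply: contraTT isT => /hf.
  rewrite addn0 ltnNge; apply: contraNN => _.
  by rewrite /index_sum [leqRHS](big_setID T) setTI /= leq_addr.
have exc S : exists c : 'X_{1..n} -> F, reducible S (f S - \sum_(m <- box S n) c m *: b S m).
  exact: sp.
have [c hc] := fin_all_exists exc.
(* Coefficients are set to 0 where f S = 0, so that the remainders come only from the support of f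
   and inherit its bound. *)
have exf S : exists f' : Omega, (forall T, f' T != 0 -> f S != 0 /\ (index_sum S < index_sum T)%N) /\
   smon S (f S) - (\sum_(m <- box S n) (if f S == 0 then 0 else c S m) *: smon S (b S m)) - f' \in @SI F n.
  case: (eqVneq (f S) 0) => [->|fS].
    exists 0; split=> [T|]; first by rewrite ffunE eqxx.
    by rewrite smon0 big1 ?subrr ?rpred0 // => m _; rewrite scale0r.
  have [f' hf' If'] := hc S; exists f'; split=> [T /hf' //|].
  move: If'; rewrite smonD -scaleN1r smonZ scaleN1r.
  rewrite (big_morph _ (@smonD _ _ _) (@smon0 _ _ _)).
  by under eq_bigr do rewrite smonZ.
have [f' /all_and2 [hf' If']] := fin_all_exists exf.
have [|c' hc'] := IHk (\sum_S f' S).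
  move=> T; rewrite sum_ffunE => nz.
  have [S fT] : exists S, f' S T != 0.
    apply/existsP; apply: contraR nz; rewrite negb_exists => /forallP f0.
    by rewrite big1 // => S _; have := f0 S; rewrite negbK => /eqP.
  have [/hf h1 h2] := hf' S T fT; apply: leq_trans h1 _.
  by rewrite addnS -addSn leq_add2r.
exists (fun S m => (if f S == 0 then 0 else c S m) + c' S m).
have IS : \sum_S (smon S (f S) - (\sum_(m <- box S n)
    (if f S == 0 then 0 else c S m) *: smon S (b S m)) - f' S) \in @SI F n.
  by apply: rpred_sum => S _; apply: If'.
have := rpredD IS hc'; rewrite 2!sumrB -smon_sum.
have -> : \sum_S \sum_(m <- box S n) ((if f S == 0 then 0 else c S m) + c' S m) *: smon S (b S m)
    = \sum_S \sum_(m <- box S n) (if f S == 0 then 0 else c S m) *: smon S (b S m)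
      + \sum_S \sum_(m <- box S n) c' S m *: smon S (b S m) :> Omega.
  rewrite -big_split; apply: eq_bigr => S _; rewrite -big_split.
  by apply: eq_bigr => m _; rewrite scalerDl.
by rewrite addrA subrK opprD addrA.
Qed.

End Invariants.

(** * Forms of top degree *)

Section AlternatingProducts.
Variables (F : numFieldType) (n : nat) (A : algType F) (v : 'I_n -> A).
Hypothesis v_sq : forall i, v i * v i = 0.
Hypothesis v_anti : forall i j, v i * v j = - (v j * v i).

Lemma prod_anticomm_seq (I : Type) (r : seq I) (f : I -> 'I_n) m :
  (\prod_(i <- r) v (f i)) * v m = (-1) ^+ size r *: (v m * \prod_(i <- r) v (f i)).
Proof.
elim: r => [|i r IHr]; first by rewrite big_nil mul1r mulr1 scale1r.
rewrite !big_cons -mulrA IHr -scalerAr !mulrA [v (f i) * v m]v_anti mulNr scalerN.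
by rewrite /= exprS mulN1r scaleNr.
Qed.

(** Moving the last factor past the product in between costs the same sign on both sides. *)
Lemma swap_odd a b (r : seq 'I_n) (f : 'I_n -> 'I_n) :
  v a * (\prod_(i <- r) v (f i)) * v b = - (v b * (\prod_(i <- r) v (f i)) * v a).
Proof.
rewrite -[LHS]mulrA -[X in - X]mulrA !prod_anticomm_seq -!scalerAr.
by rewrite !mulrA v_anti mulNr scalerN.
Qed.

Lemma split_two (T : eqType) (r : seq T) i j : i \in r -> j \in r -> i != j ->
  exists r1 r2 r3 a b, r = r1 ++ a :: r2 ++ b :: r3 /\ ((a, b) = (i, j) \/ (a, b) = (j, i)).
Proof.
case/splitPr=> r1 r2; rewrite mem_cat in_cons => /orP [] => [jr1 _|/orP [/eqP->|jr2 _]].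
- case/splitPr: jr1 => r3 r4; exists r3, r4, r2, j, i; split; last by right.
  by rewrite -catA.
- by rewrite eqxx.
- by case/splitPr: jr2 => r3 r4; exists r1, r3, r4, i, j; split; last by left.
Qed.

Lemma prod_odd_tperm (f : 'I_n -> 'I_n) (i j : 'I_n) : i != j ->
  \prod_k v (f (tperm i j k)) = - \prod_k v (f k).
Proof.
move=> ij; have := index_enum_uniq 'I_n.
have [r1 [r2 [r3 [a [b [-> ab]]]]]] :=
  split_two (mem_index_enum i) (mem_index_enum j) ij.
have {ab} -> : tperm i j = tperm a b by case: ab => [[-> ->] //|[-> ->]]; rewrite tpermC.
rewrite cat_uniq /= cat_uniq /= mem_cat in_cons has_cat /= !negb_or -!andbA.
case/and5P=> _ ar1 _ br1 /and5P [_ ar2 ab ar3 /and5P [_ br2 _ br3 _]].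
have fix_seq r : a \notin r -> b \notin r ->
    \prod_(k <- r) v (f (tperm a b k)) = \prod_(k <- r) v (f k).
  move=> ar br; rewrite !big_seq; apply: eq_bigr => k kr; rewrite tpermD //.
    by apply: contraNneq ar => ->.
  by apply: contraNneq br => ->.
rewrite !big_cat !big_cons !big_cat !big_cons /= !fix_seq // tpermL tpermR.
by rewrite ![_ * (_ * (v _ * _))]mulrA !mulrA -!(mulrA (\prod_(_ <- r1) _)) swap_odd
           !(mulrN, mulNr) !mulrA.
Qed.

Lemma prod_odd_perm (s : 'S_n) : \prod_k v (s k) = (-1) ^+ s *: \prod_k v k.
Proof.
have [ts -> dts] := prod_tpermP s; elim: ts dts => [_|[i j] ts IHts /= /andP [ij dts]].
  by rewrite big_nil odd_perm1 scale1r; apply: eq_bigr => k _; rewrite perm1.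
rewrite big_cons odd_mul_tperm ij signr_addb mulN1r scaleNr -IHts //=.
rewrite -(@prod_odd_tperm (\prod_(t <- ts) tperm t.1 t.2)%g i j) //.
by apply: eq_bigr => k _; rewrite permM.
Qed.

Lemma prod_odd_noninj (f : 'I_n -> 'I_n) (i j : 'I_n) : i != j -> f i = f j ->
  \prod_k v (f k) = 0.
Proof.
move=> ij; have [r1 [r2 [r3 [a [b [-> ab]]]]]] :=
  split_two (mem_index_enum i) (mem_index_enum j) ij.
move=> fij; have {ij fij ab} fab : f a = f b by case: ab => [[-> ->]|[-> ->]].
rewrite !big_cat !big_cons !big_cat !big_cons /= fab.
have z : v (f b) * (\prod_(k <- r2) v (f k)) * v (f b) = 0.
  by rewrite -mulrA prod_anticomm_seq -scalerAr mulrA v_sq mul0r scaler0.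
rewrite [X in _ * X](_ : _ = v (f b) * (\prod_(k <- r2) v (f k)) * v (f b)
  * \prod_(k <- r3) v (f k)); last by rewrite !mulrA.
by rewrite z mul0r mulr0.
Qed.

End AlternatingProducts.

Section TopForms.
Variables (F : numFieldType) (n : nat).
Local Notation P := {mpoly F[n]}.
Local Notation Omega := (superspace F n).
Implicit Types (p q : P) (f : Omega) (S T : {set 'I_n}) (g : hyperoctahedral n).

Lemma theta_sq i : theta F i * theta F i = 0 :> Omega.
Proof. by rewrite smonM /theta_sign disjoints1 !inE eqxx scale0r smon0. Qed.

Lemma smon_spoly S p : smon S p = spoly p * smon S 1 :> Omega.
Proof. by rewrite spoly_smon mulr1. Qed.

Lemma prod_spoly_theta (I : Type) (r : seq I) (p : I -> P) (t : I -> 'I_n) :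
  \prod_(i <- r) smon [set t i] (p i)
    = spoly (\prod_(i <- r) p i) * \prod_(i <- r) theta F (t i).
Proof.
elim: r => [|i r IHr]; first by rewrite !big_nil mulr1.
rewrite !big_cons IHr smon_spoly -/(theta F (t i)) spolyM -!mulrA; congr (_ * _).
by rewrite !mulrA spoly_central.
Qed.

(** Leibniz expansion: non-injective choices of columns vanish, and the others are permutations
    contributing their sign. *)
Lemma prod_linear_forms (M : 'M[P]_n) :
  \prod_i (\sum_j smon [set j] (M i j)) = smon setT (\det M) :> Omega.
Proof.
rewrite bigA_distr_bigA /=.
under eq_bigr do rewrite (prod_spoly_theta _ (fun i => M i (_ i))).
rewrite (bigID (fun f : {ffun 'I_n -> 'I_n} => injectiveb f)) /= addrC big1 ?add0r; last first.
  move=> f /injectivePn [i [j ij fij]].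
  by rewrite (prod_odd_noninj theta_sq (@theta_anti F n) ij fij) mulr0.
rewrite /determinant (big_morph _ (@smonD _ _ _) (@smon0 _ _ _)).
rewrite (reindex (fun s : 'S_n => val s)) /=; last first.
  have s0 : 'S_n := 1%g; exists (insubd s0) => /= s sP; last by rewrite insubdK.
  by rewrite valKd.
rewrite (eq_bigl xpredT) => [|s]; last exact: (valP s).
apply: eq_bigr => s _; rewrite (eq_bigr (fun i => M i (s i))) => [|i _]; last by rewrite -pvalE.
rewrite [X in _ * X](eq_bigr (fun i => theta F (s i))) => [|i _]; last by rewrite -pvalE.
rewrite (prod_odd_perm (@theta_anti F n)) -scalerAr.
rewrite [\prod_k theta F k](_ : _ = smon setT 1).
  by rewrite spoly_smon mulr1 -smonZ; congr smon; rewrite -signr_odd; case: (odd_perm s);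
     rewrite ?expr0 ?expr1 ?scale1r ?mul1r ?scaleN1r ?mulN1r.
by rewrite -theta_prod; apply: eq_bigl => i; rewrite inE.
Qed.

Definition form_degree f d := forall S, #|S| != d -> f S = 0.

Lemma form_degree_smon S p : form_degree (smon S p) #|S|.
Proof. by move=> T ST; rewrite smonE; case: eqP => // TS; rewrite TS eqxx in ST. Qed.
Arguments form_degree_smon : clear implicits.

Lemma form_degree_sum (I : Type) (r : seq I) (Q : pred I) (f : I -> Omega) d :
  (forall i, Q i -> form_degree (f i) d) -> form_degree (\sum_(i <- r | Q i) f i) d.
Proof. by move=> df S Sd; rewrite sum_ffunE big1 // => i Qi; apply: df. Qed.

Lemma mulE f f' W : (f * f') W =
  \sum_S \sum_T if S :|: T == W then theta_sign F S T *: (f S * f' T) else 0.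
Proof. exact: smulE. Qed.

Lemma mul_coef_eq0 f f' W :
  (forall S T, [disjoint S & T] -> S :|: T = W -> f S * f' T = 0) -> (f * f') W = 0.
Proof.
move=> ff'; rewrite mulE big1 // => S _; rewrite big1 // => T _.
case: eqP => // STW; rewrite /theta_sign; case: ifP => dST; last by rewrite scale0r.
by rewrite ff' ?scaler0.
Qed.

Lemma form_degreeM f f' d d' :
  form_degree f d -> form_degree f' d' -> form_degree (f * f') (d + d').
Proof.
move=> df df' W Wd; apply: mul_coef_eq0 => S T dST STW.
have [Sd|/df ->] := eqVneq #|S| d; last by rewrite mul0r.
have [Td|/df' ->] := eqVneq #|T| d'; last by rewrite mulr0.
by move: Wd; rewrite -STW cardsU (disjoint_setI0 dST) cards0 subn0 Sd Td eqxx.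
Qed.

Lemma form_degree_prod (I : Type) (r : seq I) (Q : pred I) (f : I -> Omega) :
  (forall i, Q i -> form_degree (f i) 1) ->
  form_degree (\prod_(i <- r | Q i) f i) (\sum_(i <- r | Q i) 1).
Proof.
move=> df; elim/big_rec2: _ => [|i d f' Qi dfi]; last first.
  by apply: form_degreeM => //; apply: df.
by have := form_degree_smon set0 1; rewrite cards0.
Qed.

Lemma act_theta_degree g i : form_degree (act_theta F g i) 1.
Proof.
apply: form_degree_sum => j _ S Sn; rewrite ffunE.
by rewrite (form_degree_smon [set j]) ?scaler0 // cards1.
Qed.

(** By [prod_linear_forms] g multiplies theta_1 ... theta_n by its determinant, the source of the
    twist by det; the other theta_S stay in lower degree. *)
Lemma sact_top g f :
  sact g f setT = hyp_det F g *: (f setT \mPo act_xvar F g).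
Proof.
rewrite /sact sum_ffunE (bigD1 setT) //= [X in _ + X]big1 ?addr0 => [|S nS]; last first.
  have : form_degree (spoly (f S \mPo act_xvar F g) * \prod_(i in S) act_theta F g i) #|S|.
    rewrite -[#|S|]add0n -sum1_card -[X in (X + _)%N](@cards0 'I_n).
    apply: form_degreeM; first exact: (form_degree_smon set0).
    by apply: form_degree_prod => i _; apply: act_theta_degree.
  apply; apply: contraNneq nS => Sn; rewrite eqEcard subsetT.
  by rewrite -Sn leqnn.
have -> : \prod_(i in [set: 'I_n]) act_theta F g i = smon setT (hyp_det F g)%:MP.
  rewrite (eq_bigl xpredT) => [|i]; last by rewrite inE.
  have -> : (hyp_det F g)%:MP = \det (\matrix_(i, j) ((hyp_mx g j i)%:~R : F)%:MP_[n]).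
    rewrite /hyp_det -det_tr -det_map_mx; congr (\det _).
    by apply/matrixP=> i j; rewrite !mxE.
  rewrite -prod_linear_forms; apply: eq_bigr => i _; apply: eq_bigr => j _.
  by rewrite mxE -smonZ -mul_mpolyC mulr1.
by rewrite spoly_smon smonE eqxx mulrC mul_mpolyC.
Qed.
End TopForms.

(** * Restriction of forms to the line through a point *)

Section Evaluation.
Variables (F : numFieldType) (n : nat).
Local Notation P := {mpoly F[n]}.
Local Notation Omega := (superspace F n).
Implicit Types (p q : P) (f : Omega) (S T : {set 'I_n}) (g : hyperoctahedral n).
Implicit Types (y : 'I_n -> F).

(** This is p(t y) as a polynomial in t; its coefficient at t^d is the value at y of the degree d
    part of p. *)
Definition line_eval y : P -> {poly F} := mmap polyC (fun i => y i *: 'X).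
HB.instance Definition _ y := GRing.RMorphism.copy (line_eval y) (line_eval y).

Lemma line_evalX y i : line_eval y 'X_i = y i *: 'X.
Proof. by rewrite /line_eval mmapX mmap1U. Qed.

Lemma line_evalC y c : line_eval y c%:MP = c%:P.
Proof. exact: mmapC. Qed.

Lemma line_evalZ y c p : line_eval y (c *: p) = c *: line_eval y p.
Proof. by rewrite -mul_mpolyC rmorphM /= line_evalC mul_polyC. Qed.

Lemma line_eval_comp g y p : line_eval y (p \mPo act_xvar F g)
  = line_eval (fun i => \sum_j (hyp_mx g j i)%:~R * y j) p.
Proof.
rewrite comp_mpolyE [p in RHS]mpolyE !raddf_sum; apply: eq_bigr => m _ /=.
rewrite !line_evalZ rmorph_prod /=; congr (_ *: _).
rewrite [in RHS]/line_eval mmapX; apply: eq_bigr => i _.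
rewrite rmorphXn /=; congr (_ ^+ _).
rewrite tnth_mktuple raddf_sum scaler_suml; apply: eq_bigr => j _ /=.
by rewrite line_evalZ line_evalX scalerA.
Qed.

Definition num_squares y : nat :=
  size (undup [seq y i ^+ 2 | i <- enum 'I_n & y i != 0]).

(** The transpose of g, that is its inverse, applied to y: a right action ([act_coordsM]). *)
Definition act_coords g y : 'I_n -> F := fun i => \sum_j (hyp_mx g j i)%:~R * y j.

Definition hyp_of (s : 'S_n) (e : 'I_n -> bool) : hyperoctahedral n :=
  HyperOct (introT (signed_perm_mxP _) (ex_intro _ s (ex_intro _ e (erefl _)))).

Lemma hyp_of_col (V : lmodType F) (v : 'I_n -> V) s e i :
  \sum_j (hyp_mx (hyp_of s e) j i)%:~R *: v j
    = (-1) ^+ e (s^-1 i)%g *: v (s^-1 i)%g.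
Proof.
rewrite (bigD1 (s^-1 i)%g) //= big1 ?addr0 => [|j nj].
  by rewrite !mxE permKV eqxx mulr1n rmorph_sign.
rewrite mxE (canF_eq (permK s)); case: eqP nj => [->|_ _]; rewrite ?eqxx //.
by rewrite scale0r.
Qed.

Lemma hyp_det_of s e : hyp_det F (hyp_of s e) = (\prod_i (-1) ^+ e i) * (-1) ^+ s.
Proof.
rewrite /hyp_det; set A := map_mx _ _.
have -> : A = diag_mx (\row_i (-1) ^+ e i) *m perm_mx s.
  apply/matrixP=> i j; rewrite mul_diag_mx !mxE rmorphMn /= rmorph_sign.
  by rewrite mulr_natr.
by rewrite det_mulmx det_diag det_perm; congr (_ * _); apply: eq_bigr => i _; rewrite mxE.
Qed.

Lemma num_squares_pigeonhole y T : (num_squares y < #|T|)%N ->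
  (exists2 j, j \in T & y j = 0) \/
  (exists i j, [/\ i \in T, j \in T, i != j & y i ^+ 2 = y j ^+ 2]).
Proof.
move=> lt_T; case: (boolP [exists j in T, y j == 0]) => [/existsP [j /andP [jT /eqP yj]]|n0].
  by left; exists j.
case: (boolP [exists i in T, [exists j in T, (i != j) && (y i ^+ 2 == y j ^+ 2)]]).
  move=> /existsP [i /andP [iT /existsP [j /and3P [jT ij /eqP yij]]]].
  by right; exists i, j.
move=> nij; move: lt_T; rewrite ltnNge => /negP []; rewrite cardE.
rewrite -(size_map (fun i => y i ^+ 2)); apply: uniq_leq_size.
  rewrite map_inj_in_uniq ?enum_uniq // => i j; rewrite !mem_enum => iT jT yij.
  apply/eqP; apply: contraNT nij => ij; apply/existsP; exists i; rewrite iT.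
  by apply/existsP; exists j; rewrite jT ij yij eqxx.
move=> _ /mapP [i iT ->]; rewrite mem_undup; apply/mapP; exists i => //.
rewrite mem_filter mem_enum andbT; apply: contraNneq n0 => yi.
by apply/existsP; exists i; rewrite yi eqxx andbT -mem_enum.
Qed.

(** A zero coordinate in T is fixed by its sign change, two coordinates with equal squares by a
    transposition up to sign; either reflection moves only indices in T. *)
Lemma exists_reflection y T : (num_squares y < #|T|)%N -> exists g,
  [/\ hyp_det F g = -1, forall l, l \notin T -> act_theta F g l = theta F l
    & act_coords g y =1 y].
Proof.
move=> /num_squares_pigeonhole [[j jT yj]|[i [j [iT jT ij yij]]]].
  exists (hyp_of 1 (pred1 j)); split=> [|l lT|i].
  - rewrite hyp_det_of odd_perm1 mulr1 (bigD1 j) //= eqxx big1 ?mulr1 ?expr1 //.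
    by move=> k /negPf ->.
  - rewrite /act_theta hyp_of_col invg1 perm1 /=; case: eqP => [lj|_].
      by rewrite lj jT in lT.
    by rewrite scale1r.
  rewrite /act_coords (@hyp_of_col F^o) invg1 perm1 /=; case: eqP => [->|_].
    by rewrite yj scaler0.
  by rewrite scale1r.
have [b yb] : exists b : bool, y i = (-1) ^+ b * y j.
  move/eqP: yij; rewrite eqf_sqr => /orP [] /eqP ->; first by exists false; rewrite mul1r.
  by exists true; rewrite mulN1r.
exists (hyp_of (tperm i j) (fun k => b && ((k == i) || (k == j)))); split=> [|l lT|l].
- rewrite hyp_det_of odd_tperm ij expr1 (bigD1 i) //= (bigD1 j) 1?eq_sym //= !eqxx orbT.
  rewrite big1 => [|k /andP [/negPf -> /negPf ->]]; last by rewrite andbF.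
  by rewrite andbT mulr1 -expr2 sqrr_sign mul1r.
- have [li lj] : l != i /\ l != j by split; apply: contraNneq lT => ->.
  rewrite /act_theta hyp_of_col tpermV tpermD /=; [|by rewrite eq_sym..].
  by rewrite (negPf li) (negPf lj) andbF scale1r.
rewrite /act_coords (@hyp_of_col F^o) tpermV /=.
case: tpermP => [->|->|/eqP/negPf -> /eqP/negPf ->]; rewrite ?eqxx ?orbT ?andbT.
- by rewrite yb.
- by rewrite yb; rewrite /GRing.scale /= mulrA -expr2 sqrr_sign mul1r.
- by rewrite andbF scale1r.
Qed.

Lemma mul_theta_top f T : (f * smon (~: T) 1) setT = theta_sign F T (~: T) *: f T.
Proof.
rewrite mulE (bigD1 T) //= [X in _ + X]big1 ?addr0 => [|S nS].
  rewrite (bigD1 (~: T)) //= [X in _ + X]big1 ?addr0 => [|U nU].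
    by rewrite setUCr eqxx smonE eqxx mulr1.
  by rewrite smonE (negPf nU) mulr0 scaler0 if_same.
rewrite big1 // => U _; case: eqP => // SU; rewrite smonE.
case: eqP => [UT|_]; last by rewrite mulr0 scaler0.
rewrite /theta_sign; case: ifP => dSU; last by rewrite scale0r.
case/eqP: nS; apply/setP=> i; have /setP/(_ i) := SU; rewrite UT !inE.
have := disjointFr dSU; rewrite UT => /(_ i); rewrite !inE.
by case: (i \in S) => [/(_ isT)/negbFE ->|_] //; rewrite /= => /negbTE.
Qed.

Definition line_null y f := forall T, line_eval y (f T) = 0.

Lemma line_nullMl y f f' : line_null y f' -> line_null y (f * f').
Proof.
move=> f0 T; rewrite mulE raddf_sum big1 // => S _; rewrite raddf_sum big1 // => U _ /=.
by case: ifP => _; rewrite ?raddf0 // line_evalZ rmorphM /= f0 mulr0 scaler0.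
Qed.

Lemma line_nullMr y f f' : line_null y f -> line_null y (f * f').
Proof.
move=> f0 T; rewrite mulE raddf_sum big1 // => S _; rewrite raddf_sum big1 // => U _ /=.
by case: ifP => _; rewrite ?raddf0 // line_evalZ rmorphM /= f0 mul0r scaler0.
Qed.

(** Multiplying by the theta_l outside T makes the coefficient of theta_T a top coefficient. The
    reflection of [exists_reflection] fixes f, these theta_l and y but has determinant -1, so along
    the line the coefficient equals its negative. *)
Lemma invariant_coef_null y f T : (forall g, sact g f = f) ->
  (num_squares y < #|T|)%N -> line_eval y (f T) = 0.
Proof.
move=> finv /exists_reflection [g [detg gth gy]].
have gU : sact g (smon (~: T) 1) = smon (~: T) 1 :> Omega.
  rewrite sact_mon comp_mpoly1 mul1r -theta_prod; apply: eq_bigr => l.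
  by rewrite inE; apply: gth.
have := sact_top g (f * smon (~: T) 1).
rewrite rmorphM /= finv gU detg scaleN1r mul_theta_top comp_mpolyZ.
have sign_neq0 : theta_sign F T (~: T) != 0.
  by rewrite /theta_sign -setI_eq0 setICr eqxx signr_eq0.
rewrite -scalerN => /(scalerI sign_neq0) /(congr1 (line_eval y)).
rewrite raddfN /= line_eval_comp (_ : line_eval _ (f T) = line_eval y (f T)).
  move/eqP; rewrite -addr_eq0 -mulr2n -(@scaler_nat F) scaler_eq0 pnatr_eq0.
  by move=> /eqP.
rewrite /line_eval ![mmap _ _ _]/(mmap _ _ _) /mmap; apply: eq_bigr => m _; congr (_ * _).
by apply: mmap1_eq => i; congr (_ *: _); apply: gy.
Qed.

Definition wedge m : Omega := \prod_(i < m) power_form F n i.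

Lemma wedge_degree m : form_degree (wedge m) m.
Proof.
rewrite -[X in form_degree _ X]card_ord -sum1_card; apply: form_degree_prod => i _.
apply: form_degree_sum => j _; rewrite -[X in form_degree _ X](cards1 j); exact: form_degree_smon.
Qed.

Lemma wedge_act g m : sact g (wedge m) = wedge m.
Proof.
by rewrite rmorph_prod /=; apply: eq_bigr => i _; apply: power_form_act.
Qed.

(** D_a commutes with theta_S up to (-1)^|S|; this brings the wedge next to the invariant in
    [positive_form_null]. *)
Lemma wedge_comm f m : exists f', f * wedge m = wedge m * f'.
Proof.
have comm1 f1 a : exists f', f1 * power_form F n a = power_form F n a * f'.
  exists (\sum_(S : {set _}) (-1) ^+ #|S| *: smon S (f1 S)).
  rewrite {1}[f1]smon_sum mulr_suml mulr_sumr; apply: eq_bigr => S _.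
  rewrite mulr_sumr -scalerAr mulr_suml scaler_sumr; apply: eq_bigr => j _.
  rewrite smon_spoly [smon [set j] _]smon_spoly -mulrA [smon S 1 * _]mulrA.
  rewrite -(spoly_central _ (smon S 1)) -mulrA -theta_prod prod_anticomm ?sum1_card.
  - rewrite -!scalerAr; congr (_ *: _); rewrite !mulrA -!(spoly_central (f1 S)).
    by rewrite !mulrA.
  - exact: theta_anti.
elim: m => [|m [f' IHm]]; first by exists f; rewrite /wedge big_ord0 mulr1 mul1r.
have [f'' e] := comm1 f' m; exists f''.
by rewrite /wedge big_ord_recr /= mulrA IHm -!mulrA e.
Qed.

(** f times the wedge is invariant and lives in degrees above m, because f has no part of degree 0
    and the wedge has degree m; [invariant_coef_null] kills these degrees. *)
Lemma positive_form_null y f m a b : (forall g, sact g f = f) -> f set0 = 0 ->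
  (num_squares y <= m)%N -> line_null y (a * f * b * wedge m).
Proof.
move=> finv f0 ym; have [b' e] := wedge_comm b m.
rewrite -mulrA e mulrA; apply: line_nullMr; rewrite -mulrA; apply: line_nullMl => T.
have [lt_mT|le_Tm] := ltnP m #|T|.
  apply: invariant_coef_null => [g|]; last exact: leq_ltn_trans ym lt_mT.
  by rewrite rmorphM /= finv wedge_act.
rewrite mul_coef_eq0 ?raddf0 // => S U dSU SUT.
have [Um|/wedge_degree ->] := eqVneq #|U| m; last by rewrite mulr0.
have -> : S = set0; last by rewrite f0 mul0r.
apply/eqP; rewrite -cards_eq0; move: le_Tm.
rewrite -SUT cardsU (disjoint_setI0 dSU) cards0 subn0 Um.
by rewrite -{2}[m]add0n leq_add2r leqn0.
Qed.

End Evaluation.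

(** * Invariant polynomials *)

Section InvariantPolynomials.
Variables (F : numFieldType) (n : nat).
Local Notation P := {mpoly F[n]}.
Implicit Types (p q : P) (m : 'X_{1..n}).

Local Notation "m # s" := [multinom m (s i) | i < n]
  (at level 40, left associativity, format "m # s").

Definition monomial_sum m : P := \sum_(s : 'S_n) 'X_[m#s].

Lemma monomial_sum_perm m (t : 'S_n) : monomial_sum (m#t) = monomial_sum m.
Proof.
rewrite /monomial_sum [RHS](reindex_inj (mulIg t)); apply: eq_bigr => s _.
by congr 'X_[_]; apply/mnmP=> i; rewrite !mnmE permM.
Qed.

Lemma monomial_sum_mul m k :
  (\sum_i 'X_i ^+ k) * monomial_sum m = \sum_i monomial_sum (m + U_(i) *+ k)%MM.
Proof.
rewrite mulr_sumr [RHS]exchange_big; apply: eq_bigr => s _.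
rewrite mulr_suml [RHS](reindex_inj (@perm_inj _ s)); apply: eq_bigr => i _ /=.
rewrite mpolyXn -mpolyXD; congr 'X_[_]; apply/mnmP=> j.
by rewrite !(mnmDE, mulmnE, mnmE) (inj_eq perm_inj) addnC.
Qed.

(* Multiplying the symmetrisation of x^m by the power sum of exponent m_j0
   gives positively many copies of it, plus symmetrised monomials in fewer
   variables. *)
Lemma monomial_sum_ideal (I : P -> Prop) m : is_ideal I ->
    (forall a, I (power_sum F n a)) -> m != 0%MM -> (forall i, ~~ odd (m i)) ->
  I (monomial_sum m).
Proof.
move=> idI Ips; have [k] := ubnP #|[set j | m j != 0%N]|.
elim: k m => // k IHk m mk m0 meven.
have [j0 mj0] : exists j, m j != 0%N.
  apply/existsP; apply: contraR m0; rewrite negb_exists => /forallP m0.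
  by apply/eqP/mnmP=> i; rewrite mnm0E; have := m0 i; rewrite negbK => /eqP.
(* m' is m with the exponent at j0 removed. Adding that exponent at i gives a permutation of m if i
   = j0 or m i = 0; otherwise it merges two exponents and leaves fewer variables. *)
pose m' := (m - U_(j0) *+ m j0)%MM.
have m'E j : m' j = if j == j0 then 0%N else m j.
  rewrite mnmBE mulmnE mnm1E eq_sym; case: eqVneq => [->|_].
    by rewrite mul1n subnn.
  by rewrite mul0n subn0.
have mE j1 j : (m' + U_(j1) *+ m j0)%MM j = ((if j == j0 then 0 else m j) + (j1 == j) * m j0)%N.
  by rewrite mnmDE mulmnE mnm1E m'E.
have Isum : I (\sum_i monomial_sum (m' + U_(i) *+ m j0)%MM).
  rewrite -monomial_sum_mul.
  apply: (is_idealMr idI); have := Ips (m j0)./2.-1; rewrite power_sumE.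
  congr I; apply: eq_bigr => i _; congr (_ ^+ _).
  rewrite mul2n -[m j0]odd_double_half (negPf (meven j0)) add0n half_double.
  have := mj0; rewrite -[m j0]odd_double_half (negPf (meven j0)) add0n half_double.
  by case: (m j0)./2 => // h _; rewrite doubleS addn2.
have same j1 : (j1 == j0) || (m j1 == 0%N) ->
    monomial_sum (m' + U_(j1) *+ m j0)%MM = monomial_sum m.
  move=> hj1; rewrite -(monomial_sum_perm m (tperm j0 j1)); congr monomial_sum.
  apply/mnmP=> j; rewrite mE mnmE; case: tpermP => [->|->|/eqP jj0 /eqP jj1].
  - rewrite eqxx add0n; case/orP: hj1 => [/eqP->|/eqP mj1]; first by rewrite eqxx mul1n.
    by rewrite mj1; case: eqVneq => [jj|]; rewrite ?mul0n // mul1n -mj1 jj.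
  - rewrite eqxx mul1n; case: eqVneq => // jj; case/orP: hj1 => [|/eqP ->] //.
    by rewrite (negPf jj).
  - by rewrite (negPf jj0) eq_sym (negPf jj1) mul0n addn0.
have Ismall : I (\sum_(i | ~~ ((i == j0) || (m i == 0%N))) monomial_sum (m' + U_(i) *+ m j0)%MM).
  apply: is_ideal_sum => // i; rewrite negb_or => /andP [ij0 mi]; apply: IHk.
  - rewrite ltnS in mk; apply: leq_trans mk; apply: proper_card; apply/properP; split.
      apply/subsetP=> j; rewrite !inE mE; have [->//|_] := eqVneq j j0.
      by have [<-//|_] := eqVneq i j; rewrite mul0n addn0.
    exists j0; rewrite !inE // mE eqxx (negPf ij0) mul0n.
    by [].
  - by apply/eqP=> /mnmP/(_ i)/eqP; rewrite mE eqxx mnm0E (negPf ij0) mul1n addn_eq0 (negPf mi).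
  - move=> j; rewrite mE oddD oddM (negPf (meven j0)) andbF addbF.
    by case: eqP.
have : I (#|[pred i | (i == j0) || (m i == 0%N)]|%:R *: monomial_sum m).
  rewrite scaler_nat -sumr_const.
  have := is_idealB idI Isum Ismall; rewrite (bigID (fun i => (i == j0) || (m i == 0%N))) /= addrK.
  by congr I; apply: eq_big => // i; apply: same.
set c := _%:R => Ic; have c0 : c != 0.
  by rewrite pnatr_eq0 -lt0n; apply/card_gt0P; exists j0; rewrite inE eqxx.
by have := is_idealZ idI c^-1 Ic; rewrite scalerA mulVf // scale1r.
Qed.

(** Sign changes force even exponents, and summing over permutations writes n! p as a combination of
    [monomial_sum]s. This handles the part of degree 0 in the theta_i of the generators of [SI]. *)
Lemma invariant_ideal (I : P -> Prop) p : is_ideal I ->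
    (forall a, I (power_sum F n a)) ->
    (forall g, p \mPo act_xvar F g = p) -> p@_0%MM = 0 -> I p.
Proof.
move=> idI Ips pinv p0.
have actE s e m : 'X_[m] \mPo act_xvar F (hyp_of s e)
    = (\prod_i (-1) ^+ (e (s^-1 i)%g * m i)) *: 'X_[m#s].
  rewrite comp_mpolyX (eq_bigr (fun i => ((-1) ^+ (e (s^-1 i)%g * m i))%:MP * 'X_(s^-1 i)%g ^+ m i)).
    rewrite big_split /= -rmorph_prod mul_mpolyC; congr (_ *: _).
    rewrite mpolyXE_id [LHS](reindex_inj (@perm_inj _ s)); apply: eq_bigr => i _.
    by rewrite permK mnmE.
  move=> i _; rewrite tnth_mktuple hyp_of_col exprZn -exprM mul_mpolyC.
  by [].
have even_supp m : m \in msupp p -> forall i, ~~ odd (m i).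
  move=> pm i; have := congr1 (mcoeff m) (pinv (hyp_of 1 (pred1 i))).
  rewrite comp_mpolyEX raddf_sum (bigD1_seq m) ?msupp_uniq //= [X in _ + X]big1_seq.
    rewrite addr0 actE scalerA mcoeffZ.
    have -> : m#(1 : 'S_n)%g = m by apply/mnmP=> j; rewrite mnmE perm1.
    rewrite mcoeffX eqxx mulr1 (bigD1 i) //= invg1 perm1 eqxx mul1n big1 ?mulr1.
      move: pm; rewrite mcoeff_msupp -signr_odd; case: odd => // pm0 /eqP.
      by rewrite mulrN1 eq_sym -addr_eq0 -mulr2n -mulr_natl mulf_eq0 pnatr_eq0 (negPf pm0).
    by move=> j nj; rewrite perm1 (negPf nj).
  move=> m' /andP [nm _]; rewrite actE scalerA mcoeffZ.
  have -> : m'#(1 : 'S_n)%g = m' by apply/mnmP=> j; rewrite mnmE perm1.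
  by rewrite mcoeffX (negPf nm) mulr0.
have symE : #|{: 'S_n}|%:R *: p = \sum_(m <- msupp p) p@_m *: monomial_sum m.
  rewrite scaler_nat -sumr_const; under [RHS]eq_bigr do rewrite scaler_sumr.
  rewrite exchange_big; apply: eq_bigr => s _.
  rewrite -{1}(pinv (hyp_of s (fun=> false))) comp_mpolyEX; apply: eq_bigr => m _.
  by rewrite actE big1 ?scale1r.
have nz : (#|{: 'S_n}|%:R : F) != 0.
  by rewrite pnatr_eq0 -lt0n; apply/card_gt0P; exists 1%g.
have : I (#|{: 'S_n}|%:R *: p).
  rewrite symE big_seq; apply: is_ideal_sum => // m pm; apply: is_idealZ => //.
  apply: monomial_sum_ideal => //; last exact: even_supp.
  by apply: contraTneq pm => ->; rewrite mcoeff_msupp p0 eqxx.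
by move=> Ip; have := is_idealZ idI (#|{: 'S_n}|%:R)^-1 Ip; rewrite scalerA mulVf // scale1r.
Qed.

End InvariantPolynomials.

(** * Evaluation at points *)

Section GradedEvaluation.
Variables (F : numFieldType) (n : nat).
Local Notation P := {mpoly F[n]}.
Local Notation Omega := (superspace F n).
Implicit Types (p q : P) (f : Omega) (S T : {set 'I_n}) (g : hyperoctahedral n).
Implicit Types (y : 'I_n -> F) (d : nat).

(** The polynomial in t with the coefficients e_d(f)(y). *)
Definition top_eval y f : {poly F} := line_eval y ((f * wedge F n (num_squares y)) setT).

Lemma top_evalD y f f' : top_eval y (f + f') = top_eval y f + top_eval y f'.
Proof. by rewrite /top_eval mulrDl ffunE raddfD. Qed.

Lemma top_eval0 y : top_eval y 0 = 0.
Proof. by rewrite /top_eval mul0r ffunE raddf0. Qed.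

Lemma top_evalZ y a f : top_eval y (a *: f) = a *: top_eval y f.
Proof. by rewrite /top_eval -scalerAl ffunE line_evalZ. Qed.

Lemma spoly_mul_coef p f T : (spoly p * f) T = p * f T.
Proof.
rewrite [f]smon_sum mulr_sumr !sum_ffunE mulr_sumr; apply: eq_bigr => S _.
by rewrite spoly_smon !smonE; case: eqP; rewrite ?mulr0.
Qed.

Lemma top_eval_spoly y p f : top_eval y (spoly p * f) = line_eval y p * top_eval y f.
Proof. by rewrite /top_eval -mulrA spoly_mul_coef rmorphM. Qed.

Lemma top_eval_degree y f k : form_degree f k -> (k + num_squares y != n)%N ->
  top_eval y f = 0.
Proof.
move=> df kn; have dw := form_degreeM df (@wedge_degree F n (num_squares y)).
rewrite /top_eval dw ?raddf0 //.
by rewrite cardsT card_ord eq_sym.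
Qed.

Lemma top_eval_positive y f a b : (forall g, sact g f = f) -> f set0 = 0 ->
  top_eval y (a * f * b) = 0.
Proof. by move=> finv f0; apply: positive_form_null. Qed.

Lemma line_eval_power_sum y a :
  line_eval y (power_sum F n a) = (\sum_i y i ^+ (2 * a + 2)) *: 'X^(2 * a + 2).
Proof.
rewrite power_sumE raddf_sum scaler_suml; apply: eq_bigr => i _ /=.
by rewrite rmorphXn /= line_evalX exprZn.
Qed.

Lemma num_squares_act g y : num_squares (act_coords g y) = num_squares y.
Proof.
have /signed_perm_mxP [s [e eg]] := hyp_mxP g.
have ysE i : act_coords g y i = (-1) ^+ e (s^-1 i)%g * y (s^-1 i)%g.
  have -> : g = hyp_of s e by apply/val_inj.
  exact: (@hyp_of_col F n F^o).
apply/perm_size/perm_undup => v; apply/mapP/mapP; case=> i.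
  rewrite mem_filter mem_enum andbT ysE mulf_eq0 signr_eq0 => yi ->.
  exists (s^-1 i)%g; first by rewrite mem_filter yi mem_enum.
  by rewrite exprMn sqrr_sign mul1r.
rewrite mem_filter mem_enum andbT => yi ->; exists (s i).
  by rewrite mem_filter mem_enum andbT ysE permK mulf_eq0 signr_eq0.
by rewrite ysE permK exprMn sqrr_sign mul1r.
Qed.

Lemma act_coordsM g h y : act_coords (g * h)%g y =1 act_coords h (act_coords g y).
Proof.
move=> i; rewrite /act_coords; under eq_bigr do rewrite mxE rmorph_sum mulr_suml.
rewrite exchange_big; apply: eq_bigr => j _; rewrite mulr_sumr; apply: eq_bigr => k _.
by rewrite rmorphM /= mulrA; congr (_ * _); rewrite mulrC.
Qed.

Lemma eq_line_eval y y' p : y =1 y' -> line_eval y p = line_eval y' p.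
Proof.
move=> yy; rewrite /line_eval /mmap; apply: eq_bigr => m _; congr (_ * _).
by apply: mmap1_eq => i; rewrite yy.
Qed.

Lemma eq_top_eval y y' f : y =1 y' -> top_eval y f = top_eval y' f.
Proof.
move=> yy; rewrite /top_eval (eq_line_eval _ yy); congr (line_eval _ ((_ * wedge _ _ _) _)).
rewrite /num_squares; congr (size (undup _)); rewrite (eq_filter (a2 := fun i => y' i != 0)).
  by apply: eq_map => i; rewrite yy.
by move=> i; rewrite yy.
Qed.

Lemma top_eval_act g y f :
  top_eval y (sact g f) = hyp_det F g *: top_eval (act_coords g y) f.
Proof.
rewrite /top_eval num_squares_act -{1}(wedge_act F g) -rmorphM /= sact_top.
by rewrite line_evalZ line_eval_comp.
Qed.

Section Points.
Variables (X : finType) (pt : X -> 'I_n -> F).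
Hypothesis pt_power : forall x a, (a < num_squares (pt x))%N ->
  \sum_i pt x i ^+ (2 * a + 2) = (a.+1 == num_squares (pt x))%:R.

Definition graded_eval d f : {ffun X -> F^o} := [ffun x => (top_eval (pt x) f)`_d].

Lemma graded_eval_linear d : linear (graded_eval d).
Proof.
move=> a f f'; apply/ffunP=> x; rewrite !ffunE top_evalD top_evalZ coefD coefZ.
by [].
Qed.
HB.instance Definition _ d :=
  GRing.isLinear.Build F Omega {ffun X -> F^o} _ (graded_eval d) (graded_eval_linear d).

Definition below d (v : {ffun X -> F^o}) :=
  exists w : nat -> Omega, v = \sum_(i < d) graded_eval i (w i).

Lemma belowD d u v : below d u -> below d v -> below d (u + v).
Proof.
move=> [w ->] [w' ->]; exists (fun i => w i + w' i); rewrite -big_split.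
by apply: eq_bigr => i _; rewrite raddfD.
Qed.

Lemma belowZ d a u : below d u -> below d (a *: u).
Proof.
move=> [w ->]; exists (fun i => a *: w i); rewrite scaler_sumr.
by apply: eq_bigr => i _; rewrite linearZ.
Qed.

Lemma below0 d : below d 0.
Proof. by exists (fun=> 0); rewrite big1 // => i _; rewrite raddf0. Qed.

Lemma below_sum d (I : Type) (r : seq I) (Q : pred I) (u : I -> {ffun X -> F^o}) :
  (forall i, Q i -> below d (u i)) -> below d (\sum_(i <- r | Q i) u i).
Proof. by move=> ur; elim/big_ind: _ => //; [apply: below0 | apply: belowD]. Qed.

Lemma below_graded_eval d k f : (k < d)%N -> below d (graded_eval k f).
Proof.
move=> kd; exists (fun i => if i == k then f else 0).
rewrite (bigD1 (Ordinal kd)) //= eqxx big1 ?addr0 // => i.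
by rewrite -val_eqE /= => /negPf ->; rewrite raddf0.
Qed.

Lemma below_widen d d' u : (d <= d')%N -> below d u -> below d' u.
Proof.
move=> dd' [w ->]; apply: below_sum => i _; apply: below_graded_eval.
exact: leq_trans (ltn_ord i) dd'.
Qed.

Lemma theta_sign_sqr S T : [disjoint S & T] -> theta_sign F S T * theta_sign F S T = 1.
Proof.
move=> dST; rewrite /theta_sign dST -expr2 -exprM mulnC exprM sqrrN.
by rewrite !expr1n.
Qed.

Lemma power_form_invariant a : (forall g, sact g (power_form F n a) = power_form F n a)
  /\ power_form F n a set0 = 0.
Proof.
split=> [g|]; first exact: power_form_act.
rewrite sum_ffunE big1 // => i _.
by rewrite smonE eq_sym -cards_eq0 cards1.
Qed.

(* Up to sign this is theta_(S \ j) times the sum over all i of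
   x_i prod_u (x_i^2 - x_u^2) theta_i, a combination of power forms. *)
Lemma top_eval_sqdiff y S j f : j \in S ->
  top_eval y (spoly ('X_j * sqdiff F (enum (~: S)) j) * smon S 1 * f) = 0.
Proof.
move=> jS; set us := enum _; pose T := S :\ j.
have sq0 i : i \notin S -> sqdiff F us i = 0.
  by move=> iS; rewrite /sqdiff (big_rem i) ?mem_enum ?inE //= subrr mul0r.
have SE : S = j |: T by rewrite setD1K.
have dj : [disjoint [set j] & T] by rewrite disjoints1 !inE eqxx.
have -> : spoly ('X_j * sqdiff F us j) * smon S 1
    = theta_sign F [set j] T *:
      ((\sum_i smon [set i] ('X_i * sqdiff F us i)) * smon T 1) :> Omega.
  rewrite mulr_suml (bigD1 j) //= big1 ?addr0 => [|i ij].
    rewrite smonM mulr1 -SE -smonZ scalerA theta_sign_sqr // scale1r.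
    by rewrite spoly_smon mulr1.
  have [iS|iS] := boolP (i \in S); last by rewrite sq0 // mulr0 smon0 mul0r.
  by rewrite smonM /theta_sign disjoints1 !inE ij iS scale0r smon0.
have -> : \sum_i smon [set i] ('X_i * sqdiff F us i) = \sum_i smon [set i]
    ('X_i ^+ (2 * 0 + 1) * (\prod_(u <- us) ('X - ('X_u ^+ 2)%:P)).['X_i ^+ 2]) :> Omega.
  by apply: eq_bigr => i _; rewrite -sqdiff_horner.
rewrite power_form_horner mulr_suml.
elim: (index_enum _) => [|a r IHr]; first by rewrite big_nil scaler0 mul0r top_eval0.
have [pinv p0] := power_form_invariant a.
rewrite big_cons scalerDr mulrDl top_evalD IHr addr0 -scalerAl top_evalZ -(mulrA _ (smon T 1)).
by rewrite top_eval_positive ?scaler0.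
Qed.

(** Only points with m = n - |S| see theta_S. For a < m, P_a is 0 or 1 there, so the result is 0 or
    e_(d-2a-2)(q theta_S). For a >= m, P_a is traded for power sums of smaller index. *)
Lemma graded_eval_power_sum_smon a d S q :
  below d (graded_eval d (spoly (power_sum F n a) * smon S q)).
Proof.
elim/ltn_ind: a S q => a IHa S q; pose m := #|~: S|.
have mE : (#|S| + m)%N = n by rewrite cardsC card_ord.
have other x f' : form_degree f' #|S| -> num_squares (pt x) != m -> top_eval (pt x) f' = 0.
  by move=> df nm; apply: (top_eval_degree df); rewrite -[X in _ != X]mE eqn_add2l.
have dS r : form_degree (smon S r : Omega) #|S| by apply: form_degree_smon.
have [am|ma] := ltnP a m.
  have [lt_d|le_d] := ltnP d (2 * a + 2).
    suff -> : graded_eval d (spoly (power_sum F n a) * smon S q) = 0 by apply: below0.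
    apply/ffunP=> x; rewrite !ffunE top_eval_spoly line_eval_power_sum.
    by rewrite -scalerAl coefZ coefXnM lt_d mulr0.
  suff -> : graded_eval d (spoly (power_sum F n a) * smon S q)
      = (a.+1 == m)%:R *: graded_eval (d - (2 * a + 2)) (smon S q).
    by apply/belowZ/below_graded_eval; rewrite ltn_subrL addn2 /= (leq_trans _ le_d) // addn2.
  apply/ffunP=> x; rewrite !ffunE top_eval_spoly line_eval_power_sum.
  rewrite -scalerAl coefZ coefXnM ltnNge le_d /=.
  have [xm|xm] := eqVneq (num_squares (pt x)) m.
    by rewrite pt_power xm.
  by rewrite other // coef0 mulr0 scaler0.
(* Q is monic of degree m, so G is P_a plus multiples of smaller power sums. G theta_S evaluates to
   0: Q vanishes at x_i^2 for i outside S, and [top_eval_sqdiff] treats i in S. *)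
pose Q : {poly P} := \prod_(u <- enum (~: S)) ('X - ('X_u ^+ 2)%:P).
have sQ : size Q = m.+1.
  by rewrite /Q -(big_map (fun u => 'X_u ^+ 2 : P) xpredT (fun z => 'X - z%:P))
     size_prod_XsubC size_map -cardE.
have lQ : Q`_m = 1.
  have := monic_prod_XsubC (enum (~: S)) xpredT (fun u => 'X_u ^+ 2 : P).
  by rewrite -/Q monicE /lead_coef sQ => /eqP.
pose G : P := \sum_i 'X_i ^+ (2 * (a - m) + 2) * Q.['X_i ^+ 2].
have GE : G = power_sum F n a + \sum_(l < m) Q`_l * power_sum F n (a - m + l).
  rewrite addrC -[X in _ + power_sum _ _ X](subnK ma) -[power_sum _ _ (_ + m)]mul1r -lQ.
  rewrite -(big_ord_recr m (fun l => Q`_l * power_sum F n (a - m + l))) /=.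
  rewrite -sQ /G; under [RHS]eq_bigr do rewrite power_sumE mulr_sumr.
  rewrite exchange_big; apply: eq_bigr => i _; rewrite horner_coef mulr_sumr.
  apply: eq_bigr => l _; rewrite mulrCA -!exprM -exprD; congr (_ * _ ^+ _).
  by rewrite mulnDr addnAC.
have G0 x f' : top_eval (pt x) (spoly G * smon S 1 * f') = 0.
  rewrite spoly_central /G /spoly (big_morph _ (@smonD _ _ _) (@smon0 _ _ _)).
  rewrite mulr_sumr mulr_suml; elim: (index_enum _) => [|i r IHr].
    by rewrite big_nil top_eval0.
  rewrite big_cons top_evalD IHr addr0 -/(spoly _) -spoly_central.
  have [iS|iS] := boolP (i \in S); last first.
    have -> : Q.['X_i ^+ 2] = 0.
      have iu : i \in enum (~: S) by rewrite mem_enum inE.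
      by rewrite -sqdiff_horner /sqdiff (big_rem i iu) /= subrr mul0r.
    by rewrite mulr0 /spoly smon0 !mul0r top_eval0.
  have -> : 'X_i ^+ (2 * (a - m) + 2) * Q.['X_i ^+ 2]
     = 'X_i ^+ (2 * (a - m) + 1) * ('X_i * sqdiff F (enum (~: S)) i).
    by rewrite mulrA -exprSr addn1 addn2 sqdiff_horner.
  by rewrite spolyM -!mulrA top_eval_spoly mulrA top_eval_sqdiff // mulr0.
have -> : spoly (power_sum F n a) * smon S q = spoly G * smon S 1 * spoly q
    - \sum_(l < m) spoly (power_sum F n (a - m + l)) * smon S (Q`_l * q) :> Omega.
  rewrite -mulrA -(spoly_central q) -(smon_spoly S q) GE [spoly (_ + _)]smonD mulrDl.
  rewrite -addrA.
  rewrite -[LHS]addr0; congr (_ + _).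
  rewrite (big_morph (@smon F n set0) (@smonD F n set0) (@smon0 F n set0)) mulr_suml.
  rewrite -sumrB big1 // => l _; rewrite -/(spoly _).
  by rewrite -(spoly_smon Q`_l) mulrA -spolyM [Q`_l * _]mulrC subrr.
rewrite linearB /=; apply: belowD.
  suff -> : graded_eval d (spoly G * smon S 1 * spoly q) = 0 by apply: below0.
  by apply/ffunP=> x; rewrite !ffunE G0 coef0.
rewrite -scaleN1r; apply: belowZ; rewrite raddf_sum; apply: below_sum => l _.
apply: IHa; rewrite -[X in (_ < X)%N](subnK ma) ltn_add2l.
exact: ltn_ord.
Qed.

Lemma graded_eval_power_sum a d f : below d (graded_eval d (spoly (power_sum F n a) * f)).
Proof.
rewrite [f]smon_sum mulr_sumr raddf_sum; apply: below_sum => S _.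
exact: graded_eval_power_sum_smon.
Qed.

Lemma graded_eval_ideal d f : f \in @SI F n -> below d (graded_eval d f).
Proof.
move=> /two_sided_idealP [k [l [p [r [Gp ->]]]]]; rewrite raddf_sum.
apply: below_sum => i _ /=; have [pinv p0] := Gp i.
(* A generator splits into an invariant polynomial without constant term, to which [invariant_ideal]
   applies, and an invariant of positive degree in the theta_i, which evaluates to 0. *)
have pE : p i = spoly (p i set0) + (p i - spoly (p i set0)) by rewrite addrC subrK.
have cinv g : (p i set0) \mPo act_xvar F g = p i set0.
  have := congr1 (fun f : Omega => f set0) (pinv g); rewrite /= /sact sum_ffunE (bigD1 set0) //=.
  rewrite big_set0 mulr1 smonE eqxx big1 ?addr0 // => S S0; rewrite spoly_mul_coef.
  have -> : (\prod_(j in S) act_theta F g j) set0 = 0; last by rewrite mulr0.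
  have : form_degree (\prod_(j in S) act_theta F g j) (\sum_(j in S) 1).
    by apply: form_degree_prod => j _; apply: act_theta_degree.
  by apply; rewrite cards0 sum1_card eq_sym cards_eq0.
rewrite {1}pE mulrDr mulrDl raddfD /=; apply: belowD; last first.
  suff -> : graded_eval d (l i * (p i - spoly (p i set0)) * r i) = 0 by apply: below0.
  apply/ffunP=> x; rewrite !ffunE top_eval_positive ?coef0 //.
    by move=> g; rewrite raddfB /= pinv sact_poly cinv.
  by rewrite !ffunE eqxx subrr.
pose I q := forall l r, below d (graded_eval d (l * spoly q * r)).
suff : I (p i set0) by apply.
apply: invariant_ideal cinv p0.
- split=> [l' r'|q q' Iq Iq' l' r'|q q' Iq l' r'].
  + by rewrite /spoly smon0 mulr0 mul0r raddf0; apply: below0.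
  + rewrite /spoly smonD mulrDr mulrDl raddfD; apply: belowD; [exact: Iq|exact: Iq'].
  + by rewrite spolyM mulrA; apply: Iq.
- by move=> a l' r'; rewrite -spoly_central -mulrA; apply: graded_eval_power_sum.
Qed.

End Points.

End GradedEvaluation.

(** * Equivariant projections *)

Section AveragedProjection.
Variables (F : numFieldType) (E : vectType F) (B : E -> Prop).
Hypotheses (B0 : B 0) (BD : forall u v, B u -> B v -> B (u + v)).
Hypothesis BZ : forall a u, B u -> B (a *: u).

(** A subspace inside B is enlarged by one vector of B at a time; the dimension of E bounds the
    number of steps. *)
Lemma subspace_of_pred : exists U : {vspace E}, forall v, v \in U <-> B v.
Proof.
have [k] : exists k,
    (\dim {:E} - \dim (0%VS : {vspace E}) < k)%N by exists (\dim {:E} - \dim (0%VS : {vspace E})).+1.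
have : forall v, v \in 0%VS -> B v by move=> v; rewrite memv0 => /eqP ->.
elim: k (0%VS : {vspace E}) => // k IHk U UB Uk.
case: (pselect (exists2 v, B v & v \notin U)) => [[v Bv vU]|nv]; last first.
  exists U => v; split=> [/UB //|Bv]; apply/negP => /negP vU.
  by apply: nv; exists v.
apply: (IHk (U + <[v]>)%VS) => [w /memv_addP [u uU [_ /vlineP [a ->] ->]]|].
  by apply: BD; [apply: UB | apply: BZ].
have lt_dim : (\dim U < \dim (U + <[v]>)%VS)%N.
  rewrite ltn_neqAle dimvS ?addvSl // andbT; apply: contra vU => eq_dim.
  have /eqP -> : (U == U + <[v]>)%VS by rewrite eqEdim addvSl (eqP eq_dim) leqnn.
  by rewrite memvE addvSr.
have le_dim := dimvS (subvf (U + <[v]>)%VS).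
rewrite ltnS in Uk; apply: leq_trans Uk; apply: ltn_sub2l => //.
exact: leq_trans lt_dim le_dim.
Qed.

Variables (gT : finGroupType) (act : gT -> E -> E).
Hypotheses (act_lin : forall g, linear (act g)).
Hypotheses (act1 : forall v, act 1%g v = v).
Hypothesis actM : forall g h v, act (g * h)%g v = act g (act h v).
Hypothesis B_act : forall g v, B v -> B (act g v).

(** Maschke's argument: a linear projector onto the stable subspace B is averaged over the group. *)
Lemma averaged_projection : exists R : E -> E,
  [/\ linear R, forall v, B (R v), forall v, B v -> R v = v
    & forall g v, R (act g v) = act g (R v)].
Proof.
have [U UB] := subspace_of_pred.
have actD g u v : act g (u + v) = act g u + act g v.
  by have := act_lin g 1 u v; rewrite !scale1r.
have act0 g : act g 0 = 0 by apply: (addrI (act g 0)); rewrite -actD !addr0.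
have actZ g a v : act g (a *: v) = a *: act g v.
  by have := act_lin g a v 0; rewrite act0 !addr0.
have actS g (I : Type) (r : seq I) (f : I -> E) :
    act g (\sum_(i <- r) f i) = \sum_(i <- r) act g (f i).
  exact: (big_morph _ (actD g) (act0 g)).
pose c : F := #|{: gT}|%:R; have c0 : c != 0.
  by rewrite pnatr_eq0 -lt0n; apply/card_gt0P; exists 1%g.
exists (fun v => c^-1 *: \sum_g act g (projv U (act g^-1%g v))); split.
- move=> a u v; rewrite scalerA mulrC -scalerA -scalerDr; congr (_ *: _).
  rewrite scaler_sumr -big_split; apply: eq_bigr => g _ /=.
  by rewrite actD actZ linearP actD actZ.
- move=> v; apply: BZ; apply: big_ind => // g _; apply: B_act.
  by apply/UB; apply: memv_proj.
- move=> v Bv; rewrite (eq_bigr (fun=> v)) => [|g _].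
    by rewrite sumr_const -scaler_nat scalerA mulVf ?scale1r.
  by rewrite projv_id -?actM ?mulgV ?act1 //; apply/UB/B_act.
- move=> h v; rewrite actZ actS; congr (_ *: _).
  rewrite (reindex_inj (mulgI h)); apply: eq_bigr => g _ /=.
  by rewrite actM invMg -!actM -mulgA mulVg mulg1.
Qed.

End AveragedProjection.

(** * Nonvanishing of the top coefficient *)

Section Surjectivity.
Variables (F : numFieldType) (n : nat).
Local Notation P := {mpoly F[n]}.
Local Notation Omega := (superspace F n).
Implicit Types (p q : P) (f : Omega) (S T : {set 'I_n}) (g : hyperoctahedral n).
Implicit Types (y : 'I_n -> F) (d : nat).

Definition point_eval y : P -> F := horner_eval 1 \o line_eval y.
HB.instance Definition _ y := GRing.RMorphism.copy (point_eval y) (horner_eval 1 \o line_eval y).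

Lemma point_evalX y i : point_eval y 'X_i = y i.
Proof. by rewrite /point_eval /= line_evalX /horner_eval hornerZ hornerX mulr1. Qed.

(** The smallest index for each nonzero value among the squares, hence m indices. *)
Definition first_squares y : {set 'I_n} :=
  [set j | (y j != 0) && [forall i : 'I_n, (i < j)%N ==> (y i ^+ 2 != y j ^+ 2)]].

Lemma first_squares_inj y : {in first_squares y &, injective (fun j => y j ^+ 2)}.
Proof.
move=> i j; rewrite !inE => /andP [_ /forallP hi] /andP [_ /forallP hj] yij.
case: (ltngtP i j) => [ij|ji|/val_inj //].
  by have := hj i; rewrite ij yij eqxx.
by have := hi j; rewrite ji yij eqxx.
Qed.

Lemma first_squaresP y i : y i != 0 -> exists2 j, j \in first_squares y & y i ^+ 2 = y j ^+ 2.
Proof.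
move=> yi; have [j /eqP yj minj] :=
  arg_minnP val (eqxx (y i ^+ 2) : (fun j => y j ^+ 2 == y i ^+ 2) i).
exists j => //; rewrite inE; apply/andP; split.
  by apply: contraNneq yi => yj0; move/eqP: yj; rewrite yj0 expr0n /= eq_sym sqrf_eq0.
apply/forallP=> k; apply/implyP; rewrite ltnNge; apply: contraNneq => yk.
by apply: minj; rewrite yk yj.
Qed.

Lemma card_first_squares y : #|first_squares y| = num_squares y.
Proof.
rewrite cardE -(size_map (fun j => y j ^+ 2)).
have us : uniq [seq y j ^+ 2 | j <- enum (first_squares y)].
  rewrite map_inj_in_uniq ?enum_uniq // => i j; rewrite !mem_enum.
  exact: first_squares_inj.
rewrite -(undup_id us); apply/perm_size/perm_undup => v; apply/mapP/mapP; case=> i.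
  rewrite mem_enum inE => /andP [yi _] ->; exists i => //.
  by rewrite mem_filter yi mem_enum.
rewrite mem_filter => /andP [/first_squaresP [j jT yj] _] ->; exists j => //.
by rewrite mem_enum.
Qed.

(** For S the complement of [first_squares y], the coefficient is a determinant whose rows are the
    unit vectors of S and the vectors (y_j^(2a+1))_j. Up to factors y_j, its essential minor is a
    Vandermonde determinant in distinct squares. *)
Lemma wedge_neq0 y : exists2 S : {set 'I_n}, (#|S| + num_squares y = n)%N &
  point_eval y ((smon S 1 * wedge F n (num_squares y)) setT) != 0.
Proof.
pose m := num_squares y; pose T := first_squares y; pose S := ~: T; exists S.
  by rewrite addnC -card_first_squares cardsC card_ord.
have Sm : (#|S| + m = n)%N by rewrite addnC /m -card_first_squares cardsC card_ord.
rewrite -/m; pose sq := [seq i <- index_enum 'I_n | i \in S].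
have ssq : size sq = #|S| by rewrite -sum1_card -big_filter sum1_size.
have mem_sq i : (i \in sq) = (i \in S) by rewrite mem_filter mem_index_enum andbT.
have usq : uniq sq by rewrite filter_uniq ?index_enum_uniq.
pose row r j : P := if (r < #|S|)%N then (nth j sq r == j)%:R
  else 'X_j ^+ (2 * (r - #|S|) + 1).
pose M : 'M[P]_n := \matrix_(r, j) row r j.
pose v r : Omega := \sum_j smon [set j] (row r j).
have prodE : smon S 1 * wedge F n m = smon setT (\det M) :> Omega.
  rewrite -prod_linear_forms.
  transitivity (\prod_(0 <= r < n) v r); last first.
    by rewrite big_mkord; apply: eq_bigr => r _; apply: eq_bigr => j _; rewrite mxE.
  have Sn : (#|S| <= n)%N by apply: leq_trans (leq_addr m _) (eq_leq Sm).
  rewrite (big_cat_nat (leq0n _) Sn) //=; congr (_ * _).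
    rewrite -theta_prod -big_filter -/sq -ssq.
    case sqE: sq => [|x0 s]; first by rewrite big_nil big_geq.
    rewrite -sqE (big_nth x0); apply: eq_big_nat => r /andP [_ rs].
    rewrite /v (bigD1 (nth x0 sq r)) //= big1 ?addr0 => [|j nj].
      by rewrite /row -ssq rs (set_nth_default x0) ?eqxx.
    by rewrite /row -ssq rs (set_nth_default x0) // eq_sym (negPf nj) smon0.
  rewrite -{1}[#|S|]add0n big_addn (_ : n - #|S| = m)%N; last first.
    by apply/eqP; rewrite -(eqn_add2l #|S|) subnKC ?Sm.
  rewrite big_mkord; apply: eq_bigr => r _.
  by apply: eq_bigr => j _; rewrite /row ltnNge leq_addl addnK.
rewrite prodE smonE eqxx -det_map_mx; apply/det0P => -[u u0 uM].
case/eqP: u0; apply/rowP=> r; rewrite mxE.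
pose w r := if insub r is Some i then u 0 i else 0.
have wE (i : 'I_n) : w i = u 0 i by rewrite /w valK.
have Sn : (#|S| <= n)%N by apply: leq_trans (leq_addr m _) (eq_leq Sm).
have uMj j : \sum_(0 <= r < #|S|) w r * point_eval y (row r j)
    + \sum_(0 <= a < m) w (a + #|S|)%N * y j ^+ (2 * a + 1) = 0.
  have /rowP/(_ j) := uM; rewrite !mxE => h; rewrite -[RHS]h.
  transitivity (\sum_(0 <= r < n) w r * point_eval y (row r j)); last first.
    by rewrite big_mkord; apply: eq_bigr => i _; rewrite wE !mxE.
  rewrite (big_cat_nat (leq0n _) Sn) //=; congr (_ + _).
  rewrite -{2}[#|S|]add0n big_addn (_ : n - #|S| = m)%N; last first.
    by apply/eqP; rewrite -(eqn_add2l #|S|) subnKC ?Sm.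
  apply: eq_bigr => a _; rewrite /row ltnNge leq_addl addnK rmorphXn /=.
  by rewrite point_evalX.
(* The unit rows vanish on the columns in T, so a left kernel vector yields a polynomial of degree
   below m with m distinct roots. *)
pose p := \poly_(a < m) w (a + #|S|)%N.
have pT j : j \in T -> p.[y j ^+ 2] = 0.
  move=> jT; have yj0 : y j != 0 by move: jT; rewrite inE => /andP [].
  apply: (mulfI yj0); rewrite mulr0 -[RHS](uMj j) horner_poly mulr_sumr.
  rewrite big_nat_cond [X in _ = X + _]big1 ?add0r => [|i /andP [/andP [_ iS] _]].
    rewrite big_mkord; apply: eq_bigr => a _.
    by rewrite mulrCA -exprM -exprS addn1.
  rewrite /row iS; case: eqP => [ji|_].
    have : nth j sq i \in S by rewrite -mem_sq mem_nth // ssq.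
    by rewrite ji inE jT.
  by rewrite rmorph0 mulr0.
have p0 : p = 0.
  apply: (@roots_geq_poly_eq0 _ p [seq y j ^+ 2 | j <- enum T]).
  - by apply/allP=> _ /mapP [j jT ->]; apply/rootP/pT; rewrite -mem_enum.
  - rewrite map_inj_in_uniq ?enum_uniq // => i j; rewrite !mem_enum.
    exact: first_squares_inj.
  - by rewrite size_map -cardE card_first_squares size_poly.
have w_ge a : (a < m)%N -> w (a + #|S|)%N = 0.
  by move=> am; have := coef0 F a; rewrite -p0 coef_poly am.
have w_lt i : (i < #|S|)%N -> w i = 0.
  move=> iS; case sqE: sq => [|x0 s]; first by move: iS; rewrite -ssq sqE.
  have := uMj (nth x0 sq i); rewrite [X in _ + X = _]big_nat_cond [X in _ + X = _]big1 ?addr0; last first.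
    by move=> a /andP [/andP [_ am] _]; rewrite w_ge ?mul0r.
  rewrite big_mkord (bigD1 (Ordinal iS)) //= big1 ?addr0 => [|k nk].
    rewrite /row iS (set_nth_default x0) ?ssq // eqxx rmorph1 mulr1.
    by [].
  rewrite /row ltn_ord (set_nth_default x0) ?ssq ?ltn_ord // nth_uniq ?ssq //.
  by rewrite -[_ == i]/(k == Ordinal iS) (negPf nk) rmorph0 mulr0.
rewrite -wE; case: (ltnP r #|S|) => [/w_lt //|Sr].
by rewrite -(subnK Sr) w_ge // ltn_subLR // Sm.
Qed.

End Surjectivity.

(** * The equivariant surjection *)

Section Homogeneity.
Variables (F : numFieldType) (n : nat).
Local Notation P := {mpoly F[n]}.
Local Notation Omega := (superspace F n).
Implicit Types (p q : P) (f : Omega) (S T : {set 'I_n}) (y : 'I_n -> F) (d : nat).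

Definition coef_degree f d := forall T, f T \is d.-homog.

Lemma coef_degreeM f f' d d' :
  coef_degree f d -> coef_degree f' d' -> coef_degree (f * f') (d + d').
Proof.
move=> df df' W; rewrite mulE; apply: rpred_sum => S _; apply: rpred_sum => T _.
by case: ifP => _; rewrite ?dhomog0 // dhomogZ // dhomogM.
Qed.

Lemma wedge_coef_degree m : exists d, coef_degree (wedge F n m) d.
Proof.
elim: m => [|m [d IHm]].
  exists 0%N => T; rewrite /wedge big_ord0 smonE.
  by case: ifP => _; rewrite ?dhomog0 ?dhomog1.
exists (d + (2 * m + 1))%N; rewrite /wedge big_ord_recr /=; apply: coef_degreeM => //.
move=> T; rewrite sum_ffunE; apply: rpred_sum => i _; rewrite smonE.
case: ifP => _; rewrite ?dhomog0 //.
by rewrite mpolyXn dhomogX /= mdegMn mdeg1 mul1n.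
Qed.

Lemma line_eval_homog y p d : p \is d.-homog ->
  exists c, line_eval y p = c *: 'X^d.
Proof.
move=> /dhomogP hp; rewrite /line_eval /mmap big_seq.
elim/big_ind: _ => [|u v [c ->] [c' ->]|m /hp md].
- by exists 0; rewrite scale0r.
- by exists (c + c'); rewrite scalerDl.
exists (p@_m * \prod_i y i ^+ m i); rewrite mul_polyC -scalerA; congr (_ *: _).
rewrite /mmap1 -md /= mdegE -prodrXr -scaler_prod; apply: eq_bigr => i _.
by rewrite exprZn.
Qed.

(* The degree at which a monomial form is seen by [graded_eval]: only points with
   n - |S| nonzero squares see x^m theta_S. *)
Lemma top_eval_monomial m S : exists d, forall y k, k != d ->
  (top_eval y (smon S 'X_[m]))`_k = 0.
Proof.
have [e we] := wedge_coef_degree (n - #|S|).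
exists (mdeg m + e)%N => y k kd.
have [Sn|nS] := eqVneq (#|S| + num_squares y)%N n; last first.
  have dS : form_degree (smon S 'X_[m] : Omega) #|S| by apply: form_degree_smon.
  by rewrite (top_eval_degree dS nS) coef0.
have hw : ((smon S 1 * wedge F n (n - #|S|)) setT) \is e.-homog.
  rewrite -[e]add0n; apply: coef_degreeM => // T; rewrite smonE.
  by case: ifP => _; rewrite ?dhomog0 ?dhomog1.
rewrite smon_spoly top_eval_spoly /top_eval.
have -> : num_squares y = (n - #|S|)%N.
  by apply/eqP; rewrite -(eqn_add2l #|S|) Sn subnKC // -[leqRHS]card_ord max_card.
have [c ->] := line_eval_homog y hw.
have [|c' ->] := @line_eval_homog y 'X_[m] (mdeg m); first by rewrite dhomogX.
by rewrite -scalerAr -scalerAl -exprD !coefZ coefXn (negPf kd) !mulr0.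
Qed.

Section Points.
Variables (X : finType) (pt : X -> 'I_n -> F).
Hypothesis pt_power : forall x a, (a < num_squares (pt x))%N ->
  \sum_i pt x i ^+ (2 * a + 2) = (a.+1 == num_squares (pt x))%:R.
Hypothesis pt_inj : forall x x', pt x =1 pt x' -> x = x'.

(** The form of [wedge_neq0] at x is multiplied by a polynomial vanishing at the other points.
    Setting t = 1 sums all coefficients, so each delta function is a sum of values of the e_d. *)
Lemma separating_form x : exists f, forall x',
  (top_eval (pt x') f).[1] = (x' == x)%:R.
Proof.
have [S Sn wx] := wedge_neq0 (pt x).
pose l x' : P := if [pick i | pt x' i != pt x i] is Some i then 'X_i - (pt x' i)%:MP else 1.
have lx x' : x' != x -> point_eval (pt x') (l x') = 0 /\ point_eval (pt x) (l x') != 0.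
  move=> nx; rewrite /l; case: pickP => [i ni|no].
    have evC y c : point_eval y c%:MP = c.
      by rewrite /point_eval /= line_evalC /horner_eval hornerC.
    rewrite !raddfB /= !point_evalX !evC subrr subr_eq0 eq_sym; split=> //.
  case/eqP: nx; apply: pt_inj => i; apply/eqP; have := no i.
  by move/negbFE.
pose q := \prod_(x' | x' != x) l x'.
have qx : point_eval (pt x) q != 0.
  by rewrite rmorph_prod prodf_seq_neq0; apply/allP => x' _; apply/implyP=> /lx [].
have qx' x' : x' != x -> point_eval (pt x') q = 0.
  by move=> nx; rewrite rmorph_prod (bigD1 x') //= (lx x' nx).1 mul0r.
pose w := point_eval (pt x) ((smon S 1 * wedge F n (num_squares (pt x))) setT).
exists ((w * point_eval (pt x) q)^-1 *: (spoly q * smon S 1)) => x'.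
rewrite top_evalZ top_eval_spoly hornerZ hornerM -[_.[1]]/(point_eval _ q).
have [->|nx] := eqVneq x' x; last first.
  by rewrite (qx' x' nx) mul0r mulr0.
rewrite -[_.[1]]/w mulrC [_ * w]mulrC mulfV //.
by rewrite mulf_neq0.
Qed.

Local Notation E := {ffun X -> F^o}.
Local Notation graded_eval := (@graded_eval F n X pt).
Local Notation below := (@below F n X pt).

Lemma below_top : exists d, forall v : E, below d v.
Proof.
have exd x : exists d, below d [ffun x' => (x' == x)%:R].
  have [f fx] := separating_form x.
  exists (\max_x' size (top_eval (pt x') f)), (fun=> f).
  apply/ffunP=> x'; rewrite ffunE -fx sum_ffunE.
  have sz := @leq_bigmax X (fun x' => size (top_eval (pt x') f)) x'.
  rewrite (horner_coef_wide 1 sz).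
  by apply: eq_bigr => i _; rewrite ffunE expr1n mulr1.
have [d hd] := fin_all_exists exd; exists (\max_x d x) => v.
have -> : v = \sum_x v x *: [ffun x' => (x' == x)%:R : F^o].
  apply/ffunP=> x; rewrite sum_ffunE (bigD1 x) //= big1 ?addr0 => [|x' nx].
    by rewrite !ffunE eqxx /GRing.scale /= mulr1.
  by rewrite !ffunE eq_sym (negPf nx) scaler0.
apply: below_sum => x _; apply: belowZ.
exact: below_widen (@leq_bigmax X d x) (hd x).
Qed.

Variables (gT : finGroupType) (act : gT -> E -> E) (actO : gT -> Omega -> Omega).
Hypotheses (act_lin : forall g, linear (act g)).
Hypotheses (act1 : forall v, act 1%g v = v).
Hypothesis actM : forall g h v, act (g * h)%g v = act g (act h v).
Hypothesis graded_eval_act : forall g d f, graded_eval d (actO g f) = act g (graded_eval d f).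

Lemma graded_quotient_map : exists Theta : Omega -> E,
  [/\ linear Theta, forall f, f \in @SI F n -> Theta f = 0,
      forall g f, Theta (actO g f) = act g (Theta f)
    & forall v, exists f, Theta f = v].
Proof.
have [D topD] := below_top.
have actD g u v : act g (u + v) = act g u + act g v.
  by have := act_lin g 1 u v; rewrite !scale1r.
have act0 g : act g 0 = 0 by apply: (addrI (act g 0)); rewrite -actD !addr0.
have actN g v : act g (- v) = - act g v.
  by apply: (addrI (act g v)); rewrite -actD !subrr act0.
have actS g (r : seq 'I_D) (f : 'I_D -> E) :
    act g (\sum_(i <- r) f i) = \sum_(i <- r) act g (f i).
  exact: (big_morph _ (actD g) (act0 g)).
have below_act d g v : below d v -> below d (act g v).
  move=> [w ->]; rewrite (big_morph _ (actD g) (act0 g)).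
  by exists (fun i => actO g (w i)); apply: eq_bigr => i _; rewrite graded_eval_act.
have exR (d : nat) : exists R : E -> E, [/\ linear R, forall v, below d (R v),
    forall v, below d v -> R v = v & forall g v, R (act g v) = act g (R v)].
  apply: averaged_projection => //.
  - exact: below0.
  - by move=> u v; apply: belowD.
  - by move=> a u; apply: belowZ.
  - by move=> g v; apply: below_act.
have [R RP] := choice exR.
pose Theta f := \sum_(d < D) (graded_eval d f - R d (graded_eval d f)).
have Theta_lin : linear Theta.
  move=> a u v; rewrite /Theta scaler_sumr -big_split; apply: eq_bigr => d _ /=.
  have [Rlin _ _ _] := RP d.
  rewrite linearP Rlin scalerBr opprD addrACA.
  by [].
exists Theta; split=> //.
- move=> f If; rewrite /Theta big1 // => d _; have [_ _ Rid _] := RP d.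
  by rewrite Rid ?subrr //; apply: graded_eval_ideal.
- move=> g f; rewrite /Theta actS; apply: eq_bigr => d _; have [_ _ _ Ract] := RP d.
  by rewrite actD actN graded_eval_act Ract.
have lin0 (V W : lmodType F) (f : V -> W) : linear f -> f 0 = 0.
  by move=> flin; have := flin (-1) 0 0; rewrite !scaleN1r oppr0 addr0 addNr.
have Theta0 : Theta 0 = 0 by apply: lin0.
have ThetaD f f' : Theta (f + f') = Theta f + Theta f'.
  by have := Theta_lin 1 f f'; rewrite !scale1r.
have ThetaZ a f : Theta (a *: f) = a *: Theta f.
  by have := Theta_lin a f 0; rewrite Theta0 !addr0.
have img d : (d <= D)%N -> forall v, below d v -> exists f, Theta f = v.
  elim: d => [_ v [w ->]|d IHd dD v [w ->]]; first by exists 0; rewrite big_ord0.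
  rewrite big_ord_recr /=.
  have [|f1 f1E] := IHd (ltnW dD) (\sum_(i < d) graded_eval i (w i)); first by exists w.
  suff [f2 f2E] : exists f', Theta f' = graded_eval d (w d).
    by exists (f1 + f2); rewrite ThetaD f1E f2E.
  (* A monomial form is seen by at most one e_d, so [Theta] sends it to its e_d minus an element of
     [below d], which is in the image by induction. A general form would mix several d. *)
  have mono m S : exists f', Theta f' = graded_eval d (smon S 'X_[m]).
    have [e he] := top_eval_monomial m S.
    have ge0 k : k != e -> graded_eval k (smon S 'X_[m]) = 0.
      by move=> ke; apply/ffunP=> x; rewrite !ffunE he.
    have [de|/ge0 ->] := eqVneq d e; last by exists 0.
    have [Rlin Rbelow _ _] := RP d.
    have [f3 f3E] := IHd (ltnW dD) _ (Rbelow (graded_eval d (smon S 'X_[m]))).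
    exists (smon S 'X_[m] + f3); rewrite ThetaD f3E /Theta.
    rewrite (bigD1 (Ordinal dD)) //= big1 ?addr0 ?subrK // => k.
    rewrite -val_eqE /= de => /ge0 ->; have [/lin0 -> _ _ _] := RP k.
    by rewrite subrr.
  rewrite [w d]smon_sum raddf_sum /=.
  have sumc (I : Type) (r : seq I) (u : I -> E) : (forall i, exists f', Theta f' = u i) ->
      exists f', Theta f' = \sum_(i <- r) u i.
    move=> hu; elim: r => [|i r [f' IHr]]; first by exists 0; rewrite big_nil.
    by have [f'' e] := hu i; exists (f'' + f'); rewrite ThetaD IHr big_cons e.
  apply: (sumc) => S; rewrite {1}(mpolyE (w d S)).
  rewrite (big_morph (@smon F n S) (@smonD F n S) (@smon0 F n S)) raddf_sum /=.
  apply: (sumc) => m; rewrite smonZ linearZ /=.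
  by have [f' e] := mono m S; exists ((w d S)@_m *: f'); rewrite ThetaZ e.
by move=> v; apply: (img D).
Qed.

End Points.
End Homogeneity.

(** * Comparison of dimensions *)

Section Isomorphism.
Variables (F : numFieldType) (R : realType) (n : nat).
Local Notation Omega := (superspace F n).
Local Notation X := (face R n).
Local Notation E := {ffun X -> F^o}.

(** N elements spanning modulo [SI] map onto a space of dimension at least N, so their images are
    independent and an element of the kernel has zero coordinates. *)
Lemma kernel_SI (Theta : Omega -> E) : linear Theta ->
    (forall f, f \in @SI F n -> Theta f = 0) -> (forall v, exists f, Theta f = v) ->
    (\sum_(S : {set 'I_n}) size (box S n) <= #|{: X}|)%N ->
  forall f, Theta f = 0 -> f \in @SI F n.
Proof.
move=> lin kill surj leN f Tf0.
have [b spb] := SI_span F n.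
pose N := (\sum_(S : {set 'I_n}) size (box S n))%N.
pose bs : seq Omega := flatten [seq [seq smon U (b U m) | m <- box U n] | U <- index_enum {set 'I_n}].
have sbs : size bs = N.
  rewrite size_flatten /shape -map_comp sumnE big_map; apply: eq_bigr => S _ /=.
  by rewrite size_map.
have spanbs f' : exists c : 'I_N -> F, f' - \sum_i c i *: nth 0 bs i \in @SI F n.
  have [c hc] := spb f'.
  suff [c' e] : exists c' : 'I_N -> F, \sum_i c' i *: nth 0 bs i
      = \sum_S \sum_(m <- box S n) c S m *: smon S (b S m) by exists c'; rewrite e.
  pose ps := flatten [seq [seq (c U m, smon U (b U m)) | m <- box U n] | U <- index_enum {set 'I_n}].
  have bsE : bs = [seq p.2 | p <- ps].
    rewrite map_flatten -map_comp; congr flatten; apply: eq_map => U /=.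
    by rewrite -map_comp.
  have sps : size ps = N by rewrite -sbs bsE size_map.
  exists (fun i => (nth (0, 0) ps i).1).
  rewrite -(big_mkord xpredT (fun i => (nth (0, 0) ps i).1 *: nth 0 bs i)).
  transitivity (\sum_(p <- ps) p.1 *: p.2).
    rewrite (big_nth (0, 0)) sps; apply: eq_big_nat => i /andP [_ iN].
    by rewrite bsE (nth_map (0, 0)) ?sps.
  rewrite big_flatten big_map; apply: eq_bigr => U _.
  by rewrite big_map.
pose A := \matrix_(i < N, k < #|{: X}|) Theta (nth 0 bs i) (enum_val k).
have ThetaE (c : 'I_N -> F) k :
    Theta (\sum_i c i *: nth 0 bs i) (enum_val k) = ((\row_i c i) *m A) 0 k.
  have Ts : Theta (\sum_i c i *: nth 0 bs i) = \sum_i c i *: Theta (nth 0 bs i).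
    elim: (index_enum _) => [|i r IHr].
      rewrite !big_nil; have := lin (-1) 0 0.
      by rewrite !scaleN1r oppr0 addr0 addNr.
    by rewrite !big_cons lin IHr.
  rewrite Ts sum_ffunE mxE; apply: eq_bigr => i _.
  by rewrite !mxE ffunE.
have TB f1 f2 : f1 - f2 \in @SI F n -> Theta f1 = Theta f2.
  move=> /kill; rewrite -[f1 - f2]addrC -scaleN1r lin scaleN1r.
  by rewrite addrC => /eqP; rewrite subr_eq0 => /eqP.
have fullA : row_full A.
  apply/row_fullP.
  have exB k : exists c : 'I_N -> F, (\row_i c i) *m A = delta_mx 0 k.
    have [f' f'E] := surj [ffun x => (x == enum_val k)%:R].
    have [c hc] := spanbs f'; exists c; apply/rowP=> j.
    by rewrite -ThetaE -(TB _ _ hc) f'E ffunE mxE eqxx (inj_eq enum_val_inj).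
  have [c hc] := fin_all_exists exB.
  exists (\matrix_(k, i) c k i); apply/row_matrixP=> k.
  rewrite row_mul row1 -hc; congr (_ *m _).
  by apply/rowP=> i; rewrite !mxE.
have freeA : row_free A.
  have rA : \rank A = #|{: X}| by apply/eqP.
  by rewrite /row_free rA eqn_leq leN -[leqLHS]rA rank_leq_row.
have [c hc] := spanbs f; have := TB _ _ hc; rewrite Tf0 => T0.
have c0 : \row_i c i = 0.
  apply: (row_free_inj freeA); rewrite mul0mx; apply/rowP=> k.
  by rewrite -ThetaE -T0 ffunE mxE.
move: hc; rewrite big1 ?subr0 // => i _.
by have /rowP/(_ i) := c0; rewrite !mxE => ->; rewrite scale0r.
Qed.

Variable pt : X -> 'I_n -> F.
Hypothesis pt_power : forall x a, (a < num_squares (pt x))%N ->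
  \sum_i pt x i ^+ (2 * a + 2) = (a.+1 == num_squares (pt x))%:R.
Hypothesis pt_inj : forall x x', pt x =1 pt x' -> x = x'.
Hypothesis pt_act : forall g x, pt (face_act g^-1%g x) =1 act_coords g (pt x).
Hypothesis leN : (\sum_(S : {set 'I_n}) size (box S n) <= #|{: X}|)%N.

Lemma gmod_iso_of_points :
  gmod_iso (SR_gmodule F n) (tensor_det (OP_gmodule R n F)).
Proof.
set V := tensor_det _.
have comp_act g d f :
    graded_eval pt d (sact g f) = @Defs.gact _ _ V g (graded_eval pt d f).
  apply/ffunP=> x; rewrite !ffunE top_eval_act coefZ.
  by rewrite (eq_top_eval _ (pt_act g x)).
have [Theta [lin kill equiv surj]] := graded_quotient_map pt_power pt_inj
  (@Defs.gact_linear _ _ V) (@Defs.gact1 _ _ V) (@Defs.gactM _ _ V) comp_act.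
have ker := kernel_SI lin kill surj leN.
pose phi (v : SR F n) : V := Theta (repr v).
have TB f1 f2 : f1 - f2 \in @SI F n <-> Theta f1 = Theta f2.
  have -> : f1 - f2 = (-1) *: f2 + f1 by rewrite scaleN1r addrC.
  split=> [/kill|e]; first by rewrite lin scaleN1r addrC => /eqP; rewrite subr_eq0 => /eqP.
  by apply: ker; rewrite lin scaleN1r e addNr.
have phiE f : phi (\pi_(SR F n) f) = Theta f.
  by apply/TB; apply/pi_eq; rewrite reprK.
have phi_lin : linear (phi : SR_gmodule F n -> V).
  move=> a u v; rewrite -[u]reprK -[v]reprK -[_ *: _]SR_piZ -[_ + _]SR_piD !phiE.
  exact: lin.
pose L := GRing.isLinear.Build F (SR_gmodule F n) V _ phi phi_lin.
pose psi : {linear SR_gmodule F n -> V} := HB.pack phi L.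
exists psi; split.
  have exf v : exists w, phi w = v.
    by have [f <-] := surj v; exists (\pi_(SR F n) f); rewrite phiE.
  have [inv invE] := choice exf.
  exists inv; last exact: invE.
  by move=> v; have /TB/pi_eq := invE (phi v); rewrite !reprK.
move=> g v; transitivity (phi (SR_act g (\pi_(SR F n) (repr v)))).
  by rewrite reprK.
by rewrite SR_actE phiE equiv.
Qed.

End Isomorphism.

(** * Solutions of weighted power sum equations *)

Section WeightedPowerSums.
Variables (F : numFieldType) (n : nat) (wt : 'I_n -> nat).
Hypothesis wt_gt0 : forall i, (0 < wt i)%N.
Local Notation P := {mpoly F[n]}.
Local Notation pw := (wpower F wt).
Implicit Types (p q : P) (e : 'X_{1..n}) (d : nat) (c : 'I_n -> F).

(** The ideal of n equations in n unknowns. The homogeneous case c = 0 is understood first, and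
    general c is a deformation of it. *)
Definition pw_ideal c q := exists g : 'I_n -> P, q = \sum_a g a * (pw a - (c a)%:MP).

Lemma pw_ideal_ideal c : is_ideal (pw_ideal c).
Proof.
split.
- by exists (fun=> 0); rewrite big1 // => a _; rewrite mul0r.
- move=> _ _ [g ->] [h ->]; exists (fun a => g a + h a).
  by rewrite -big_split; apply: eq_bigr => a _; rewrite mulrDl.
- move=> p _ [h ->]; exists (fun a => p * h a).
  by rewrite mulr_sumr; apply: eq_bigr => a _; rewrite mulrA.
Qed.

Lemma pw_ideal_gen c (a : 'I_n) : pw_ideal c (pw a - (c a)%:MP).
Proof.
exists (fun b => (b == a)%:R); rewrite (bigD1 a) //= eqxx mul1r big1 ?addr0 //.
by move=> b /negPf ->; rewrite mul0r.
Qed.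

(** A Newton relation: the monic polynomial with roots x_u^2 expresses a power sum of index at least
    n through the n preceding ones. *)
Lemma pw_ideal0 a : pw_ideal (fun=> 0) (pw a).
Proof.
have idJ := pw_ideal_ideal (fun=> 0).
elim/ltn_ind: a => a IHa; have [an|na] := ltnP a n.
  by have := pw_ideal_gen (fun=> 0) (Ordinal an); rewrite mpolyC0 subr0.
pose Q : {poly P} := \prod_(u <- enum 'I_n) ('X - ('X_u ^+ 2)%:P).
have sQ : size Q = n.+1.
  by rewrite /Q -(big_map (fun u => 'X_u ^+ 2 : P) xpredT (fun z => 'X - z%:P))
     size_prod_XsubC size_map size_enum_ord.
have lQ : Q`_n = 1.
  have := monic_prod_XsubC (enum 'I_n) xpredT (fun u => 'X_u ^+ 2 : P).
  by rewrite -/Q monicE /lead_coef sQ => /eqP.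
have := wpower_horner wt Q (a - n); rewrite sQ big_ord_recr /= lQ mul1r subnK // big1.
  move/eqP; rewrite eq_sym addrC addr_eq0 => /eqP ->; apply: is_idealN => //.
  apply: is_ideal_sum => // l _; apply: is_idealMl => //; apply: IHa.
  by rewrite -[X in (_ < X)%N](subnK na) ltn_add2l.
move=> i _; rewrite (_ : Q.[_] = 0) ?mulr0 ?scaler0 //.
by rewrite -sqdiff_horner /sqdiff (big_rem i) ?mem_enum //= subrr mul0r.
Qed.

Local Notation r := (nforms (set0 : {set 'I_n})).
Local Notation codes := (box (set0 : {set 'I_n}) n).

(** This is also the degree of [pw j]; the coincidence makes the family [basis_elt] exactly as large
    as that of the monomials. *)
Lemma nforms0 (j : 'I_n) : r j = (2 * j + 2)%N.
Proof.
rewrite /nforms in_set0 /=; have -> : size (free_below set0 j) = j.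
  rewrite /free_below size_filter -sum1_count big_enum_cond /=.
  rewrite (eq_bigl (fun u : 'I_n => (u < j)%N)) => [|u]; last by rewrite in_set0 andbT.
  by rewrite -(big_ord_widen n (fun=> 1%N)) ?(ltnW (ltn_ord j)) // sum1_card card_ord.
by rewrite addnn addnC -muln2 mulnC.
Qed.

Lemma graded_span_pw : graded_span (pw_ideal (fun=> 0)) codes.
Proof.
apply: (graded_span_box wt_gt0) => //.
- exact: pw_ideal_ideal.
- exact: pw_ideal0.
- by move=> j; rewrite in_set0.
- by move=> i; rewrite leqNgt ltn_ord.
Qed.

Lemma pihomogM d d' p q : q \is d'.-homog ->
  pihomog mdeg d (p * q) = if (d' <= d)%N then pihomog mdeg (d - d') p * q else 0.
Proof.
move=> hq; rewrite {1 2}[p]mpolyE mulr_suml !raddf_sum /=.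
under eq_bigr do rewrite -scalerAl linearZ /=.
have term m : pihomog mdeg d ('X_[m] * q) = if (mdeg m + d' == d)%N then 'X_[m] * q else 0.
  have hm : 'X_[m] * q \is (mdeg m + d').-homog by rewrite dhomogM ?dhomogX.
  case: eqP => [<-|/eqP nd]; first exact: pihomog_dE.
  by rewrite (pihomog_ne0 _ hm).
under eq_bigr do rewrite term.
case: (leqP d' d) => [le_d|lt_d].
  rewrite mulr_suml; apply: eq_bigr => m _; rewrite linearZ /= pihomogX /=.
  rewrite -[d in (_ == d)%N](subnK le_d) eqn_add2r.
  by case: ifP => _; rewrite ?scaler0 ?mul0r // scalerAl.
rewrite big1 // => m _; case: eqP => [e|_]; last by rewrite scaler0.
by rewrite -e ltnNge leq_addl in lt_d.
Qed.

Lemma pw_homog (a : nat) : pw a \is (2 * a + 2).-homog.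
Proof.
apply: rpred_sum => i _; apply: dhomogZ.
by rewrite mpolyXn dhomogX /= mdegMn mdeg1 mul1n.
Qed.

Section Basis.
Variables (c : 'I_n -> F) (b : 'X_{1..n} -> P).
Hypothesis b_homog : forall e, b e \is (mdeg e).-homog.
Hypothesis b_span : forall q, exists k : 'X_{1..n} -> F,
  pw_ideal (fun=> 0) (q - \sum_(e <- codes) k e *: b e).

(** Division by r j: the remainders select a spanning element of the homogeneous quotient, the
    quotients a power of each equation. The indices are all monomials, and the degree is at most
    [mdeg e]. *)
Definition basis_elt e : P :=
  (\prod_(j < n) (pw j - (c j)%:MP) ^+ (e j %/ r j)) * b [multinom (e j %% r j)%N | j < n].

Lemma basis_elt_code e : e \in codes -> basis_elt e = b e.
Proof.
move=> /box_lt elt; rewrite /basis_elt big1 => [|j _]; last by rewrite divn_small.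
by rewrite mul1r; congr b; apply/mnmP=> j; rewrite mnmE modn_small.
Qed.

Lemma basis_elt_shift e (a : 'I_n) :
  basis_elt (e + U_(a) *+ r a)%MM = (pw a - (c a)%:MP) * basis_elt e.
Proof.
have ra : (0 < r a)%N by rewrite nforms0 addn2.
rewrite /basis_elt mulrA; congr (_ * b _); last first.
  apply/mnmP=> j; rewrite !mnmE mulmnE mnm1E; case: eqVneq => [->|_].
    by rewrite mul1n modnDr.
  by rewrite mul0n addn0.
rewrite (bigD1 a) //= [in RHS](bigD1 a) //= mulrA; congr (_ * _).
  by rewrite mnmDE mulmnE mnm1E eqxx mul1n divnDr ?divnn ?ra ?addn1 ?exprS.
apply: eq_bigr => j nj; rewrite mnmDE mulmnE mnm1E eq_sym (negPf nj).
by rewrite mul0n addn0.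
Qed.

Definition combination d q := exists k : 'X_{1..n} -> F,
  q = \sum_(e : 'X_{1..n < d}) k e *: basis_elt e.

Lemma combination0 d : combination d 0.
Proof. by exists (fun=> 0); rewrite big1 // => e _; rewrite scale0r. Qed.

Lemma combinationD d p q : combination d p -> combination d q -> combination d (p + q).
Proof.
move=> [k ->] [k' ->]; exists (fun e => k e + k' e); rewrite -big_split.
by apply: eq_bigr => e _; rewrite scalerDl.
Qed.

Lemma combinationZ d a p : combination d p -> combination d (a *: p).
Proof.
move=> [k ->]; exists (fun e => a * k e); rewrite scaler_sumr.
by apply: eq_bigr => e _; rewrite scalerA.
Qed.

Lemma combination_sum d (I : Type) (s : seq I) (A : pred I) (f : I -> P) :
  (forall i, A i -> combination d (f i)) -> combination d (\sum_(i <- s | A i) f i).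
Proof.
by move=> hf; elim/big_ind: _ => //; [apply: combination0 | apply: combinationD].
Qed.

Lemma combination_elt d e : (mdeg e < d)%N -> combination d (basis_elt e).
Proof.
move=> ed; exists (fun e' => (e' == e)%:R); rewrite (bigD1 (BMultinom ed)) //= eqxx.
rewrite scale1r big1 ?addr0 // => e' ne; rewrite (_ : _ == e = false) ?scale0r //.
by apply: contraNF ne => /eqP ee; apply/eqP/val_inj.
Qed.

Lemma combination_widen d d' p : (d <= d')%N -> combination d p -> combination d' p.
Proof.
move=> dd' [k ->]; apply: combination_sum => e _; apply: combinationZ.
apply: combination_elt; exact: leq_trans (bmdeg e) dd'.
Qed.

Lemma combination_pw d (a : 'I_n) q : combination d q ->
  combination (d + r a) ((pw a - (c a)%:MP) * q).
Proof.
move=> [k ->]; rewrite mulr_sumr; apply: combination_sum => e _.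
rewrite -scalerAr -basis_elt_shift; apply/combinationZ/combination_elt.
by rewrite mdegD mdegMn mdeg1 mul1n ltn_add2r bmdeg.
Qed.

(** Modulo the homogeneous ideal q is a combination of the b e; each remaining term is g' pw_a =
    (pw_a - c_a) g' + c_a g' with g' of smaller degree. *)
Lemma combination_homog d q : q \is d.-homog -> combination d.+1 q.
Proof.
elim/ltn_ind: d q => d IHd q hq.
have [k [g gE]] := b_span q.
have -> : q = \sum_(e <- codes) k e *: pihomog mdeg d (b e)
    + \sum_(a < n) pihomog mdeg d (g a * pw a).
  rewrite -{1}(pihomog_dE hq) -[X in pihomog _ _ X](subrK (\sum_(e <- codes) k e *: b e)) gE.
  rewrite raddfD /= addrC !raddf_sum; congr (_ + _); apply: eq_bigr => i _ /=.
    by rewrite linearZ.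
  by rewrite mpolyC0 subr0.
apply: combinationD.
  rewrite big_seq; apply: combination_sum => e ec; apply: combinationZ.
  have [ed|/eqP nd] := (mdeg e =P d); last by rewrite (pihomog_ne0 nd (b_homog e)); apply: combination0.
  rewrite -ed pihomog_dE // -basis_elt_code //; exact: combination_elt.
apply: combination_sum => a _; rewrite (pihomogM _ _ (pw_homog a)).
case: ifP => le_d; last exact: combination0.
set g' := pihomog _ _ _; have hg : g' \is (d - (2 * a + 2)).-homog by apply: pihomogP.
have lt_d : (d - (2 * a + 2) < d)%N by rewrite ltn_subrL addn2 /= (leq_trans _ le_d) // addn2.
have cg := IHd _ lt_d _ hg.
have -> : g' * pw a = (pw a - (c a)%:MP) * g' + c a *: g'.
  by rewrite -mul_mpolyC; ring.
apply: combinationD; last by apply: combinationZ; apply: combination_widen cg; rewrite ltnS ltnW.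
apply: combination_widen (combination_pw a cg).
by rewrite nforms0 addSn subnK.
Qed.

Lemma combination_all q : exists d, combination d q.
Proof.
exists (msize q).+1; rewrite {2}[q]mpolyE big_seq; apply: combination_sum => m mq.
apply: combinationZ; apply: (@combination_widen (mdeg m).+1).
  by rewrite ltnS ltnW // msize_mdeg_lt.
by apply: combination_homog; rewrite dhomogX.
Qed.

(** The [basis_elt e] with [mdeg e < d] span the monomials of degree below d and are equally many,
    so they form a basis: a left inverse of a square matrix is a right inverse. *)
Lemma basis_coord d : exists coord : P -> 'X_{1..n} -> F,
  [/\ forall p q e, coord (p + q) e = coord p e + coord q e,
      forall a p e, coord (a *: p) e = a * coord p e &
      forall e e', (mdeg e < d)%N -> (mdeg e' < d)%N ->
        coord (basis_elt e) e' = (e == e')%:R].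
Proof.
pose K := 'X_{1..n < d}.
pose V := \matrix_(i < #|{: K}|, j < #|{: K}|) (basis_elt (enum_val i))@_(enum_val j).
have exG (i : 'I_#|{: K}|) : exists k : 'X_{1..n} -> F,
    'X_[enum_val i] = \sum_(e : K) k e *: basis_elt e.
  apply: (@combination_widen (mdeg (enum_val i)).+1); first exact: bmdeg.
  by apply: combination_homog; rewrite dhomogX.
have [k hk] := fin_all_exists exG.
pose G := \matrix_(i < #|{: K}|, j < #|{: K}|) k i (enum_val j).
have GV : G *m V = 1%:M.
  apply/matrixP=> i j; rewrite !mxE.
  have := congr1 (mcoeff (enum_val j)) (hk i).
  rewrite mcoeffX raddf_sum /= => h.
  rewrite (reindex (@enum_rank K)); last exact/onW_bij/enum_rank_bij.
  have -> : (i == j) = (enum_val i == enum_val j :> 'X_{1..n}).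
    by rewrite (inj_eq val_inj) (inj_eq enum_val_inj).
  rewrite h; apply: eq_bigr => e _.
  by rewrite !mxE enum_rankK mcoeffZ.
have VG : V *m G = 1%:M by apply: mulmx1C.
exists (fun p e => if insub e is Some e' then
  \sum_(j < #|{: K}|) p@_(enum_val j) * G j (enum_rank (e' : K)) else 0).
split=> [p q e|a p e|e e' ed ed'].
- case: insub => [e'|]; last by rewrite addr0.
  by rewrite -big_split; apply: eq_bigr => j _; rewrite mcoeffD mulrDl.
- case: insub => [e'|]; last by rewrite mulr0.
  by rewrite mulr_sumr; apply: eq_bigr => j _; rewrite mcoeffZ mulrA.
- rewrite insubT.
  have := congr1 (fun A : 'M_ _ => A (enum_rank (BMultinom ed)) (enum_rank (BMultinom ed'))) VG.
  rewrite !mxE (inj_eq enum_rank_inj) -val_eqE /= => <-.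
  by apply: eq_bigr => j _; rewrite !mxE !enum_rankK.
Qed.

(** Multiplication by the a-th equation adds r a to the a-th exponent, so elements of the ideal are
    combinations of [basis_elt]s whose indices are not codes. *)
Lemma basis_independent (k : 'X_{1..n} -> F) :
  pw_ideal c (\sum_(e <- codes) k e *: basis_elt e) -> {in codes, forall e, k e = 0}.
Proof.
move=> [g gE] e0 e0c.
have [dg hdg] := fin_all_exists (fun a => combination_all (g a)).
pose d := maxn (\max_(e <- codes) mdeg e).+1 (\max_a (dg a + r a))%N.
have dcode e : e \in codes -> (mdeg e < d)%N.
  move=> ec; apply: leq_trans (leq_maxl _ _); rewrite ltnS.
  exact: (@leq_bigmax_seq _ _ xpredT).
have dga a : (dg a + r a <= d)%N.
  apply: leq_trans (leq_maxr _ _); exact: (@leq_bigmax _ (fun a => dg a + r a)%N).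
have [coord [cD cZ cE]] := basis_coord d.
have c0 e : coord 0 e = 0 by have := cZ 0 0 e; rewrite scale0r mul0r.
have cS (I : Type) (s : seq I) (f : I -> P) e :
    coord (\sum_(i <- s) f i) e = \sum_(i <- s) coord (f i) e.
  by elim: s => [|i s IHs]; rewrite ?big_nil ?c0 // !big_cons cD IHs.
have := congr1 (fun p => coord p e0) gE; rewrite !cS.
rewrite (bigD1_seq e0) ?uniq_box //= cZ cE ?dcode // eqxx mulr1.
rewrite big_seq_cond big1 ?addr0 => [->|e /andP [ec ne]]; last first.
  by rewrite cZ cE ?dcode // (negPf ne) mulr0.
apply: big1 => a _; have [h ->] := hdg a.
rewrite mulr_suml cS big1 // => e _.
have lt_e : (mdeg (e + U_(a) *+ r a)%MM < d)%N.
  apply: leq_trans (dga a); rewrite mdegD mdegMn mdeg1 mul1n ltn_add2r.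
  exact: bmdeg.
rewrite -scalerAl mulrC -basis_elt_shift cZ (cE _ _ lt_e (dcode _ e0c)).
case: eqP => [e0E|_]; last by rewrite mulr0.
have := box_lt e0c a; rewrite -e0E mnmDE mulmnE mnm1E eqxx mul1n.
by rewrite ltnNge leq_addl.
Qed.

(** A [basis_elt] whose index is not a code is divisible by one of the equations. *)
Lemma code_span q : exists k : 'X_{1..n} -> F,
  pw_ideal c (q - \sum_(e <- codes) k e *: basis_elt e).
Proof.
have idc := pw_ideal_ideal c.
have spanned_ideal p : pw_ideal c p -> exists k : 'X_{1..n} -> F,
    pw_ideal c (p - \sum_(e <- codes) k e *: basis_elt e).
  exists (fun=> 0); rewrite big1 ?subr0 // => e _.
  by rewrite scale0r.
have [d [h ->]] := combination_all q.
elim/big_ind: _ => [|p p' [k hk] [k' hk']|e _].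
- by apply: spanned_ideal; apply: is_ideal0.
- exists (fun e => k e + k' e); under eq_bigr do rewrite scalerDl.
  by rewrite big_split opprD addrACA; apply: is_idealD.
have [ec|nec] := boolP (val e \in codes).
  exists (fun e' => h e * (e' == e)%:R); rewrite (bigD1_seq (val e)) ?uniq_box //= eqxx mulr1.
  rewrite big1 ?addr0 ?subrr => [|e' ne]; first exact: is_ideal0.
  by rewrite (negPf ne) mulr0 scale0r.
apply: spanned_ideal; apply: is_idealZ => //.
have [j ej] : exists j, (r j <= e j)%N.
  apply/existsP; apply: contraR nec; rewrite negb_exists => /forallP nr.
  apply: mem_boxP => i; first by move=> _; rewrite ltnNge nr.
  by rewrite leqNgt ltn_ord.
have -> : val e = (e - U_(j) *+ r j + U_(j) *+ r j)%MM.
  apply/mnmP=> i; rewrite mnmDE mnmBE mulmnE mnm1E; case: eqVneq => [<-|_].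
    by rewrite mul1n subnK.
  by rewrite mul0n addn0 subn0.
by rewrite basis_elt_shift; apply: is_idealMr => //; apply: pw_ideal_gen.
Qed.

End Basis.
End WeightedPowerSums.

(** * Existence of zeros of an ideal *)

Section IdealPoints.
Variables (F : numFieldType) (n : nat).
Local Notation P := {mpoly F[n]}.
Implicit Types (p q l : P) (I J : P -> Prop) (x : 'I_n -> F).

Lemma ideal_eval J x p : is_ideal J -> (forall i, J ('X_i - (x i)%:MP)) ->
  J (p - (p.@[x])%:MP).
Proof.
move=> idJ JX.
have cong2 a b a' b' : J (a - a') -> J (b - b') -> J (a * b - a' * b').
  move=> Ja Jb; have -> : a * b - a' * b' = b * (a - a') + a' * (b - b') by ring.
  by apply: is_idealD => //; apply: is_idealMl.
rewrite {1}[p]mpolyE mevalE raddf_sum /= -sumrB; apply: is_ideal_sum => // m _.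
rewrite -mul_mpolyC rmorphM /=; apply: (cong2); first by rewrite subrr; apply: is_ideal0.
rewrite mpolyXE_id rmorph_prod /=; elim: (index_enum _) => [|i s IHs].
  by rewrite !big_nil subrr; apply: is_ideal0.
rewrite !big_cons; apply: (cong2) => //; rewrite rmorphXn /=.
by rewrite subrXX; apply: is_idealMr.
Qed.

(** The product of the later factors is in (I : l), so by induction 1 is too; hence l is in I and
    (I, l) = I. *)
Lemma ideal_prod_one I (ls : seq P) : is_ideal I -> I (\prod_(l <- ls) l) ->
  (forall l, l \in ls -> ideal_add I l 1) -> I 1.
Proof.
elim: ls I => [|l ls IHls] I idI; rewrite ?big_nil ?big_cons // => Ils I1.
have Il : I l.
  rewrite -[l]mulr1; apply: (IHls (ideal_colon I l) (ideal_colon_ideal l idI)) => // l' l'ls.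
  have [|k Ik] := I1 l'; first by rewrite in_cons l'ls orbT.
  by exists k; apply: is_idealMl.
have [|k Ik] := I1 l; first by rewrite mem_head.
by apply: (is_ideal_transl idI) Ik _; apply: is_idealMl.
Qed.

(** A weak Nullstellensatz: coordinates are fixed one at a time, and by [ideal_prod_one] some root z
    keeps (J, x_j - z) proper. *)
Lemma ideal_point I : is_ideal I -> ~ I 1 ->
    (forall i, exists s : seq F, I (\prod_(z <- s) ('X_i - z%:MP))) ->
  exists x, forall p, I p -> p.@[x] = 0.
Proof.
move=> idI I1 split_I.
have [J [x [idJ J1 IJ JX]]] : exists J x, [/\ is_ideal J, ~ J 1, forall p, I p -> J p
    & forall i : 'I_n, J ('X_i - (x i)%:MP)].
  suff H t : exists J x, [/\ is_ideal J, ~ J 1, forall p, I p -> J p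
      & forall i : 'I_n, (i < t)%N -> J ('X_i - (x i)%:MP)].
    by have [J [x [idJ J1 IJ JX]]] := H n; exists J, x; split=> // i; apply: JX.
  elim: t => [|t [J [x [idJ J1 IJ JX]]]]; first by exists I, (fun=> 0); split.
  have [tn|nt] := ltnP t n; last first.
    by exists J, x; split=> // i _; apply: JX; apply: leq_trans (ltn_ord i) nt.
  pose j := Ordinal tn; have [s Is] := split_I j.
  have [z zs Jz] : exists2 z, z \in s & ~ ideal_add J ('X_j - z%:MP) 1.
    case: (pselect (exists2 z, z \in s & ~ ideal_add J ('X_j - z%:MP) 1)) => // no.
    case: J1; apply: (ideal_prod_one (ls := [seq 'X_j - z%:MP | z <- s])) => //.
      by rewrite big_map; apply: IJ.
    move=> _ /mapP [z zs ->]; case: (pselect (ideal_add J ('X_j - z%:MP) 1)) => // nz.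
    by case: no; exists z.
  have JJ p : J p -> ideal_add J ('X_j - z%:MP) p by exists 0; rewrite mul0r subr0.
  exists (ideal_add J ('X_j - z%:MP)), (fun i => if i == j then z else x i).
  split=> //; first exact: ideal_add_ideal.
    by move=> p /IJ /JJ.
  move=> i; rewrite ltnS leq_eqVlt => /orP [/eqP it|it].
    have -> : i = j by apply/val_inj.
    by rewrite eqxx; exists 1; rewrite mul1r subrr; apply: is_ideal0.
  rewrite ifN; first exact/JJ/JX.
  by rewrite -val_eqE /= ltn_eqF.
exists x => p Ip; have := ideal_eval p idJ JX; rewrite -opprB => /(is_idealN idJ).
rewrite opprK => /(is_idealD idJ) /(_ (IJ _ Ip)); rewrite subrK => Jp.
apply/eqP; apply: contra_notT J1 => p0.
have := is_idealZ idJ (p.@[x])^-1 Jp.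
by rewrite -mul_mpolyC -mpolyCM mulVf.
Qed.

End IdealPoints.

Section Solutions.
Variables (F : numClosedFieldType) (n : nat) (wt : 'I_n -> nat).
Hypothesis wt_gt0 : forall i, (0 < wt i)%N.
Local Notation P := {mpoly F[n]}.
Local Notation pw := (wpower F wt).
Local Notation codes := (box (set0 : {set 'I_n}) n).
Implicit Types (p q : P) (e : 'X_{1..n}) (x : 'I_n -> F).

Definition solution x := forall a : 'I_n,
  \sum_i (wt i)%:R * x i ^+ (2 * a + 2) = (a.+1 == n)%:R.

Let c (a : 'I_n) : F := (a.+1 == n)%:R.

Lemma pw_eval x a : (pw a).@[x] = \sum_i (wt i)%:R * x i ^+ (2 * a + 2).
Proof.
rewrite raddf_sum; apply: eq_bigr => i _ /=.
by rewrite mevalZ rmorphXn /= mevalXU.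
Qed.

(* A monic polynomial of degree n without constant term that vanishes at all
   x_i^2 would give sum_i wt_i x_i^(2n) = 0. *)
Lemma solution_no_monic x (Q : {poly F}) : solution x -> Q \is monic ->
  size Q = n.+1 -> Q.[0] = 0 -> (0 < n)%N -> ~ (forall i, Q.[x i ^+ 2] = 0).
Proof.
move=> sx Qm sQ Q0 n_gt0 Qx.
have : \sum_i (wt i)%:R * Q.[x i ^+ 2] = 1.
  under eq_bigr do rewrite horner_coef sQ mulr_sumr.
  rewrite exchange_big big_ord_recl /= big1 ?add0r => [|i _]; last first.
    by rewrite -horner_coef0 Q0 mul0r mulr0.
  transitivity (\sum_(a < n) Q`_a.+1 * (a.+1 == n)%:R).
    apply: eq_bigr => a _; rewrite -sx mulr_sumr; apply: eq_bigr => i _.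
    by rewrite /= mulrCA -exprM; congr (_ * (_ * _ ^+ _)); rewrite mulnS addnC.
  have an : (n.-1 < n)%N by rewrite prednK.
  rewrite (bigD1 (Ordinal an)) //= prednK // eqxx mulr1 big1 ?addr0 => [|a na].
    by have /eqP := Qm; rewrite /lead_coef sQ.
  rewrite (_ : _ == n = false) ?mulr0 //; apply: contraNF na => /eqP an'.
  by apply/eqP/val_inj; apply: (congr1 predn an').
rewrite big1 => [/eqP|i _]; last by rewrite Qx mulr0.
by rewrite eq_sym oner_eq0.
Qed.

(** If x_i = 0, the monic polynomial with roots x_j^2 has no constant term. *)
Lemma solution_neq0 x i : solution x -> x i != 0.
Proof.
move=> sx; apply/eqP=> xi; have n_gt0 : (0 < n)%N by apply: leq_ltn_trans (ltn_ord i).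
apply: (solution_no_monic (Q := \prod_(j <- enum 'I_n) ('X - (x j ^+ 2)%:P)) sx) => //.
- exact: monic_prod_XsubC.
- by rewrite -(big_map (fun j => x j ^+ 2) xpredT (fun z => 'X - z%:P))
     size_prod_XsubC size_map size_enum_ord.
- by rewrite horner_prod (big_rem i) ?mem_enum //= hornerXsubC xi expr0n subrr mul0r.
- by move=> j; rewrite horner_prod (big_rem j) ?mem_enum //= hornerXsubC subrr mul0r.
Qed.

(** If two squares agree, one linear factor can be replaced by the variable without losing a
    root. *)
Lemma solution_sqr_inj x : solution x -> injective (fun i => x i ^+ 2).
Proof.
move=> sx i j xij; apply/eqP; apply/negPn/negP => nij.
have n_gt0 : (0 < n)%N by apply: leq_ltn_trans (ltn_ord i).
have sz : size (rem i (enum 'I_n)) = n.-1 by rewrite size_rem ?mem_enum ?size_enum_ord.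
have um : uniq (enum 'I_n) := enum_uniq _.
apply: (solution_no_monic (Q := 'X * \prod_(k <- rem i (enum 'I_n)) ('X - (x k ^+ 2)%:P)) sx) => //.
- by rewrite monicMl ?monicX // monic_prod_XsubC.
- rewrite -(big_map (fun k => x k ^+ 2) xpredT (fun z => 'X - z%:P)).
  rewrite mulrC size_mulX ?monic_neq0 ?monic_prod_XsubC //.
  by rewrite size_prod_XsubC size_map sz prednK.
- by rewrite hornerM hornerX mul0r.
- have xk k : k != i -> ('X * \prod_(k <- rem i (enum 'I_n)) ('X - (x k ^+ 2)%:P)).[x k ^+ 2] = 0.
    move=> ki; rewrite hornerM horner_prod (big_rem k) /= ?hornerXsubC ?subrr ?mul0r ?mulr0 //.
    by rewrite mem_rem_uniq // inE ki mem_enum.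
  move=> k; have [->|/xk //] := eqVneq k i.
  by rewrite xij xk // eq_sym.
Qed.

(** The quotient is spanned by N elements, so the powers of x_i up to the N-th are dependent; the
    resulting polynomial splits over the closed field. *)
Lemma univariate_split i : exists s : seq F,
  pw_ideal wt c (\prod_(z <- s) ('X_i - z%:MP)).
Proof.
have [b bh bs] := graded_span_pw F wt_gt0.
pose N := size codes; pose v := basis_elt wt c b.
have exk (k : 'I_N.+1) : exists u : 'X_{1..n} -> F,
    pw_ideal wt c ('X_i ^+ k - \sum_(e <- codes) u e *: v e).
  exact: (code_span c bh bs).
have [u hu] := fin_all_exists exk.
pose A := \matrix_(k < N.+1, j < N) u k (nth 0%MM codes j).
have [w w0 wA] : exists2 w : 'rV_N.+1, w != 0 & w *m A = 0.
  have : ~~ row_free A by rewrite /row_free neq_ltn (leq_ltn_trans (rank_leq_col A)).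
  rewrite -kermx_eq0 => /rowV0Pn [w /sub_kermxP wA w0].
  by exists w.
pose chi := \poly_(k < N.+1) (if insub k is Some k' then w 0 k' else 0).
have chi0 : chi != 0.
  apply: contraNneq w0 => e; apply/eqP/rowP=> k; rewrite mxE.
  have := congr1 (fun p : {poly F} => p`_k) e.
  by rewrite /= coef_poly ltn_ord coef0 valK.
have idc := pw_ideal_ideal wt c.
have [s chiE] := closed_field_poly_normal chi; exists s.
have lc0 : lead_coef chi != 0 by rewrite lead_coef_eq0.
have mapE : (map_poly (@mpolyC n F) chi).['X_i] = lead_coef chi *: \prod_(z <- s) ('X_i - z%:MP).
  rewrite {1}chiE map_polyZ hornerZ mul_mpolyC; congr (_ *: _).
  rewrite rmorph_prod horner_prod; apply: eq_bigr => z _.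
  by rewrite /= map_polyXsubC hornerXsubC.
have Ichi : pw_ideal wt c (map_poly (@mpolyC n F) chi).['X_i].
  have -> : (map_poly (@mpolyC n F) chi).['X_i]
      = \sum_(k < N.+1) w 0 k *: ('X_i ^+ k - \sum_(e <- codes) u k e *: v e).
    under [RHS]eq_bigr do rewrite scalerBr.
    rewrite sumrB [X in _ - X](_ : _ = 0) ?subr0.
      rewrite (@horner_coef_wide _ N.+1); last first.
        by rewrite size_map_poly_id0 ?size_poly // fmorph_eq0 lead_coef_eq0.
      apply: eq_bigr => k _; rewrite coef_map /= coef_poly ltn_ord valK.
      by rewrite mul_mpolyC.
    under eq_bigr do rewrite (big_nth 0%MM) big_mkord scaler_sumr.
    rewrite exchange_big big1 // => j _; under eq_bigr do rewrite scalerA.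
    rewrite -scaler_suml; have /rowP/(_ j) := wA; rewrite !mxE => wAj.
    rewrite (eq_bigr (fun k => w 0 k * A k j)) => [|k _]; last by rewrite mxE.
    by rewrite wAj scale0r.
  by apply: is_ideal_sum => // k _; apply: is_idealZ.
by move: Ichi; rewrite mapE => /(is_idealZ idc (lead_coef chi)^-1); rewrite scalerA mulVf ?scale1r.
Qed.

(** Up to nonzero row and column factors this is a Vandermonde determinant in the distinct
    squares. *)
Lemma solution_jacobian x : solution x -> (0 < n)%N ->
  \det (\matrix_(a < n, i < n) ((wt i)%:R * x i ^+ (2 * a + 1) *+ (2 * a + 2))) != 0.
Proof.
move=> sx n_gt0; apply/det0P => -[u u0 uM]; case/eqP: u0; apply/rowP=> a; rewrite mxE.
pose p := \poly_(b < n) (if insub b is Some b' then u 0 b' *+ (2 * b + 2) else 0).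
have p0 : p = 0.
  apply: (@roots_geq_poly_eq0 _ p [seq x i ^+ 2 | i <- enum 'I_n]).
  - apply/allP=> _ /mapP [i _ ->]; apply/rootP.
    have /rowP/(_ i) := uM; rewrite !mxE => h.
    have wx0 : (wt i)%:R * x i != 0.
      by rewrite mulf_neq0 ?solution_neq0 // pnatr_eq0 -lt0n wt_gt0.
    apply: (mulfI wx0); rewrite mulr0 -[RHS]h horner_poly mulr_sumr; apply: eq_bigr => b _.
    rewrite valK mxE -exprM addn1 exprS.
    move: (x i ^+ _) (u 0 b) (wt i)%:R => z ub w; rewrite !(mulrnAl, mulrnAr).
    by congr (_ *+ _); ring.
  - by rewrite map_inj_uniq ?enum_uniq //; apply: solution_sqr_inj.
  - by rewrite size_map size_enum_ord size_poly.
have := congr1 (fun p : {poly F} => p`_a) p0; rewrite /= coef_poly ltn_ord coef0 valK.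
by move/eqP; rewrite -mulr_natr mulf_eq0 pnatr_eq0 addn2 orbF => /eqP.
Qed.

(* The Jacobian criterion: at a solution x the determinant of the matrix D with
   pw - pw(x) = D (X - x) is nonzero, and it conducts the ideal of x into the
   ideal of the equations. *)
Lemma vanishing_ideal q : (0 < n)%N -> (forall x, solution x -> q.@[x] = 0) ->
  pw_ideal wt c q.
Proof.
move=> n_gt0 qs; have idc := pw_ideal_ideal wt c.
(* If this colon ideal is proper, it has a zero x, which is a solution; but det D lies in B and does
   not vanish at x. *)
pose B p := pw_ideal wt c (q * p).
have idB : is_ideal B := ideal_colon_ideal q idc.
have IB p : pw_ideal wt c p -> B p by apply: is_idealMl.
case: (pselect (B 1)) => [|B1]; first by rewrite /B mulr1.
have [|x xB] := ideal_point idB B1.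
  by move=> i; have [s Is] := univariate_split i; exists s; apply: IB.
have sx : solution x.
  move=> a; have /IB/xB := pw_ideal_gen wt c a.
  by rewrite mevalB mevalC pw_eval => /eqP; rewrite subr_eq0 => /eqP.
pose D : 'M[P]_n := \matrix_(a, i) ((wt i)%:R *:
   \sum_(k < 2 * a + 2) 'X_i ^+ ((2 * a + 2).-1 - k) * (x i)%:MP ^+ k).
have DE (a : 'I_n) : pw a - (c a)%:MP = \sum_i D a i * ('X_i - (x i)%:MP).
  have -> : c a = (a.+1 == n)%:R by [].
  rewrite -(sx a) rmorph_sum -sumrB; apply: eq_bigr => i _; rewrite mxE.
  rewrite -scalerAl [X in _ = _ *: X]mulrC -subrXX scalerBr; congr (_ - _).
  by rewrite rmorphM rmorphXn /= mul_mpolyC.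
have adjE i : \det D * ('X_i - (x i)%:MP) = \sum_a \adj D i a * (pw a - (c a)%:MP).
  under eq_bigr do rewrite DE mulr_sumr.
  rewrite exchange_big /= (bigD1 i) //= [X in _ = _ + X]big1 ?addr0 => [|j nj].
    under eq_bigr do rewrite mulrA.
    rewrite -mulr_suml; congr (_ * _).
    by have /matrixP/(_ i i) := mul_adj_mx D; rewrite !mxE eqxx mulr1n => <-.
  under eq_bigr do rewrite mulrA.
  rewrite -mulr_suml; have /matrixP/(_ i j) := mul_adj_mx D.
  by rewrite !mxE eq_sym (negPf nj) mulr0n => ->; rewrite mul0r.
have Bdet : B (\det D).
  rewrite /B mulrC; pose J p := pw_ideal wt c (\det D * p).
  have idJ : is_ideal J := ideal_colon_ideal _ idc.
  have := ideal_eval (x := x) q idJ; rewrite qs // mpolyC0 subr0; apply.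
  move=> i; rewrite /J adjE; apply: is_ideal_sum => // a _.
  by apply: is_idealMl => //; apply: pw_ideal_gen.
have := xB _ Bdet; rewrite -[meval x _]/(meval x _) -det_map_mx => /eqP.
rewrite (_ : map_mx _ D = \matrix_(a < n, i < n) ((wt i)%:R * x i ^+ (2 * a + 1) *+ (2 * a + 2))).
  by rewrite (negPf (solution_jacobian sx n_gt0)).
apply/matrixP=> a i; rewrite !mxE /= mevalZ raddf_sum /=.
rewrite -mulrnAr; congr (_ * _); rewrite (eq_bigr (fun=> x i ^+ (2 * a + 1))) => [|k _].
  by rewrite sumr_const card_ord.
rewrite rmorphM !rmorphXn /= mevalXU mevalC -exprD subnK.
  by rewrite addn2 addn1.
by rewrite -ltnS prednK ?ltn_ord // addn2.
Qed.

(** If there were fewer solutions than codes, a nontrivial combination of the [basis_elt]s at codes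
    would vanish at all of them and lie in the ideal by [vanishing_ideal], against
    [basis_independent]. *)
Lemma many_solutions : exists s : seq {ffun 'I_n -> F},
  [/\ uniq s, size s = (\prod_(j < n) (2 * j + 2))%N & forall y, y \in s -> solution y].
Proof.
have [n0|n_gt0] := posnP n.
  exists [:: [ffun=> 0]]; split=> // [|y _ a]; last by have := ltn_ord a; rewrite {2}n0.
  by rewrite big1 // => j _; have := ltn_ord j; rewrite {2}n0.
have -> : (\prod_(j < n) (2 * j + 2))%N = size codes.
  by rewrite size_box; apply: eq_bigr => j _; rewrite nforms0.
have [b bh bs] := graded_span_pw F wt_gt0.
pose v := basis_elt wt c b; pose N := size codes.
suff H k : (k <= N)%N -> exists s : seq {ffun 'I_n -> F},
    [/\ uniq s, size s = k & forall y, y \in s -> solution y] by apply: H.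
elim: k => [_|k IHk kN]; first by exists [::].
have [s [us sk ss]] := IHk (ltnW kN).
suff [y sy ys] : exists2 y : {ffun 'I_n -> F}, solution y & y \notin s.
  by exists (y :: s); split=> [||z]; rewrite /= ?ys ?us ?sk // inE => /orP [/eqP->|/ss].
case: (pselect (exists2 y : {ffun 'I_n -> F}, solution y & y \notin s)) => // no.
pose A := \matrix_(i < N, j < k) (v (nth 0%MM codes i)).@[nth [ffun=> 0] s j].
have [w w0 wA] : exists2 w : 'rV_N, w != 0 & w *m A = 0.
  have : ~~ row_free A by rewrite /row_free neq_ltn (leq_ltn_trans (rank_leq_col A)).
  rewrite -kermx_eq0 => /rowV0Pn [w /sub_kermxP wA w0].
  by exists w.
pose kf e := if insub (index e codes) is Some i then w 0 i else 0.
have kfE (i : 'I_N) : kf (nth 0%MM codes i) = w 0 i.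
  by rewrite /kf index_uniq ?uniq_box // valK.
have Ik : pw_ideal wt c (\sum_(e <- codes) kf e *: v e).
  apply: vanishing_ideal => // x sx.
  have xs : [ffun i => x i] \in s.
    apply/negPn/negP => xs; apply: no; exists [ffun i => x i] => // a.
    by rewrite -sx; apply: eq_bigr => i _; rewrite ffunE.
  have xk : (index [ffun i => x i] s < k)%N by rewrite -sk index_mem.
  have /rowP/(_ (Ordinal xk)) := wA; rewrite !mxE => h; rewrite -[RHS]h.
  rewrite (big_nth 0%MM) big_mkord raddf_sum; apply: eq_bigr => i _ /=.
  rewrite mevalZ kfE mxE nth_index //; congr (_ * _).
  by apply: meval_eq => j; rewrite ffunE.
case/eqP: w0; apply/rowP=> i; rewrite mxE -kfE.
by apply: (basis_independent bh bs Ik); rewrite mem_nth.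
Qed.

End Solutions.

(** * Faces and their stabilisers *)

Section Rank.
Variables (d : Order.disp_t) (K : orderType d) (T : finType).
Implicit Types (A : {set T}) (f : T -> K).

Definition rank A f x := #|[set y in A | (f y < f x)%O]|.

Lemma rank_lt A f x x' : x \in A -> (f x < f x')%O -> (rank A f x < rank A f x')%N.
Proof.
move=> xA lt_xx'; apply: proper_card; apply/properP; split.
  by apply/subsetP=> y; rewrite !inE => /andP [-> /lt_trans ->].
by exists x; rewrite !inE xA ?lt_xx' ?ltxx.
Qed.

Lemma rank_ltE A f : {in A &, forall x x', (rank A f x < rank A f x')%N = (f x < f x')%O}.
Proof.
move=> x x' xA x'A; apply/idP/idP => [|/(rank_lt xA) //].
case: (ltgtP (f x) (f x')) => // [lt_x'x|eq_xx'].
  by rewrite ltnNge ltnW // rank_lt.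
by rewrite /rank eq_xx' ltnn.
Qed.

Lemma rank_eq A f : {in A &, forall x x', rank A f x = rank A f x' -> f x = f x'}.
Proof.
move=> x x' xA x'A eq_r; apply/eqP; rewrite eq_le !leNgt -!(@rank_ltE A f) //.
by rewrite eq_r ltnn.
Qed.

Lemma rank_bound A f x : x \in A -> (rank A f x < #|A|)%N.
Proof.
move=> xA; apply: proper_card; apply/properP; split.
  by apply/subsetP=> y; rewrite inE => /andP [].
by exists x; rewrite ?inE ?ltxx ?andbF.
Qed.

Lemma rank_perm A f (s : {perm T}) x : (forall y, (s y \in A) = (y \in A)) ->
  rank A (f \o s) x = rank A f (s x).
Proof.
move=> sA; rewrite /rank -[RHS](card_preimset _ (@perm_inj _ s)).
by apply: eq_card => y; rewrite !inE sA.
Qed.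

Lemma eq_rank A f f' x : (forall i j, (f i < f j)%O = (f' i < f' j)%O) ->
  rank A f x = rank A f' x.
Proof. by move=> e; apply: eq_card => y; rewrite !inE e. Qed.
End Rank.

Section Signs.
Variable R : realDomainType.
Implicit Types a b c e : R.

Lemma sgr_eqP a b : Num.sg a = Num.sg b <-> (0 < a) = (0 < b) /\ (a < 0) = (b < 0).
Proof.
split=> [e|]; first by rewrite -sgr_gt0 -sgr_lt0 e sgr_gt0 sgr_lt0.
case: (ltrgt0P a) => [a0|a0|->] [/esym b1 /esym b2].
- by rewrite !gtr0_sg.
- by rewrite !ltr0_sg.
- by rewrite sgr0; apply/esym/eqP; rewrite sgr_eq0 eq_le !leNgt b1 b2.
Qed.

Lemma lt_sqrE a b :
  (a < b) = if 0 < b then (a <= 0) || (a ^+ 2 < b ^+ 2) else (a < 0) && (b ^+ 2 < a ^+ 2).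
Proof.
case: ifPn => [b_gt0|]; rewrite -?leNgt.
  have [a_le0|a_gt0] := leP a 0; first by rewrite (le_lt_trans a_le0).
  by rewrite ltr_pXn2r // nnegrE ltW.
move=> b_le0; have [a_lt0|a_ge0] := ltP a 0; last by apply/negbTE; rewrite -leNgt (le_trans b_le0).
by rewrite -[b ^+ 2]sqrrN -[a ^+ 2]sqrrN ltr_pXn2r ?ltrN2 // nnegrE oppr_ge0 // ltW.
Qed.

Lemma sgr_sub_eq a b c e : Num.sg a = Num.sg c -> Num.sg b = Num.sg e ->
    (a ^+ 2 < b ^+ 2) = (c ^+ 2 < e ^+ 2) -> (b ^+ 2 < a ^+ 2) = (e ^+ 2 < c ^+ 2) ->
  Num.sg (a - b) = Num.sg (c - e).
Proof.
move=> /sgr_eqP [ac1 ac2] /sgr_eqP [be1 be2] lt1 lt2; apply/sgr_eqP.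
rewrite !subr_gt0 !subr_lt0 (lt_sqrE a) (lt_sqrE b) (lt_sqrE c) (lt_sqrE e).
by rewrite !leNgt ac1 ac2 be1 be2 lt1 lt2.
Qed.

Lemma sqr_sg_inj a b : a ^+ 2 = b ^+ 2 -> Num.sg a = Num.sg b -> a = b.
Proof.
move=> /eqP; rewrite eqf_sqr => /orP [/eqP-> //|/eqP ab] sab.
by rewrite [a]realEsg ?num_real // [b]realEsg ?num_real // sab ab normrN.
Qed.
End Signs.

Section Faces.
Variables (R : realType) (n : nat).
Local Notation point := 'cV[R]_n.
Implicit Types (u v : point).

Lemma same_face_all u v i j : same_face u v ->
  Num.sg (u i 0 - u j 0) = Num.sg (v i 0 - v j 0) /\
  Num.sg (u i 0 + u j 0) = Num.sg (v i 0 + v j 0).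
Proof.
case=> h1 h2; case: (ltngtP i j) => [/h2 //|/h2 [hB hD]|/val_inj ->].
  by rewrite ![_ i 0 + _ j 0]addrC -(opprB (u j 0)) -(opprB (v j 0)) !sgrN hB.
by rewrite !subrr -!mulr2n -[_ *+ 2]mulr_natl -[v j 0 *+ 2]mulr_natl !sgrM h1.
Qed.

(** Since u_i^2 - u_j^2 = (u_i - u_j)(u_i + u_j), a face amounts to the signs of the coordinates and
    the ranking of their squares. *)
Lemma same_faceP u v : same_face u v <-> (forall i, Num.sg (u i 0) = Num.sg (v i 0)) /\
  forall i j, (u i 0 ^+ 2 < u j 0 ^+ 2) = (v i 0 ^+ 2 < v j 0 ^+ 2).
Proof.
split=> [uv|[sg_uv lt_uv]]; split=> [i|i j].
- by case: uv => ->.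
- have [hB hD] := same_face_all i j uv.
  rewrite -subr_lt0 -[RHS]subr_lt0 !subr_sqr -[LHS]sgr_lt0 -[RHS]sgr_lt0.
  by rewrite !sgrM hB hD.
- exact: sg_uv.
- move=> _; split; first exact: sgr_sub_eq.
  rewrite -[u j 0]opprK -[v j 0]opprK; apply: sgr_sub_eq; rewrite ?sqrrN //.
  by rewrite !sgrN sg_uv.
Qed.
End Faces.

Section Ties.
Variable n : nat.
Local Notation B := (hyperoctahedral n).
Implicit Types (g : B).

(** The case i = j of the second condition records zero coordinates. Two fields are allowed because
    stabilisers of real and of complex points are compared. *)
Definition same_ties (K K' : numFieldType) (u : 'I_n -> K) (v : 'I_n -> K') : Prop :=
  forall i j, (u i == u j) = (v i == v j) /\ (u i == - u j) = (v i == - v j).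

Lemma hyp_mxE g : exists s e, g = hyp_of s e.
Proof. by have /signed_perm_mxP [s [e eg]] := hyp_mxP g; exists s, e; apply/val_inj. Qed.

Lemma act_coords_of (K : numFieldType) s e (y : 'I_n -> K) i :
  act_coords (hyp_of s e) y i = (-1) ^+ e (s^-1 i)%g * y (s^-1 i)%g.
Proof. exact: (hyp_of_col (y : 'I_n -> K^o)). Qed.

Section TwoFields.
Variables (K K' : numFieldType) (u : 'I_n -> K) (v : 'I_n -> K').

Lemma same_ties_eq0 i : same_ties u v -> (u i == 0) = (v i == 0).
Proof. by move=> /(_ i i) [_]; rewrite ![_ == - _]eq_sym !eqNr. Qed.

Lemma same_ties_sqr i j : same_ties u v -> (u i ^+ 2 == u j ^+ 2) = (v i ^+ 2 == v j ^+ 2).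
Proof. by move=> /(_ i j) [h1 h2]; rewrite !eqf_sqr h1 h2. Qed.

Lemma same_ties_first : same_ties u v -> first_squares u = first_squares v.
Proof.
move=> uv; apply/setP=> j; rewrite !inE (same_ties_eq0 _ uv); congr (_ && _).
by apply: eq_forallb => i; rewrite (same_ties_sqr _ _ uv).
Qed.

Lemma same_ties_fix g : same_ties u v -> act_coords g u =1 u -> act_coords g v =1 v.
Proof.
have [s [e ->]] := hyp_mxE g; move=> uv fu i; have := fu i.
rewrite !act_coords_of; have [h1 h2] := uv i (s^-1 i)%g.
case: (e _) => /esym/eqP; rewrite ?mulN1r ?mul1r.
  by rewrite h2 => /eqP.
by rewrite h1 => /eqP.
Qed.

(** Each tie says that one particular group element, a reflection or the identity, fixes the
    point. *)
Lemma ties_of_fix : (forall g, act_coords g u =1 u <-> act_coords g v =1 v) -> same_ties u v.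
Proof.
pose flip (i : 'I_n) := hyp_of 1 (pred1 i).
pose swap b (i j : 'I_n) := hyp_of (tperm i j) (fun k => b && (k \in [set i; j])).
have flipE (L : numFieldType) (w : 'I_n -> L) i : act_coords (flip i) w =1 w <-> w i == - w i.
  split=> [/(_ i)|/eqP wi k]; rewrite act_coords_of invg1 perm1 /=.
    by rewrite eqxx mulN1r => ->.
  by case: eqP => [->|_]; rewrite ?mul1r // mulN1r -wi.
have swapE (L : numFieldType) (w : 'I_n -> L) b i j :
    act_coords (swap b i j) w =1 w <-> w i == (-1) ^+ b * w j.
  split=> [/(_ i)|/eqP wi k]; rewrite act_coords_of tpermV.
    by rewrite tpermL !inE eqxx orbT andbT => ->.
  case: tpermP => [->|->|/eqP /negPf nki /eqP /negPf nkj]; rewrite !inE ?eqxx ?orbT ?andbT //.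
    by rewrite wi mulrA -expr2 sqrr_sign mul1r.
  by rewrite nki nkj andbF mul1r.
move=> fixE i j; split.
  apply/idP/idP => h.
    by have := (swapE _ v false i j).1; rewrite mul1r; apply; apply/fixE/swapE; rewrite mul1r.
  by have := (swapE _ u false i j).1; rewrite mul1r; apply; apply/fixE/swapE; rewrite mul1r.
apply/idP/idP => h.
  by have := (swapE _ v true i j).1; rewrite mulN1r; apply; apply/fixE/swapE; rewrite mulN1r.
by have := (swapE _ u true i j).1; rewrite mulN1r; apply; apply/fixE/swapE; rewrite mulN1r.
Qed.
End TwoFields.

Lemma same_ties_sym (K K' : numFieldType) (u : 'I_n -> K) (v : 'I_n -> K') :
  same_ties u v -> same_ties v u.
Proof. by move=> uv i j; have [-> ->] := uv i j. Qed.
End Ties.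

Section FaceStabilizers.
Variables (R : realType) (n : nat).
Implicit Types (A : face R n) (g : hyperoctahedral n) (u v : 'cV[R]_n).

Definition face_pt A : 'I_n -> R := fun i => sval (cid (faceP A)) i 0.

Lemma face_ptE A : A = the_face (\col_i face_pt A i).
Proof.
rewrite {1}(svalP (cid (faceP A))); congr the_face.
by apply/colP=> i; rewrite mxE.
Qed.

Lemma act_pointE g u i : act_point g u i 0 = act_coords g^-1%g (u^~ 0) i.
Proof. by rewrite mxE; apply: eq_bigr => j _; rewrite !mxE. Qed.

Lemma face_act_the_face g u : face_act g (the_face u) = the_face (act_point g u).
Proof.
have [w ew] := faceP (face_act g (the_face u)); rewrite ew; apply/the_faceP.
suff : face_set (face_act g (the_face u)) (act_point g u) by rewrite ew.
by exists u.
Qed.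

Lemma same_face_ties u v : same_face u v -> same_ties (u^~ 0) (v^~ 0).
Proof.
move=> uv i j; have [hB hD] := same_face_all i j uv.
rewrite -subr_eq0 -[in RHS]subr_eq0 -sgr_eq0 hB sgr_eq0; split=> //.
by rewrite -addr_eq0 -[in RHS]addr_eq0 -sgr_eq0 hD sgr_eq0.
Qed.

(* The multiset of the u_i ^ 2 and hence their ranking is the same for u and
   g u, so that if these lie in the same face then each u_i ^ 2 is fixed. *)
Lemma same_face_fix g u : same_face (act_point g u) u -> act_point g u = u.
Proof.
have [s [e eg]] := hyp_mxE g^-1%g; move=> /same_faceP [sg_gu lt_gu].
have guE i : act_point g u i 0 ^+ 2 = u (s^-1 i)%g 0 ^+ 2.
  by rewrite act_pointE eg act_coords_of exprMn sqrr_sign mul1r.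
apply/colP=> i; apply: sqr_sg_inj => //; rewrite guE.
apply: (@rank_eq _ _ _ [set: 'I_n] (fun i => u i 0 ^+ 2)); rewrite ?inE //.
rewrite -(@rank_perm _ _ _ _ _ s^-1%g) => [|j]; last by rewrite !inE.
by apply: eq_rank => j k /=; rewrite -!guE lt_gu.
Qed.

(** By [same_face_fix] the stabiliser of a face is that of its chosen point; the inverse appears
    because [act_coords g] applies the inverse of g. *)
Lemma face_fixE A g : (face_act g A = A) <-> act_coords g^-1%g (face_pt A) =1 face_pt A.
Proof.
rewrite {1 2}(face_ptE A) face_act_the_face; set u := \col_i _.
have uE : face_pt A =1 u^~ 0 by move=> i; rewrite mxE.
have -> : (the_face (act_point g u) = the_face u) <-> (act_point g u = u).
  by split=> [/the_faceP/same_face_fix|->].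
split=> [gu i|gu].
  rewrite uE -{1}gu act_pointE; apply: eq_bigr => j _; by rewrite uE.
apply/colP=> i; rewrite act_pointE -uE -gu; apply: eq_bigr => j _; by rewrite uE.
Qed.
End FaceStabilizers.

(** * Equivariant injections *)

Section EquivariantInjection.
Variables (gT : finGroupType) (X : finType) (Y : eqType).
Variables (aX : gT -> X -> X) (aY : gT -> Y -> Y).
Hypothesis aX1 : forall x, aX 1%g x = x.
Hypothesis aXM : forall g h x, aX (g * h)%g x = aX g (aX h x).
Hypothesis aY1 : forall y, aY 1%g y = y.
Hypothesis aYM : forall g h y, aY (g * h)%g y = aY g (aY h y).
Variable good : Y -> Prop.
Hypothesis good_act : forall g y, good y -> good (aY g y).

Definition fixers (Z : eqType) (aZ : gT -> Z -> Z) z := [set g | aZ g z == z].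

Hypothesis enough : forall x, exists s : seq Y,
  [/\ uniq s, (#|[set x' | fixers aX x' == fixers aX x]| <= size s)%N
    & forall y, y \in s -> good y /\ fixers aY y = fixers aX x].

Definition partial_injection (D : {set X}) (f : X -> Y) :=
  [/\ forall g x, x \in D -> aX g x \in D, {in D &, injective f},
      forall g, {in D, forall x, f (aX g x) = aY g (f x)}
    & {in D, forall x, good (f x) /\ fixers aY (f x) = fixers aX x}].

Lemma extend_partial_injection D f x : partial_injection D f -> x \notin D ->
  exists (D' : {set X}) (f' : X -> Y), [/\ D \subset D', x \in D' & partial_injection D' f'].
Proof.
move=> [Dst f_inj f_eqv f_good] xD; have [s [us Zs s_good]] := enough x.
set Z := [set _ | _] in Zs.
have [y ys fy] : exists2 y, y \in s & y \notin [seq f z | z <- enum (Z :&: D)].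
  apply/hasP; rewrite -[has _ _]negbK -all_predC; apply/negP => /allP sf.
  have : (size s <= size [seq f z | z <- enum (Z :&: D)])%N.
    by apply: uniq_leq_size => // y /sf; rewrite /= negbK.
  rewrite size_map -cardE leqNgt => /negP; apply; apply: leq_trans Zs.
  apply: proper_card; rewrite properE subsetIl; apply/subsetPn.
  by exists x; rewrite inE ?eqxx // (negPf xD) andbF.
have [y_good y_fix] := s_good y ys.
(* An element of D with value y would have the stabiliser of x, hence lie in Z, whose values y
   avoids. *)
have yf d : d \in D -> f d != y.
  move=> dD; apply/eqP=> fd; case/negP: fy; apply/mapP; exists d => //.
  by rewrite mem_enum inE dD andbT inE; have [_ <-] := f_good d dD; rewrite fd y_fix.
pose f' x' := if [pick g | aX g x == x'] is Some g then aY g y else f x'.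
have f'x g : f' (aX g x) = aY g y.
  rewrite /f'; case: pickP => [h /eqP hg|/(_ g)]; last by rewrite eqxx.
  have : (h^-1 * g)%g \in fixers aX x by rewrite inE aXM -hg -aXM mulVg aX1.
  by rewrite -y_fix inE => /eqP {1}<-; rewrite -aYM mulKVg.
have f'd d : d \in D -> f' d = f d.
  move=> dD; rewrite /f'; case: pickP => // h /eqP hd; case/negP: xD.
  by rewrite -[x]aX1 -(mulVg h) aXM hd Dst.
exists (D :|: [set aX g x | g in [set: gT]]), f'; split; first exact: subsetUl.
  by rewrite inE; apply/orP; right; apply/imsetP; exists 1%g.
have orb z : z \in D :|: [set aX g x | g in [set: gT]] -> z \in D \/ exists g, z = aX g x.
  by rewrite inE => /orP [|/imsetP [g _ ->]]; [left | right; exists g].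
have fy' d g : d \in D -> f d <> aY g y.
  move=> dD fd; have /negP := yf _ (Dst g^-1%g d dD); apply.
  by rewrite f_eqv // fd -aYM mulVg aY1.
split.
- move=> g z /orb [zD|[h ->]]; rewrite inE; first by rewrite Dst.
  by rewrite -aXM; apply/orP; right; apply: imset_f.
- move=> z z' /orb [zD|[h ->]] /orb [z'D|[h' ->]]; rewrite ?f'x.
  + by rewrite !f'd //; apply: f_inj.
  + by rewrite f'd // => /fy'; case.
  + by rewrite f'd // => /esym/fy'; case.
  + move=> hh'; have : (h^-1 * h')%g \in fixers aY y by rewrite inE aYM -hh' -aYM mulVg aY1.
    by rewrite y_fix inE => /eqP {1}<-; rewrite -aXM mulKVg.
- move=> g z /orb [zD|[h ->]]; first by rewrite !f'd ?Dst // f_eqv.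
  by rewrite -aXM !f'x aYM.
- move=> z /orb [zD|[h ->]]; first by rewrite f'd //; apply: f_good.
  rewrite f'x; split; first exact: good_act.
  apply/setP=> g; rewrite !inE.
  have := congr1 (fun C : {set gT} => (h^-1 * g * h)%g \in C) y_fix.
  rewrite !inE !aYM !aXM => e; apply/eqP/eqP => hz.
    have : aX h^-1%g (aX g (aX h x)) == x by rewrite -e hz -aYM mulVg aY1.
    by move/eqP => {2}<-; rewrite -!aXM !mulgA mulgV mul1g.
  have : aY h^-1%g (aY g (aY h y)) == y by rewrite e hz -aXM mulVg aX1.
  by move/eqP => {2}<-; rewrite -!aYM !mulgA mulgV mul1g.
Qed.

Lemma equivariant_injection (y0 : Y) : exists f : X -> Y,
  [/\ injective f, forall g x, f (aX g x) = aY g (f x) & forall x, good (f x)].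
Proof.
suff H k : exists (D : {set X}) (f : X -> Y),
    partial_injection D f /\ (k <= #|D|)%N \/ partial_injection D f /\ D = setT.
  have [D [f Df]] := H #|X|.+1.
  have [D_inj DT] : partial_injection D f /\ D = setT.
    by case: Df => [[_ /leq_trans/(_ (max_card _))]|//]; rewrite ltnn.
  move: D_inj; rewrite DT => -[_ f_inj f_eqv f_good]; exists f; split=> [x x'|g x|x].
  - by apply: f_inj; rewrite in_setT.
  - by rewrite f_eqv ?in_setT.
  - by have [] := f_good x (in_setT x).
elim: k => [|k [D [f [[fD kD]|[fD DT]]]]].
- exists set0, (fun=> y0); left; split=> //.
  by split=> [g z|z z'|g z|z]; rewrite inE.
- have [DT|] := eqVneq D setT; first by exists D, f; right.
  rewrite -subTset => /subsetPn [x _ xD].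
  have [D' [f' [DD' xD' fD']]] := extend_partial_injection fD xD.
  exists D', f'; left; split=> //; apply: leq_ltn_trans kD _.
  by apply: proper_card; apply/properP; split=> //; exists x.
- by exists D, f; right.
Qed.
End EquivariantInjection.

(** * Faces and complex points with prescribed ties *)

Section FacesWithTies.
Variables (R : realType) (n : nat) (u : 'I_n -> R).
Local Notation m := #|first_squares u|.
Local Notation t k := (@enum_val _ (mem (first_squares u)) k).

Lemma first_squares_ties (K : numFieldType) (w : 'I_n -> K) i : same_ties u w ->
  u i != 0 -> exists (k : 'I_m) (b : bool), u i = (-1) ^+ b * u (t k) /\ w i = (-1) ^+ b * w (t k).
Proof.
move=> uw /first_squaresP [j jT /eqP].
rewrite -(enum_rankK_in jT jT) eqf_sqr; set k := enum_rank_in _ _ => uij.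
exists k, (u i != u (t k)); move: uij; have [h1 h2] := uw i (t k).
case: eqVneq h1 h2 => [-> /esym/eqP -> _ _|_ _ h2 /= uij]; first by rewrite !mul1r.
by move: h2; rewrite uij !mulN1r => /esym/eqP ->; rewrite (eqP uij).
Qed.

(** The ties express all coordinates through those at [first_squares u], where m signs and the
    ranking of m distinct squares determine the face. *)
Lemma card_same_ties :
  (#|[set A : face R n | `[< same_ties u (face_pt A) >]]| <= 2 ^ m * m`!)%N.
Proof.
pose sq (A : face R n) (k : 'I_m) := face_pt A (t k) ^+ 2.
pose signs (A : face R n) : {ffun 'I_m -> bool} := [ffun k => 0 < face_pt A (t k)].
pose ranks (A : face R n) : {ffun 'I_m -> 'I_#|[set: 'I_m]|} :=
  [ffun k => Ordinal (rank_bound (sq A) (in_setT k))].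
pose code (A : face R n) := (signs A, ranks A).
pose codes := setX [set: {ffun 'I_m -> bool}]
  [set r | injectiveb (r : {ffun 'I_m -> 'I_#|[set: 'I_m]|})].
have -> : (2 ^ m * m`! = #|codes|)%N.
  by rewrite cardsX cardsT card_ffun card_bool card_ord card_inj_ffuns !card_ord cardsT
    card_ord ffactnn.
have tnz (A : face R n) k : same_ties u (face_pt A) -> face_pt A (t k) != 0.
  move=> uA; rewrite -(same_ties_eq0 _ uA).
  by have := enum_valP k; rewrite inE => /andP [].
rewrite -(@card_in_imset _ _ code) => [|A A'].
  apply: subset_leq_card; apply/subsetP=> c /imsetP [A]; rewrite inE => /asboolP uA -> {c}.
  rewrite !inE /=; apply/injectiveP=> k l; rewrite !ffunE => /(congr1 val) /= rkl.
  have sq_kl : sq A k = sq A l by apply: rank_eq rkl; rewrite inE.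
  apply: enum_val_inj; apply: (first_squares_inj (y := u)); rewrite ?enum_valP //.
  by apply/eqP; rewrite (same_ties_sqr _ _ uA); apply/eqP.
rewrite !inE => /asboolP uA /asboolP uA' [/ffunP sgE /ffunP rkE].
rewrite [A]face_ptE [A']face_ptE; apply/the_faceP/same_faceP.
have sg_t k : Num.sg (face_pt A (t k)) = Num.sg (face_pt A' (t k)).
  have := sgE k; rewrite !ffunE => h; apply/sgr_eqP; split=> //.
  by rewrite !lt_neqAle !tnz //= !leNgt h.
have sq_t k l : (face_pt A (t k) ^+ 2 < face_pt A (t l) ^+ 2)
              = (face_pt A' (t k) ^+ 2 < face_pt A' (t l) ^+ 2).
  have := rkE k; have := rkE l; rewrite !ffunE => /(congr1 val) /= hl /(congr1 val) /= hk.
  rewrite -(@rank_ltE _ _ _ setT (sq A)) ?inE // hk hl.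
  by rewrite (@rank_ltE _ _ _ setT (sq A')) ?inE.
have ties i : u i = 0 \/ exists (k : 'I_m) (b : bool),
    face_pt A i = (-1) ^+ b * face_pt A (t k) /\ face_pt A' i = (-1) ^+ b * face_pt A' (t k).
  have [->|ui] := eqVneq (u i) 0; [by left | right].
  have [k [b [ub Ab]]] := first_squares_ties uA ui.
  exists k, b; split=> //; have [h1 h2] := uA' i (t k).
  case: b ub {Ab} => /eqP; rewrite ?mulN1r ?mul1r; first by rewrite h2 => /eqP.
  by rewrite h1 => /eqP.
have z0 i : u i = 0 -> (face_pt A i = 0) * (face_pt A' i = 0).
  by move=> ui; split; apply/eqP; rewrite -?(same_ties_eq0 _ uA) -?(same_ties_eq0 _ uA') ui.
split=> [i|i j]; rewrite !mxE.
  by have [/z0 [-> ->] //|[k [b [-> ->]]]] := ties i; rewrite !sgrM sg_t.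
have [/z0 [-> ->]|[l [c [-> ->]]]] := ties j; first by rewrite expr0n /= !ltNge !sqr_ge0.
have [/z0 [-> ->]|[k [b [-> ->]]]] := ties i; last by rewrite !exprMn !sqrr_sign !mul1r.
by rewrite !exprMn !sqrr_sign !mul1r expr0n /= !lt_neqAle !sqr_ge0
  ![0 == _]eq_sym !sqrf_eq0 !(negPf (tnz _ _ _)).
Qed.
End FacesWithTies.

Section Points.
Variables (R : realType) (F : numClosedFieldType) (n : nat).
Implicit Types (y : 'I_n -> F).

Lemma signed_even_power (b : bool) (x : F) a :
  ((-1) ^+ b * x) ^+ (2 * a + 2) = x ^+ (2 * a + 2).
Proof.
by rewrite addnC -mulnS exprM [RHS]exprM [in LHS](exprMn 2) sqrr_sign mul1r.
Qed.

Definition normalized_powers y := forall a, (a < num_squares y)%N ->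
  \sum_i y i ^+ (2 * a + 2) = (a.+1 == num_squares y)%:R.

Lemma normalized_powers_act g y : normalized_powers y -> normalized_powers (act_coords g y).
Proof.
move=> ny a; rewrite num_squares_act => /ny <-; have [s [e ->]] := hyp_mxE g.
rewrite (reindex_inj (@perm_inj _ s)); apply: eq_bigr => i _.
by rewrite act_coords_of permK signed_even_power.
Qed.

Section Lift.
Variable u : 'I_n -> R.
Local Notation m := #|first_squares u|.
Local Notation t k := (@enum_val _ (mem (first_squares u)) k).

(** Copies z along the ties of u: if u_i is plus or minus u_(t k), coordinate i gets z k with that
    sign. At most one k qualifies, so the sum is a lookup with default 0. *)
Definition spread (z : 'I_m -> F) : {ffun 'I_n -> F} :=
  [ffun i => \sum_(k < m | u i ^+ 2 == u (t k) ^+ 2) (-1) ^+ (u i != u (t k)) * z k].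

Lemma spread0 z i : u i = 0 -> spread z i = 0.
Proof.
move=> ui; rewrite ffunE big_pred0 // => k; rewrite ui expr0n eq_sym sqrf_eq0.
by have := enum_valP k; rewrite inE => /andP [/negPf ->].
Qed.

Lemma spread_unique i k l : u i ^+ 2 = u (t k) ^+ 2 -> u i ^+ 2 = u (t l) ^+ 2 -> k = l.
Proof.
move=> -> kl; apply: enum_val_inj; apply: (first_squares_inj (y := u)) => //; exact: enum_valP.
Qed.

Lemma spreadE z i k : u i ^+ 2 = u (t k) ^+ 2 ->
  spread z i = (-1) ^+ (u i != u (t k)) * z k.
Proof.
move=> uik; rewrite ffunE (big_pred1 k) // => l; apply/eqP/eqP => [/(spread_unique uik) //|->].
by [].
Qed.

Lemma spreadP i : u i = 0 \/ exists (k : 'I_m) (b : bool), u i = (-1) ^+ b * u (t k) /\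
  forall z, spread z i = (-1) ^+ b * z k.
Proof.
have [|ui] := eqVneq (u i) 0; [by left | right].
have [k [b [ub _]]] := first_squares_ties (fun i j => conj erefl erefl : _ /\ _) ui.
exists k, b; split=> // z; have tk0 : u (t k) != 0.
  by have := enum_valP k; rewrite inE => /andP [].
rewrite (spreadE _ (k := k)); last by rewrite ub exprMn sqrr_sign mul1r.
rewrite ub; case: b {ub}.
  by rewrite !mulN1r eqNr tk0 mulN1r.
by rewrite !mul1r eqxx mul1r.
Qed.

Lemma spread_inj z z' : spread z = spread z' -> z =1 z'.
Proof.
by move=> /ffunP e k; have := e (t k); rewrite !(spreadE _ (erefl _)) eqxx !mul1r.
Qed.

Definition multiplicity (k : 'I_m) := #|[set i | u i ^+ 2 == u (t k) ^+ 2]|.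

Lemma multiplicity_gt0 k : (0 < multiplicity k)%N.
Proof. by apply/card_gt0P; exists (t k); rewrite inE. Qed.

Lemma spread_sum z a : \sum_i spread z i ^+ (2 * a + 2)
  = \sum_k (multiplicity k)%:R * z k ^+ (2 * a + 2).
Proof.
transitivity (\sum_i \sum_(k < m | u i ^+ 2 == u (t k) ^+ 2) z k ^+ (2 * a + 2)).
  apply: eq_bigr => i _; have [ui|[k [b [ub yE]]]] := spreadP i.
    rewrite spread0 // big_pred0 ?expr0n ?addn2 // => k.
    rewrite ui expr0n eq_sym sqrf_eq0.
    by have := enum_valP k; rewrite inE => /andP [/negPf ->].
  have uik : u i ^+ 2 = u (t k) ^+ 2 by rewrite ub exprMn sqrr_sign mul1r.
  rewrite yE (big_pred1 k) => [|l]; last first.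
    by apply/eqP/eqP => [/(spread_unique uik) //|->].
  by rewrite signed_even_power.
rewrite (exchange_big_dep xpredT) //=; apply: eq_bigr => k _.
by rewrite sumr_const mulr_natl; congr (_ *+ _); apply: eq_card => i; rewrite !inE.
Qed.

Lemma spread_ties z : (forall k, z k != 0) -> injective (fun k => z k ^+ 2) ->
  same_ties u (spread z).
Proof.
move=> z0 z_inj i j.
have main (b c : bool) (k l : 'I_m) : ((-1) ^+ b * u (t k) == (-1) ^+ c * u (t l))
    = ((-1) ^+ b * z k == (-1) ^+ c * z l).
  have tk0 : u (t k) != 0 by have := enum_valP k; rewrite inE => /andP [].
  have [<-|nkl] := eqVneq k l.
    case: b; case: c; rewrite ?eqxx // mulN1r mul1r.
      by rewrite mulN1r mul1r !eqNr (negPf tk0) (negPf (z0 k)).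
    by rewrite mulN1r mul1r ![_ == - _]eq_sym !eqNr (negPf tk0) (negPf (z0 k)).
  transitivity false; last apply/esym; apply: contraNF nkl => /eqP e; apply/eqP.
    apply: (@spread_unique (t k)) => //; have := congr1 (fun x => x ^+ 2) e.
    by rewrite !exprMn !sqrr_sign !mul1r.
  by apply: z_inj; have := congr1 (fun x => x ^+ 2) e; rewrite !exprMn !sqrr_sign !mul1r.
have nz (b : bool) k : ((-1) ^+ b * u (t k) == 0) = ((-1) ^+ b * z k == 0).
  rewrite !mulf_eq0 !signr_eq0 (negPf (z0 k)).
  by have := enum_valP k; rewrite inE => /andP [/negPf ->].
have [ui|[k [b [-> ->]]]] := spreadP i; have [uj|[l [c [-> ->]]]] := spreadP j.
- by rewrite ui uj !spread0 // !oppr0 !eqxx.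
- by rewrite ui spread0 // ![0 == _]eq_sym !oppr_eq0 nz.
- by rewrite uj !spread0 // !oppr0 nz.
- by rewrite -!mulNr -!signrN !main.
Qed.

(** With the multiplicities as weights, solutions have nonzero distinct squares, so their spreads
    have exactly the ties of u; the product of the 2j+2 for j < m is 2^m m!. *)
Lemma enough_points : exists s : seq {ffun 'I_n -> F},
  [/\ uniq s, size s = (2 ^ m * m`!)%N
    & forall y : {ffun 'I_n -> F}, y \in s -> normalized_powers y /\ same_ties u y].
Proof.
have [s [us ss s_sol]] := many_solutions F multiplicity_gt0.
exists [seq spread z | z : {ffun 'I_m -> F} <- s]; split.
- by rewrite map_inj_uniq // => z z' /spread_inj zz'; apply/ffunP.
- rewrite size_map ss fact_prod big_add1 big_mkord -[X in (2 ^ X)%N]card_ord.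
  by rewrite -prod_nat_const -big_split; apply: eq_bigr => j _; rewrite /= mulnS addnC.
move=> _ /mapP [z /s_sol sz ->].
have ties : same_ties u (spread z).
  apply: spread_ties => [k|]; first exact: solution_neq0 sz.
  exact: solution_sqr_inj sz.
split=> // a; rewrite -card_first_squares -(same_ties_first ties) => am.
by rewrite spread_sum (sz (Ordinal am)).
Qed.
End Lift.

Lemma equivariant_points : exists pt : face R n -> 'I_n -> F,
  [/\ forall A, normalized_powers (pt A), forall A A', pt A =1 pt A' -> A = A'
    & forall g A, pt (face_act g^-1%g A) =1 act_coords g (pt A)].
Proof.
(* The inverse turns the right action [act_coords] into a left action. *)
pose aY (g : hyperoctahedral n) (y : {ffun 'I_n -> F}) : {ffun 'I_n -> F} :=
  [ffun i => act_coords g^-1%g y i].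
have act_eq g (y y' : 'I_n -> F) : y =1 y' -> act_coords g y =1 act_coords g y'.
  by move=> yy' i; apply: eq_bigr => j _; rewrite yy'.
have aY1 (y : {ffun 'I_n -> F}) : aY 1%g y = y.
  apply/ffunP=> i; rewrite ffunE invg1 /act_coords (bigD1 i) //= big1 ?addr0.
    by rewrite !mxE eqxx mul1r.
  by move=> j /negPf nj; rewrite !mxE nj mul0r.
have aYM g h (y : {ffun 'I_n -> F}) : aY (g * h)%g y = aY g (aY h y).
  apply/ffunP=> i; rewrite !ffunE invMg act_coordsM.
  by apply: act_eq => j; rewrite ffunE.
pose good (y : {ffun 'I_n -> F}) := normalized_powers y.
have good_ext (y y' : 'I_n -> F) : y =1 y' -> normalized_powers y -> normalized_powers y'.
  by move/funext->.
have good_act g (y : {ffun 'I_n -> F}) : good y -> good (aY g y).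
  by move=> /(@normalized_powers_act g^-1%g); apply: good_ext => i; rewrite ffunE.
have aY_fix g (y : {ffun 'I_n -> F}) : aY g y = y <-> act_coords g^-1%g y =1 y.
  split=> [/ffunP e i|e]; first by rewrite -{1}e ffunE.
  by apply/ffunP=> i; rewrite ffunE e.
have fixE A (y : {ffun 'I_n -> F}) :
    same_ties (face_pt A) y -> fixers aY y = fixers (@face_act R n) A.
  move=> Ay; apply/setP=> g; rewrite !inE; apply/eqP/eqP => [/aY_fix|/face_fixE] gA.
    by apply/face_fixE; apply: same_ties_fix gA; apply: same_ties_sym.
  by apply/aY_fix; apply: same_ties_fix gA.
have [|f [f_inj f_eqv f_good]] := @equivariant_injection _ _ _ (@face_act R n) aY
  (@face_act1 R n) (@face_actM R n) aY1 aYM good good_act _ [ffun=> 0].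
  move=> A; have [s [us ss s_good]] := enough_points (face_pt A).
  exists s; split=> // [|y /s_good [gy uy]]; last by split=> //; apply: fixE.
  rewrite ss; apply: leq_trans (card_same_ties (face_pt A)); apply: subset_leq_card.
  apply/subsetP=> A'; rewrite !inE => /eqP eA; apply/asboolP.
  apply: ties_of_fix => g; rewrite -[g]invgK; have /setP/(_ g^-1%g) := eA.
  rewrite !inE => e; split=> /face_fixE/eqP; [rewrite -e|rewrite e] => /eqP/face_fixE //.
exists (fun A => fun_of_fin (f A : {ffun _ -> F})).
split=> [A|A A' /ffunP/f_inj|g A i]; [exact: f_good|by []|].
by rewrite f_eqv ffunE invgK.
Qed.
End Points.

(** * Counting faces *)

(** The ranks within Q run through 0, ..., #|Q| - 1. *)
Lemma prod_rank n (Q : {set 'I_n}) :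
  (\prod_(j in Q) (rank Q val j).+1 = #|Q|`!)%N.
Proof.
rewrite big_enum_val /=.
pose h (k : 'I_#|Q|) := Ordinal (rank_bound (val : 'I_n -> nat) (enum_valP k)).
have h_inj : injective h.
  move=> k l /(congr1 val) /= hkl; apply: enum_val_inj; apply: val_inj.
  by apply: rank_eq hkl; apply: enum_valP.
by rewrite fact_prod big_add1 big_mkord [RHS](reindex_inj h_inj).
Qed.

Section FaceCount.
Variables (R : realType) (n : nat).
Local Notation signed_index := ('I_n * bool)%type.
Implicit Types (S : {set 'I_n}) (a : {ffun 'I_n -> option signed_index}) (p : 'S_n).

(* A triple (S, a, p) encodes a point with coordinates of absolute value 0, 1,
   ..., n.  Outside S are the indices at which a nonzero absolute value occurs
   for the first time, which there is given by p; the coordinate j in S is 0 if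
   a j = None and +-1 times coordinate t < j, t outside S, if a j = Some (t, _). *)
Definition targets S j : {set option signed_index} :=
  if j \in S then None |: Some @: setX [set t in free_below S j] [set: bool]
  else Some @: setX [set j] [set: bool].

Lemma size_free_below S j : size (free_below S j) = rank (~: S) val j.
Proof.
have /card_uniqP <- : uniq (free_below S j) by rewrite filter_uniq ?enum_uniq.
apply: eq_card => t; by rewrite mem_filter mem_enum !inE andbT andbC.
Qed.

(** For j in S, r_j = 1 + 2 #U counts the value 0 and the signed free indices below j. For j outside
    S, r_j = 2 (#U + 1) is a choice of sign times a factor of the factorial. *)
Lemma prod_nforms S :
  (\prod_(j < n) nforms S j = #|family (targets S)| * #|~: S|`!)%N.
Proof.
have -> : #|family (targets S)| = (\prod_j #|targets S j|)%N.
  by rewrite card_family foldrE big_map big_enum.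
rewrite -prod_rank [X in (_ * X)%N]big_mkcond -big_split; apply: eq_bigr => j _ /=.
rewrite /nforms size_free_below /targets in_setC; case: (boolP (j \in S)) => jS /=.
  rewrite cardsU1 card_imset; last by move=> ? ? [].
  rewrite cardsX cardsT card_bool muln1 (_ : #|_| = rank (~: S) val j); last first.
    rewrite -size_free_below.
    have /card_uniqP <- : uniq (free_below S j) by rewrite filter_uniq ?enum_uniq.
    by apply: eq_card => t; rewrite inE.
  by case: imsetP => [[]|_] //; rewrite muln2 addnn.
rewrite card_imset; last by move=> ? ? [].
by rewrite cardsX cards1 cardsT card_bool mul1n mulnS mul2n addnn.
Qed.

Definition is_code (c : {set 'I_n} * ({ffun 'I_n -> option signed_index} * 'S_n)) : bool :=
  (c.2.1 \in family (targets c.1)) && perm_on (~: c.1) c.2.2.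

Lemma card_codes : #|is_code| = (\sum_(S : {set 'I_n}) size (box S n))%N.
Proof.
rewrite -sum1_card -(pair_big_dep xpredT (fun S ap => is_code (S, ap)) (fun _ _ => 1%N)) /=.
apply: eq_bigr => S _; rewrite size_box prod_nforms -card_perm -cardX -sum1_card.
by apply: eq_bigl => -[a p].
Qed.

Lemma succ_sqr_inj : injective (fun k : 'I_n => k.+1%:R ^+ 2 : R).
Proof. by move=> k l /eqP; rewrite eqrXn2 ?ler0n // eqr_nat eqSS => /eqP/val_inj. Qed.

Definition code_point (c : {set 'I_n} * ({ffun 'I_n -> option signed_index} * 'S_n)) : 'I_n -> R :=
  fun j => if c.2.1 j is Some (t, b) then (-1) ^+ (b : bool) * (c.2.2 t).+1%:R else 0.

Section OneCode.
Variables (S : {set 'I_n}) (a : {ffun 'I_n -> option signed_index}) (p : 'S_n).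
Hypothesis Sap : is_code (S, (a, p)).
Local Notation u := (code_point (S, (a, p))).

Lemma code_targets j t b : a j = Some (t, b) ->
  t \notin S /\ if j \in S then (t < j)%N else t == j.
Proof.
move=> aj; have /andP [/familyP/(_ j) /= + _] := Sap.
rewrite aj /targets; case: ifP => jS; rewrite ?inE /=.
  case/imsetP => -[t' b']; rewrite !inE mem_filter mem_enum !andbT.
  by move=> /andP [t'j t'S] [-> _].
by case/imsetP => -[t' b']; rewrite !inE andbT /= => /eqP -> [-> _]; rewrite jS.
Qed.

Lemma code_leader t : t \notin S -> exists b, a t = Some (t, b).
Proof.
move=> tS; have /andP [/familyP/(_ t) /= + _] := Sap.
rewrite /targets (negPf tS) => /imsetP [[t' b]].
by rewrite !inE andbT /= => /eqP -> at'; exists b.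
Qed.

Lemma code_point_eq0 j : (u j == 0) = (a j == None).
Proof.
rewrite /code_point /=; case: (a j) => [[t b]|]; last by rewrite !eqxx.
by rewrite mulf_eq0 signr_eq0 pnatr_eq0.
Qed.

Lemma code_point_sqr j t b : a j = Some (t, b) -> u j ^+ 2 = (p t).+1%:R ^+ 2.
Proof. by move=> aj; rewrite /code_point /= aj exprMn sqrr_sign mul1r. Qed.

Lemma code_point_leader j t b : a j = Some (t, b) -> u j ^+ 2 = u t ^+ 2.
Proof.
move=> aj; have [/code_leader [c at_] _] := code_targets aj.
by rewrite (code_point_sqr aj) (code_point_sqr at_).
Qed.

(** A coordinate in S is 0 or repeats an earlier square, while one outside S introduces a new
    square; hence S can be read off from the point. *)
Lemma first_squares_code : first_squares u = ~: S.
Proof.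
apply/setP=> j; rewrite !inE code_point_eq0; apply/idP/idP => [/andP [aj /forallP fj]|jS].
  case aE: (a j) aj => [[t b]|] // _.
  have [tS] := code_targets aE; case: ifP => // jS tj; have := fj t.
  by rewrite tj (code_point_leader aE) eqxx.
have [b aj] := code_leader jS; rewrite aj; apply/forallP=> i; apply/implyP=> ij.
case ai: (a i) => [[t c]|]; last first.
  have /eqP -> : u i == 0 by rewrite code_point_eq0 ai.
  by rewrite expr0n eq_sym sqrf_eq0 code_point_eq0 aj.
rewrite (code_point_sqr ai) (code_point_sqr aj); apply: contraTneq ij => /succ_sqr_inj /perm_inj tj.
have [_] := code_targets ai; rewrite tj -leqNgt; case: ifP => _; first exact: ltnW.
by move/eqP->.
Qed.

Lemma rank_code t : t \notin S ->
  rank (~: S) (fun j => u j ^+ 2) t = rank (~: S) (fun k : 'I_n => k.+1%:R ^+ 2 : R) (p t).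
Proof.
move=> tS; have /andP [_ pS] := Sap.
rewrite -rank_perm => [|y]; last by rewrite (perm_closed y pS).
have uE y : y \notin S -> u y ^+ 2 = (p y).+1%:R ^+ 2.
  by move/code_leader => [b /code_point_sqr].
apply: eq_card => y; rewrite !inE; case: (boolP (y \in S)) => //= yS.
by rewrite !uE.
Qed.
End OneCode.

(** The ties of the face determine S, ties and signs then determine a, and the ranking of the
    squares outside S determines p. *)
Lemma code_face_inj :
  {in is_code &, injective (fun c => the_face (\col_j code_point c j))}.
Proof.
move=> [S [a p]] [S' [a' p']] h h' /the_faceP uu'.
set u := code_point _ in uu'; set u' := code_point _ in uu'.
have ties : same_ties u u'.
  by move=> i j; have := same_face_ties uu' i j; rewrite !mxE.
have eSS : S = S'.
  by apply: setC_inj; rewrite -(first_squares_code h) (same_ties_first ties) first_squares_code.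
subst S'; have /same_faceP [sgE ltE] := uu'.
have ea : a = a'.
  apply/ffunP=> j; have := same_ties_eq0 j ties; rewrite !code_point_eq0.
  have := sgE j; rewrite !mxE /u /u' /code_point /=.
  case aj: (a j) => [[t b]|]; case a'j: (a' j) => [[t' b']|] //= sg_j _.
  have [tS _] := code_targets h aj; have [t'S _] := code_targets h' a'j.
  have -> : t = t'.
    apply: (first_squares_inj (y := u')); rewrite ?first_squares_code ?inE //.
    rewrite -(code_point_leader h' a'j); apply/eqP.
    by rewrite eq_sym -(same_ties_sqr _ _ ties) (code_point_leader h aj).
  congr (Some (_, _)); move: sg_j; rewrite !sgrM !(gtr0_sg (ltr0Sn _ _)) !mulr1.
  case: b {aj}; case: b' {a'j} => //; rewrite sgrN sgr1 => /eqP.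
    by rewrite eqNr oner_eq0.
  by rewrite eq_sym eqNr oner_eq0.
have ep : p = p'.
  have /andP [_ pS] := h; have /andP [_ p'S] := h'.
  apply/permP=> t; case: (boolP (t \in S)) => [tS|tS].
    by rewrite !(out_perm (S := ~: S)) // inE tS.
  apply: succ_sqr_inj.
  apply: (@rank_eq _ _ _ (~: S) (fun k : 'I_n => k.+1%:R ^+ 2 : R));
    rewrite ?(perm_closed _ pS, perm_closed _ p'S) ?inE //.
  rewrite -(rank_code h tS) -(rank_code h' tS); apply: eq_rank => i j.
  by have := ltE i j; rewrite !mxE.
by rewrite ea ep.
Qed.

Lemma count_le_faces : (\sum_(S : {set 'I_n}) size (box S n) <= #|{: face R n}|)%N.
Proof.
rewrite -card_codes -(card_in_imset code_face_inj) cardT -cardE; exact: max_card.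
Qed.
End FaceCount.

Theorem corollary4p25 (R : realType) (n : nat) (hn : (1 <= n)%N) :
  gmod_iso (SR_gmodule (complex R) n)
           (tensor_det (OP_gmodule R n (complex R))).
Proof.
have [pt [pt_power pt_inj pt_act]] := equivariant_points R (complex R) n.
exact: (gmod_iso_of_points pt_power pt_inj pt_act (count_le_faces R n)).
Qed.
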